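(* Let $\mathfrak R\subset\mathbb C$ be a finitely generated $\mathbb Z$-algebra with quotient field $\mathfrak k$, $\mathsf T$ an $\mathfrak R$-scheme, $\mathsf t$ an $\mathfrak R$-valued smooth point of $\mathsf T$, and $\mathsf v$ a vector field in $\mathsf T$ with $\mathsf v(\mathsf t)\ne0$. Assume moreover that there is a function $z\in\mathcal O_{\mathsf T}$ such that $z(\mathsf t)=0$ and $\mathsf v(z)=1$. If the solution $\varphi$ of $\mathsf v$ through $\mathsf t$ is algebraic, then there is a nonzero $N\in\mathfrak R$ such that for all $m\in\mathbb N$ the composition $$\frac{N^m\mathsf v^m}{m!}(\mathsf t):\ \mathcal O_{\mathsf T_{\mathfrak k},\mathsf t}\to\mathcal O_{\mathsf T_{\mathfrak k},\mathsf t}\xrightarrow{\ \mathsf t\ }\mathfrak k$$ is defined over $\mathfrak R$, that is, it sends $\mathcal O_{\mathsf T}$ to $\mathfrak R$. If all the solutions of $\mathsf v$ are algebraic, then there is $N\in\mathbb N$ such that for all $m\in\mathbb N$ the map $$\frac{N^m\mathsf v^m}{m!}:\ \mathcal O_{\mathsf T}\to\mathcal O_{\mathsf T}$$ is well-defined, that is, its image is in $\mathcal O_{\mathsf T}$.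
   Context: By an $\mathfrak R$-scheme is meant an affine scheme $\mathsf T=\mathrm{Spec}(\mathsf R)$ with $\mathsf R$ a finitely generated ring extension of $\mathfrak R$; $\mathcal O_{\mathsf T}=\mathsf R$, and $\mathsf T_{\mathfrak k}=\mathsf T\times_{\mathfrak R}\mathrm{Spec}\,\mathfrak k$. An $\mathfrak R$-valued point is an $\mathfrak R$-algebra morphism $\mathsf t:\mathsf R\to\mathfrak R$, and $f(\mathsf t):=\mathsf t(f)$. It is smooth if, with $\mathfrak R_{\mathbb Q}=\mathfrak R\otimes_{\mathbb Z}\mathbb Q$, there are local holomorphic coordinates $z_1,\dots,z_n$ at $\mathsf t$ freely generating the ring $\mathcal O_{\mathsf T^{hol}_{\mathfrak R_{\mathbb Q}},\mathsf t}$ of germs at $\mathsf t$ of holomorphic functions with coefficients in $\mathfrak R_{\mathbb Q}$ (convergent power series in the $z_i$). A vector field is an $\mathfrak R$-linear derivation $\mathsf v:\mathcal O_{\mathsf T}\to\mathcal O_{\mathsf T}$; $\mathsf v^m$ is its $m$-fold iterate; $\mathsf v(\mathsf t)$ is the map $\mathsf t\circ\mathsf v$ on $\mathfrak m/\mathfrak m^2$, $\mathfrak m=\ker\mathsf t$. The solution of $\mathsf v$ through $\mathsf t$ is the unique holomorphic map germ $\varphi:(\mathbb A^1,0)\to(\mathsf T,\mathsf t)$, $\varphi(0)=\mathsf t$ (defined over $\mathfrak R_{\mathbb Q}$), mapping the vector field $\frac{\partial}{\partial s}$ ($s$ the coordinate of $\mathbb A^1$) to $\mathsf v$. It is algebraic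 if $f\circ\varphi$ is an algebraic function of $s$ for every $f\in\mathcal O_{\mathsf T}$. ''All the solutions'' refers to the solutions through all smooth points at which $\mathsf v$ does not vanish.
   Formalization: In the second claim T_k is assumed reduced (false otherwise: Z[x,z,e]/(xe,e²), v=∂_z+e∂_e), ''all the solutions'' means those through all smooth complex points where v does not vanish, and ''image in O_T'' is read inside O_{T_k}. *)

(* Defs.v *)
(* The field of complex numbers is K[i] for an arbitrary K : realType. *)
From HB Require Import structures.
From mathcomp Require Import all_boot all_order all_algebra.
From mathcomp Require Import reals complex mpoly.

Set Implicit Arguments.
Unset Strict Implicit.
Unset Printing Implicit Defensive.

Import GRing.Theory Num.Theory.
Local Open Scope ring_scope.

(* The family g generates the ring S over the scalars k, along phi : k -> S. *)
Definition generates (k S : nzRingType) (phi : k -> S) (n : nat)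
    (g : 'I_n -> S) : Prop :=
  forall s : S, exists p : {mpoly k[n]}, mmap phi g p = s.

Definition finitely_generated_over_Z (A : nzRingType) : Prop :=
  exists (n : nat) (g : 'I_n -> A), generates (intr : int -> A) g.

(* A subring of the complex numbers is given by its membership predicate D;
   D_Q is D tensored with the rational numbers. *)
Definition over_Q (C : fieldType) (D : C -> Prop) (c : C) : Prop :=
  exists (a : C) (q : nat), [/\ D a, q != 0%N & c = a / q%:R].

(** ** Power series in n variables *)

Section Series.
Variable C : numFieldType.

Definition series (n : nat) : Type := 'X_{1..n} -> C.

(* Absolute convergence on some polydisc of radius r > 0: the partial sums of
   nonnegative terms are bounded. *)
Definition convergent n (F : series n) : Prop :=
  exists r M : C, 0 < r /\
    forall d : nat, \sum_(m : 'X_{1..n < d}) `|F m| * r ^+ mdeg m <= M.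

(* Germs at the origin of holomorphic functions with coefficients in D_Q. *)
Definition hol (D : C -> Prop) n (F : series n) : Prop :=
  (forall m, over_Q D (F m)) /\ convergent F.

Definition sone n : series n := fun m => (m == 0%MM)%:R.

Definition smul n (F G : series n) : series n := fun m =>
  \sum_(k : 'X_{1..n < (mdeg m).+1, (mdeg m).+1} | m == (k.1 + k.2)%MM)
    F k.1 * G k.2.

Definition smonom r n (z : 'I_r -> series n) (a : 'X_{1..r}) : series n :=
  \big[@smul n/@sone n]_(i < r) iter (a i) (smul (z i)) (@sone n).

(* G(z_1, ..., z_r).  Only meant for z_i without constant term: then z^a has
   no monomial of degree less than |a|, and the sum below is complete. *)
Definition scomp r n (G : series r) (z : 'I_r -> series n) : series n :=
  fun m => \sum_(a : 'X_{1..r < (mdeg m).+1}) G a * smonom z a m.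

End Series.

(** ** Power series in the coordinate s of the affine line *)

Section Series1.
Variable C : numFieldType.

Definition convergent1 (u : nat -> C) : Prop :=
  exists r M : C, 0 < r /\
    forall d : nat, \sum_(m < d) `|u m| * r ^+ m <= M.

Definition hol1 (D : C -> Prop) (u : nat -> C) : Prop :=
  (forall m, over_Q D (u m)) /\ convergent1 u.

Definition mul1 (u w : nat -> C) : nat -> C := fun m =>
  \sum_(i < m.+1) u i * w (m - i)%N.

Definition const1 (c : C) : nat -> C := fun m => if m is 0%N then c else 0.

Definition exp1 (u : nat -> C) (k : nat) : nat -> C := iter k (mul1 u) (const1 1).

Definition deriv1 (u : nat -> C) : nat -> C := fun m => u m.+1 *+ m.+1.

(* P(s, u(s)) = 0 for some nonzero P; the coefficients of P : C[s][y] are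
   the polynomials P`_k in s. *)
Definition algebraic1 (u : nat -> C) : Prop :=
  exists P : {poly {poly C}}, P != 0 /\
    forall m : nat,
      \sum_(k < size P) mul1 (fun i => (P`_k)`_i) (exp1 u k) m = 0.

End Series1.

(** ** Schemes over a subring of the complex numbers *)

Section Scheme.
Variables (C : numFieldType) (A : comNzRingType) (iota : {rmorphism A -> C}).
Variable O : comAlgType A.

Definition image_iota (c : C) : Prop := exists a : A, c = iota a.
Definition all_scalars (c : C) : Prop := True.

(* The generators g embed T = Spec O in an affine space, with defining ideal
   the p such that p(g) = 0. *)
Section Germs.
Variables (n : nat) (g : 'I_n -> O).

Definition relation (p : {mpoly A[n]}) : Prop :=
  mmap (in_alg O : A -> O) g p = 0.

(* Expansion of the polynomial p around the point (x(g_1), ..., x(g_n)). *)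
Definition taylor (x : O -> C) (p : {mpoly A[n]}) : series C n := fun m =>
  (map_mpoly iota p \mPo [tuple 'X_i + (x (g i))%:MP | i < n])@_m.

(* The ideal generated by the defining ideal of T in the ring of germs of
   holomorphic functions at x with coefficients in D_Q; the quotient is the
   ring of germs of holomorphic functions on T at x. *)
Definition hol_ideal (D : C -> Prop) (x : O -> C) (F : series C n) : Prop :=
  exists (l : nat) (G : 'I_l -> series C n) (p : 'I_l -> {mpoly A[n]}),
    [/\ forall j, hol D (G j),
        forall j, relation (p j) &
        forall m, F m = \sum_(j < l) smul (G j) (taylor x (p j)) m].

(* Some z_1, ..., z_r vanishing at x freely generate the ring of germs:
   G |-> G(z_1, ..., z_r) is onto, and has no kernel. *)
Definition smooth_at (D : C -> Prop) (x : O -> C) : Prop :=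
  exists (r : nat) (z : 'I_r -> series C n),
    [/\ forall i, hol D (z i) /\ z i 0%MM = 0,
        forall F : series C n, hol D F ->
          exists2 G : series C r, hol D G &
            hol_ideal D x (fun m => F m - scomp G z m) &
        forall G : series C r, hol D G -> hol_ideal D x (scomp G z) ->
          forall m, G m = 0].

End Germs.

Definition derivation (v : O -> O) : Prop :=
  forall f h : O, v (f * h) = v f * h + f * v h.

(* The functions on the base change of T to D are the sums of the b_i f_i with
   b_i in D and f_i in O; one of them, in the maximal ideal of x, has a
   derivative along v which does not vanish at x. *)
Definition nonvanishing_at (D : C -> Prop) (v : O -> O) (x : O -> C) : Prop :=
  exists (l : nat) (b : 'I_l -> C) (f : 'I_l -> O),
    [/\ forall i, D (b i),
        \sum_(i < l) b i * x (f i) = 0 &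
        \sum_(i < l) b i * x (v (f i)) != 0].

(* phi f is the germ of f \o phi : a holomorphic map germ from (A^1, 0) to
   (T, x) is a morphism of algebras from O to convergent power series. *)
Definition solution (D : C -> Prop) (v : O -> O) (x : O -> C)
    (phi : O -> nat -> C) : Prop :=
  [/\ [/\ forall f, hol1 D (phi f),
          forall (a : A) m, phi (a%:A) m = const1 (iota a) m,
          forall f h m, phi (f + h) m = phi f m + phi h m &
          forall f h m, phi (f * h) m = mul1 (phi f) (phi h) m],
      forall f, phi f 0%N = x f &
      forall f m, phi (v f) m = deriv1 (phi f) m].

Definition algebraic_solution (phi : O -> nat -> C) : Prop :=
  forall f : O, algebraic1 (phi f).

(* Equality of the images of f and h in O_{T_k}, the tensor product of O with
   the quotient field k of A. *)
Definition eq_generic (f h : O) : Prop :=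
  exists2 b : A, b != 0 & b *: f = b *: h.

Definition generically_reduced : Prop :=
  forall (f : O) (m : nat), eq_generic (f ^+ m) 0 -> eq_generic f 0.

End Scheme.

(* Main.v *)
Require Import Defs.
From HB Require Import structures.
From mathcomp Require Import all_boot all_order all_algebra.
From mathcomp Require Import boolp classical_sets reals complex mpoly.
From mathcomp Require Import zify ring lra.

Import Order.TTheory GRing.Theory Num.Theory.
Local Open Scope ring_scope.

(** The solution of [v] through a point [x] is the morphism that maps [f] to the
    series with coefficients [x (v^m f) / m!] (the Taylor formula), so both claims
    concern the denominators of the coefficients of an algebraic power series.

    For the first claim these are bounded by Eisenstein's theorem (eisenstein): an
    algebraic series [u] with coefficients in the fraction field of a ring [D] and
    [u(0)] in [D] has a nonzero [N] in [D] such that all [N^m u_m] lie in [D].  One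
    descends an equation of [u] to [D], makes it a simple root, and substitutes
    [s -> c^2 s] in Newton's recursion for the coefficients.  A common [N] for the
    generators of [O] works for all functions (solution_integral).

    For the second claim, [N] has to be an integer, and the solutions are known to be
    algebraic only through smooth complex points.  Let [P] be a prime ideal of [O]
    such that the local ring at [P] is a field.  Since the complex numbers have
    infinite transcendence degree over the finitely generated ring [A], there is a
    complex point [x] with kernel exactly [P].  It is smooth
    (smooth_generic_point): one adjoins the generators of [O] one at a time, and
    continues the algebraic ones to convergent series of the transcendental ones by
    Hensel's lemma.  The solution through [x] exists, as its formal series converges
    (solution_convergent), and it is algebraic by assumption.  Eisenstein's theorem
    for the ring [O/P] then provides [M] outside [P] such that [M^m v^m/m!] maps [O]
    to [O] modulo [P].

    As [O] is noetherian and reduced up to torsion, such [M] for the minimal primes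
    [P] combine to one nonzerodivisor [N] such that [N^m v^m/m!] preserves [O]
    (nonzerodivisor_denominator).  The passage to an integer is possible because the
    only denominators at stake are factorials: [O/N O] has integral torsion only
    for finitely many primes; for a prime not among these, [N^m] can be cancelled
    modulo its powers, and the other primes divide [m!] at most [m] times
    (integral_denominator). *)

Set Implicit Arguments.
Unset Strict Implicit.
Unset Printing Implicit Defensive.

(** * Noetherian rings *)

(** Ideals are predicates in [Prop]: those that occur below, kernels of maps to
    the complex numbers and annihilators modulo torsion, are not decidable. *)
Definition ideal (R : comNzRingType) (I : R -> Prop) : Prop :=
  [/\ I 0, forall a b, I a -> I b -> I (a + b) & forall c a, I a -> I (c * a)].

(** The least ideal containing [s], without mention of coefficients. *)
Definition generated (R : comNzRingType) (s : seq R) (f : R) : Prop :=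
  forall J : R -> Prop, ideal J -> (forall a, a \in s -> J a) -> J f.

Definition noetherian (R : comNzRingType) : Prop :=
  forall I : R -> Prop, ideal I ->
    exists2 s : seq R, forall a, a \in s -> I a & forall f, I f -> generated s f.

Lemma idealN (R : comNzRingType) (I : R -> Prop) a : ideal I -> I a -> I (- a).
Proof. by case=> _ _ IM Ia; rewrite -mulN1r; apply: IM. Qed.

Lemma idealB (R : comNzRingType) (I : R -> Prop) a b :
  ideal I -> I a -> I b -> I (a - b).
Proof. by move=> iI Ia Ib; case: (iI) => _ ID _; apply: ID => //; apply: idealN. Qed.

Lemma ideal_sum (R : comNzRingType) (I : R -> Prop) (J : Type) (r : seq J)
    (P : pred J) (F : J -> R) :
  ideal I -> (forall j, P j -> I (F j)) -> I (\sum_(j <- r | P j) F j).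
Proof. by case=> I0 ID _ IF; elim/big_ind: _ => // a b; apply: ID. Qed.

Lemma generated_ideal (R : comNzRingType) (s : seq R) : ideal (generated s).
Proof.
split.
- by move=> J [].
- by move=> a b ga gb J iJ sJ; case: (iJ) => _ JD _; apply: JD; [apply: ga|apply: gb].
- by move=> c a ga J iJ sJ; case: (iJ) => _ _; apply; apply: ga.
Qed.

Lemma generatedS (R : comNzRingType) (s1 s2 : seq R) f :
  {subset s1 <= s2} -> generated s1 f -> generated s2 f.
Proof. by move=> sub g1 J iJ J2; apply: g1 => // a /sub; apply: J2. Qed.

Lemma noetherian_quotient (R S : comNzRingType) (phi : {rmorphism R -> S}) :
  (forall s, exists r, phi r = s) -> noetherian R -> noetherian S.
Proof.
move=> surj nR I iI.
have pre J : ideal J -> ideal (fun r => J (phi r)).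
  case=> J0 JD JM; split=> [|a b|c a]; first by rewrite rmorph0.
    by rewrite rmorphD; apply: JD.
  by rewrite rmorphM; apply: JM.
have [s sI sg] := nR _ (pre I iI).
exists (map phi s) => [a /mapP[b bs ->]|f]; first exact: sI.
have [r <-] := surj f => Ir J iJ sJ.
by apply: (sg r Ir) (pre J iJ) _ => a sa; apply: sJ; apply: map_f.
Qed.

Lemma int_noetherian : noetherian int.
Proof.
move=> I iI; case: (iI) => I0 ID IM.
have [[n [n0 In]]|no] := pselect (exists n : nat, (0 < n)%N /\ I n%:Z); last first.
  exists [::] => // f If J [J0 _ _] _.
  suff -> : f = 0 by [].
  apply: contra_notP no => /eqP f0; exists `|f|%N; split; first lia.
  rewrite -[_%:Z]/(`|f|%:Z) abszE normrEsg; exact: IM.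
have ex : exists n : nat, (0 < n)%N && `[< I n%:Z >].
  by exists n; rewrite n0; apply/asboolP.
case: (ex_minnP ex) => k /andP[k0 /asboolP Ik] kmin.
exists [:: k%:Z] => [a|f If J [J0 JD JM] sJ].
  by rewrite inE => /eqP ->.
have Jk : J k%:Z by apply: sJ; rewrite inE.
suff -> : f = (f %/ k)%Z * k%:Z by apply: JM.
rewrite [LHS](divz_eq f k) -[RHS]addr0; congr (_ + _).
have Ir : I (f %% k)%Z.
  have -> : (f %% k)%Z = f - (f %/ k)%Z * k%:Z by rewrite /modz.
  by apply: idealB => //; apply: IM.
apply/eqP; apply: contraT => r0.
have r_ge0 : 0 <= (f %% k)%Z by apply: modz_ge0; lia.
have r_lt : ((f %% k)%Z < k%:Z)%R by apply: ltz_pmod; lia.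
have /kmin : (0 < `|(f %% k)%Z|)%N && `[< I `|(f %% k)%Z|%N%:Z >].
  by rewrite absz_gt0 r0; apply/asboolP; rewrite gez0_abs.
lia.
Qed.

Lemma leading_ideal (R : comNzRingType) (I : {poly R} -> Prop) (d : nat) :
  ideal I -> ideal (fun a => exists f, [/\ I f, (size f <= d.+1)%N & f`_d = a]).
Proof.
case=> I0 ID IM; split.
- by exists 0; rewrite size_poly0 coef0.
- move=> a b [f [If sf <-]] [h [Ih sh <-]]; exists (f + h); split.
  + exact: ID.
  + by rewrite (leq_trans (size_polyD _ _)) // geq_max sf.
  + by rewrite coefD.
- move=> c a [f [If sf <-]]; exists (c *: f); split.
  + by rewrite -mul_polyC; apply: IM.
  + by rewrite (leq_trans (size_scale_leq _ _)).
  + by rewrite coefZ.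
Qed.

Lemma lift_seq (T U : eqType) (rel : T -> U -> Prop) (s : seq T) :
  (forall a, a \in s -> exists b, rel a b) ->
  exists2 t : seq U, forall a, a \in s -> exists2 b, b \in t & rel a b
                   & forall b, b \in t -> exists2 a, a \in s & rel a b.
Proof.
elim: s => [|a s IH] ex; first by exists [::].
have [|t t1 t2] := IH; first by move=> x xs; apply: ex; rewrite inE xs orbT.
have [b ab] := ex a (mem_head _ _).
exists (b :: t) => [x|y]; rewrite inE => /orP[/eqP ->|].
- by exists b; rewrite ?mem_head.
- by move=> /t1[y yt xy]; exists y; rewrite // inE yt orbT.
- by exists a; rewrite ?mem_head.
- by move=> /t2[x xs xy]; exists x; rewrite // inE xs orbT.
Qed.

(** Hilbert's basis theorem.  The leading coefficients of all elements of [I]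
    are generated by those of finitely many elements, of degree at most some
    [D]; adding generators for the leading coefficients in each degree less
    than [D], one can cancel the leading term of any element of [I]. *)
Lemma poly_noetherian (R : comNzRingType) :
  noetherian R -> noetherian {poly R}.
Proof.
move=> nR I iI; case: (iI) => I0 ID IM.
pose lead (J : {poly R} -> Prop) d a :=
  exists f, [/\ J f, (size f <= d.+1)%N & f`_d = a].
have leadW J d e a : ideal J -> (d <= e)%N -> lead J d a -> lead J e a.
  move=> [J0 JD JM] de [f [If sf fa]]; exists ('X^(e - d) * f); split.
  - exact: JM.
  - by rewrite (leq_trans (size_polyMleq _ _)) // size_polyXn; lia.
  - by rewrite coefXnM ltnNge leq_subr /= subKn.
have inf_ideal : ideal (fun a => exists d, lead I d a).
  split.
  - by exists 0%N, 0; rewrite size_poly0 coef0.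
  - move=> a b [d Ia] [e Ib]; exists (maxn d e).
    have [_ LD _] := leading_ideal (maxn d e) iI.
    by apply: LD; [apply: leadW iI (leq_maxl d e) Ia|
                   apply: leadW iI (leq_maxr d e) Ib].
  - by move=> c a [d Ia]; exists d; have [_ _ LM] := leading_ideal d iI; apply: LM.
have [s sI sg] := nR _ inf_ideal.
have [|t t1 t2] := @lift_seq _ _ (fun a f => exists d,
   [/\ I f, (size f <= d.+1)%N & f`_d = a]) s.
  by move=> a /sI[d [f If]]; exists f, d.
have [D sD] : exists D, forall a, a \in s -> lead (generated t) D a.
  have aux (s' : seq R) : {subset s' <= s} ->
      exists D, forall a, a \in s' -> lead (generated t) D a.
    elim: s' => [|a s' IH] sub; first by exists 0%N.
    have [|D HD] := IH; first by move=> x xs; apply: sub; rewrite inE xs orbT.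
    have [f ft [d [If sf fa]]] := t1 a (sub _ (mem_head _ _)).
    exists (maxn d D) => x; rewrite inE => /orP[/eqP ->|xs].
      apply: leadW (generated_ideal _) (leq_maxl _ _) _; exists f; split=> //.
      by move=> J _; apply.
    exact: leadW (generated_ideal _) (leq_maxr _ _) (HD _ xs).
  by apply: aux.
have low d : exists2 u : seq {poly R}, forall f, f \in u -> I f &
    forall f, I f -> (size f <= d.+1)%N -> lead (generated u) d f`_d.
  have [v vI vg] := nR _ (leading_ideal d iI).
  have [|u u1 u2] := @lift_seq _ _ (fun a f =>
     [/\ I f, (size f <= d.+1)%N & f`_d = a]) v; first by move=> a /vI.
  exists u => [f /u2[a _ []]//|f If sf].
  apply: vg; first by exists f.
    exact/leading_ideal/generated_ideal.
  move=> a /u1[h hu [Ih sh ha]]; exists h; split=> //.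
  by move=> J _; apply.
have [u uI ug] : exists2 u : seq {poly R}, forall f, f \in u -> I f &
    forall d f, (d < D)%N -> I f -> (size f <= d.+1)%N ->
      lead (generated u) d f`_d.
  elim: (D) => [|k [u uI ug]]; first by exists [::].
  have [w wI wg] := low k; exists (u ++ w) => [f|d f].
    by rewrite mem_cat => /orP[/uI|/wI].
  rewrite ltnS leq_eqVlt => /orP[/eqP ->|dk] If sf.
    have [h [gh sh hf]] := wg f If sf; exists h; split=> //.
    by apply: generatedS gh => x; rewrite mem_cat => ->; rewrite orbT.
  have [h [gh sh hf]] := ug d f dk If sf; exists h; split=> //.
  by apply: generatedS gh => x; rewrite mem_cat => ->.
exists (t ++ u) => [f|f].
  by rewrite mem_cat => /orP[/t2[a _ [d []]]|/uI].
have [k] := ubnP (size f); elim: k f => // k IH f; rewrite ltnS => sk If.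
have gI := generated_ideal (t ++ u); case: (gI) => g0 gD gM.
have [f0|f0] := posnP (size f).
  by move/eqP: f0; rewrite size_poly_eq0 => /eqP ->; apply: g0.
set d := (size f).-1; have sd : size f = d.+1 by rewrite /d prednK.
have [h [gh sh hf]] : lead (generated (t ++ u)) d f`_d.
  have [dD|Dd] := ltnP d D.
    have [|h [gh sh hf]] := ug d f dD If; first by rewrite sd.
    exists h; split=> //.
    by apply: generatedS gh => x; rewrite mem_cat => ->; rewrite orbT.
  have [h [gh sh hf]] : lead (generated t) d f`_d; last first.
    exists h; split=> //.
    by apply: generatedS gh => x; rewrite mem_cat => ->.
  apply: (sg f`_d); first by exists d, f; rewrite sd.
    exact/leading_ideal/generated_ideal.
  by move=> a /sD; apply: leadW => //; apply: generated_ideal.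
rewrite -[f](subrK h); apply: (gD) => //; apply: IH; last first.
  apply: idealB => //; apply: (gh I iI) => a.
  by rewrite mem_cat => /orP[/t2[b _ [e []]]|/uI].
apply: leq_ltn_trans (_ : d < k)%N; last by rewrite -sd.
apply/leq_sizeP => j; rewrite leq_eqVlt => /orP[/eqP <-|dj].
  by rewrite coefB hf subrr.
by rewrite coefB !nth_default ?subr0 // ?sd // (leq_trans sh).
Qed.

(** A chain of ideals without a largest element would have a union which is
    not finitely generated. *)
Lemma noetherian_max (R : comNzRingType) (T : Type) (F : T -> R -> Prop) (t0 : T) :
  noetherian R -> (forall t, ideal (F t)) ->
  exists t, forall t', (forall a, F t a -> F t' a) -> (forall a, F t' a -> F t a).
Proof.
move=> nR iF; apply: contrapT => nomax.
have step t : exists t', (forall a, F t a -> F t' a) /\ exists2 a, F t' a & ~ F t a.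
  apply: contrapT => no; apply: nomax; exists t => t' sub a Fa.
  by apply: contrapT => Fna; apply: no; exists t'; split=> //; exists a.
have [next nextP] := choice step.
pose c k := iter k next t0.
have cS k a : F (c k) a -> F (c k.+1) a by case: (nextP (c k)) => sub _; apply: sub.
have cW k l a : (k <= l)%N -> F (c k) a -> F (c l) a.
  by move=> kl; rewrite -(subnKC kl); elim: (l - k)%N => [|m IH] Fa;
    rewrite ?addn0 // addnS; apply: cS; apply: IH.
have [|s sU sg] := nR (fun a => exists k, F (c k) a).
  split.
  - by exists 0%N; case: (iF (c 0%N)).
  - move=> a b [k Fa] [l Fb]; exists (maxn k l).
    by case: (iF (c (maxn k l))) => _ FD _; apply: FD;
      [apply: cW Fa; exact: leq_maxl|apply: cW Fb; exact: leq_maxr].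
  - by move=> x a [k Fa]; exists k; case: (iF (c k)) => _ _; apply.
have [k sk] : exists k, forall a, a \in s -> F (c k) a.
  have: forall a, a \in s -> exists k, F (c k) a by [].
  elim: (s) => [|a s' IH] ex; first by exists 0%N.
  have [|k Hk] := IH; first by move=> x xs; apply: ex; rewrite inE xs orbT.
  have [l Hl] := ex a (mem_head _ _).
  exists (maxn k l) => x; rewrite inE => /orP[/eqP ->|xs].
    by apply: cW Hl; exact: leq_maxr.
  by apply: cW (Hk _ xs); exact: leq_maxl.
case: (nextP (c k)) => _ [a Fa]; apply.
by apply: (sg a) => //; exists k.+1.
Qed.

(** * Iterated polynomial rings *)

Section Tower.

Fixpoint tower (A : comNzRingType) (n : nat) : comNzRingType :=
  if n is m.+1 then {poly (tower A m)} else A.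

(** The tower adjoins one variable at a time, and so allows one to extend several
    morphisms from the same ring simultaneously, generator by generator. *)
Fixpoint tower_eval (A S : comNzRingType) (f : {rmorphism A -> S}) (k : nat -> S)
    (n : nat) : {rmorphism tower A n -> S} :=
  match n return {rmorphism tower A n -> S} with
  | 0 => f
  | m.+1 => GRing.RMorphism.clone _ _
              (horner_eval (k m) \o map_poly (tower_eval f k m)) _
  end.

Variables (A : comNzRingType).

Lemma tower_evalS (S : comNzRingType) (f : {rmorphism A -> S}) k n
    (q : {poly (tower A n)}) :
  tower_eval f k n.+1 q = (map_poly (tower_eval f k n) q).[k n].
Proof. by []. Qed.

Lemma tower_evalC (S : comNzRingType) (f : {rmorphism A -> S}) k n (r : tower A n) :
  tower_eval f k n.+1 (r%:P : {poly (tower A n)}) = tower_eval f k n r.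
Proof. by rewrite tower_evalS map_polyC hornerC. Qed.

Lemma tower_evalX (S : comNzRingType) (f : {rmorphism A -> S}) k n :
  tower_eval f k n.+1 ('X : {poly (tower A n)}) = k n.
Proof. by rewrite tower_evalS map_polyX hornerX. Qed.

Lemma eq_tower_eval (S : comNzRingType) (f f' : {rmorphism A -> S}) k k' n r :
  f =1 f' -> (forall j, (j < n)%N -> k j = k' j) ->
  tower_eval f k n r = tower_eval f' k' n r.
Proof.
move=> ff; elim: n r => [|n IH] r kk; first exact: ff.
rewrite !tower_evalS kk // (eq_map_poly (g := tower_eval f' k' n)) // => p.
by apply: IH => j jn; apply: kk; apply: ltnW.
Qed.

Lemma rmorph_tower_eval (S S' : comNzRingType) (e : {rmorphism S -> S'})
    (f : {rmorphism A -> S}) (f' : {rmorphism A -> S'}) k n r :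
  (forall a, e (f a) = f' a) ->
  e (tower_eval f k n r) = tower_eval f' (e \o k) n r.
Proof.
move=> ff; elim: n r => [|n IH] r; first exact: ff.
rewrite !tower_evalS -horner_map -map_poly_comp; congr (_.[_]).
by apply: eq_map_poly => p /=; apply: IH.
Qed.

(** Again in [Prop]: the subrings of interest are images of morphisms, and rings of
    convergent series. *)
Definition subring (S : nzRingType) (D : S -> Prop) : Prop :=
  [/\ D 1, forall a b, D a -> D b -> D (a + b), forall a, D a -> D (- a)
    & forall a b, D a -> D b -> D (a * b)].

Section Subring.
Variables (S : nzRingType) (D : S -> Prop).
Hypothesis sD : subring D.

Lemma subring1 : D 1. Proof. by case: sD. Qed.
Lemma subringD a b : D a -> D b -> D (a + b). Proof. by case: sD => _ H _ _; apply: H. Qed.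
Lemma subringN a : D a -> D (- a). Proof. by case: sD => _ _ H _; apply: H. Qed.
Lemma subringM a b : D a -> D b -> D (a * b). Proof. by case: sD => _ _ _; apply. Qed.
Lemma subringB a b : D a -> D b -> D (a - b).
Proof. by move=> Da Db; apply: subringD => //; apply: subringN. Qed.
Lemma subring0 : D 0.
Proof. by rewrite -(subrr 1); apply: subringB; apply: subring1. Qed.
Lemma subringX a n : D a -> D (a ^+ n).
Proof.
by move=> Da; elim: n => [|n IH]; rewrite ?expr0 ?exprS;
  [apply: subring1|apply: subringM].
Qed.
Lemma subring_sum (J : Type) (r : seq J) (P : pred J) (F : J -> S) :
  (forall j, P j -> D (F j)) -> D (\sum_(j <- r | P j) F j).
Proof. by move=> DF; elim/big_ind: _ => //; [apply: subring0|apply: subringD]. Qed.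
Lemma subring_prod (J : Type) (r : seq J) (P : pred J) (F : J -> S) :
  (forall j, P j -> D (F j)) -> D (\prod_(j <- r | P j) F j).
Proof. by move=> DF; elim/big_ind: _ => //; [apply: subring1|apply: subringM]. Qed.
Lemma subring_nat n : D n%:R.
Proof.
elim: n => [|n IH]; first exact: subring0.
by rewrite -natr1; apply: subringD => //; apply: subring1.
Qed.
Lemma subring_horner (p : {poly S}) y : (forall i, D p`_i) -> D y -> D p.[y].
Proof.
move=> Dp Dy; rewrite horner_coef; apply: subring_sum => i _.
by apply: subringM => //; apply: subringX.
Qed.
End Subring.

Lemma subring_tower_eval (S : comNzRingType) (D : S -> Prop)
    (f : {rmorphism A -> S}) k n r :
  subring D -> (forall a, D (f a)) -> (forall j, (j < n)%N -> D (k j)) ->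
  D (tower_eval f k n r).
Proof.
move=> sD Df; elim: n r => [|n IH] r Dk; first exact: Df.
rewrite tower_evalS; apply: subring_horner => // [i|]; last exact: Dk.
by rewrite coef_map; apply: IH => j jn; apply: Dk; apply: ltnW.
Qed.

Lemma tower_noetherian n : noetherian A -> noetherian (tower A n).
Proof. by move=> nA; elim: n => //= n; apply: poly_noetherian. Qed.

Definition enumerable (T : Type) : Prop := exists e : nat -> T, forall t, exists i, e i = t.

Lemma enumerable_surj (T U : Type) (f : T -> U) :
  (forall u, exists t, f t = u) -> enumerable T -> enumerable U.
Proof.
move=> surj [e eP]; exists (f \o e) => u.
by have [t <-] := surj u; have [i <-] := eP t; exists i.
Qed.

Lemma enumerable_poly (R : comNzRingType) : enumerable R -> enumerable {poly R}.
Proof.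
case=> e eP.
exists (fun i => Poly (map e (odflt [::] (unpickle i : option (seq nat))))) => p.
have [s sp] : exists s, map e s = p.
  elim: (p : seq R) => [|a l [s <-]]; first by exists [::].
  by have [i <-] := eP a; exists (i :: s).
by exists (pickle s); rewrite pickleK /= sp polyseqK.
Qed.

Lemma enumerable_tower n : enumerable A -> enumerable (tower A n).
Proof. by move=> eA; elim: n => //= n; apply: enumerable_poly. Qed.

Definition extend0 (S : nmodType) n (k : 'I_n -> S) (j : nat) : S :=
  if insub j is Some i then k i else 0.

Lemma extend0E (S : nmodType) n (k : 'I_n -> S) (i : 'I_n) : extend0 k i = k i.
Proof. by rewrite /extend0 valK. Qed.

(** Ring morphisms evaluate the [mpoly] and its lift to the tower in the same way,
    hence inductions on the number of variables can take place in the tower. *)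
Lemma tower_mpoly n (p : {mpoly A[n]}) : exists r : tower A n,
  forall (S : comNzRingType) (f : {rmorphism A -> S}) (k : 'I_n -> S),
    mmap f k p = tower_eval f (extend0 k) n r.
Proof.
have var m (i : nat) : (i < m)%N -> exists r : tower A m,
    forall (S : comNzRingType) (f : {rmorphism A -> S}) (k : nat -> S),
      tower_eval f k m r = k i.
  elim: m => // m IH; rewrite ltnS leq_eqVlt => /orP[/eqP ->|/IH[r Hr]].
    by exists ('X : {poly (tower A m)}) => S f k; rewrite tower_evalX.
  by exists (r%:P : {poly (tower A m)}) => S f k; rewrite tower_evalC.
have cst m (a : A) : exists r : tower A m,
    forall (S : comNzRingType) (f : {rmorphism A -> S}) (k : nat -> S),
      tower_eval f k m r = f a.
  elim: m => [|m [r Hr]]; first by exists a.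
  by exists (r%:P : {poly (tower A m)}) => S f k; rewrite tower_evalC.
pose Q (p : {mpoly A[n]}) := exists r : tower A n,
  forall (S : comNzRingType) (f : {rmorphism A -> S}) (k : 'I_n -> S),
    mmap f k p = tower_eval f (extend0 k) n r.
have QD p1 p2 : Q p1 -> Q p2 -> Q (p1 + p2).
  by move=> [r1 H1] [r2 H2]; exists (r1 + r2) => S f k; rewrite mmapD H1 H2 rmorphD.
have QM p1 p2 : Q p1 -> Q p2 -> Q (p1 * p2).
  by move=> [r1 H1] [r2 H2]; exists (r1 * r2) => S f k; rewrite [LHS]rmorphM [RHS]rmorphM -H1 -H2.
have QC a : Q a%:MP.
  by have [r Hr] := cst n a; exists r => S f k; rewrite Hr mmapC.
have QX i : Q 'X_i.
  have [r Hr] := var n i (ltn_ord i); exists r => S f k.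
  by rewrite Hr mmapX mmap1U extend0E.
rewrite -/(Q p) (mpolyE p); elim/big_ind: _ => // [|m _]; first by rewrite -mpolyC0.
rewrite -mul_mpolyC; apply: (QM) => //.
rewrite mpolyXE_id; elim/big_ind: _ => // [|i _]; first by rewrite -mpolyC1.
by elim: (m i) => [|l IH]; rewrite ?expr0 ?exprS -?mpolyC1 //; apply: QM.
Qed.

End Tower.

(** * Differences of values of a polynomial *)

Lemma subring_poly (S : nzRingType) (D : S -> Prop) :
  subring D -> subring (fun p : {poly S} => forall i, D p`_i).
Proof.
move=> sD; split.
- by move=> i; rewrite coef1; apply: subring_nat.
- by move=> p q Dp Dq i; rewrite coefD; apply: subringD.
- by move=> p Dp i; rewrite coefN; apply: subringN.
- by move=> p q Dp Dq i; rewrite coefM; apply: subring_sum => // j _; apply: subringM.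
Qed.

Lemma subring_comp_poly (S : comNzRingType) (D : S -> Prop) (p q : {poly S}) :
  subring D -> (forall i, D p`_i) -> (forall i, D q`_i) -> forall i, D (p \Po q)`_i.
Proof.
move=> sD Dp Dq; rewrite comp_polyE.
apply: (subring_sum (subring_poly sD)) => j _ i; rewrite coefZ; apply: subringM => //.
exact: (subringX (subring_poly sD)).
Qed.

Lemma deriv_neq0 (R : idomainType) (p : {poly R}) :
  (forall k, k.+1%:R != 0 :> R) -> (1 < size p)%N -> p^`() != 0.
Proof.
move=> char0 sp; apply/eqP => /(congr1 (fun q : {poly R} => q`_(size p).-2)).
have -> : p^`()`_(size p).-2 = lead_coef p *+ (size p).-1.
  by rewrite coef_deriv lead_coefE; move: sp; case: (size p) => [|[|k]].
have p0 : p != 0 by rewrite -size_poly_gt0 ltnW.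
move=> /eqP; rewrite coef0 -mulr_natl mulf_eq0 lead_coef_eq0 (negPf p0) orbF.
by case: (size p) sp => [|[|k]] // _; rewrite (negPf (char0 _)).
Qed.

(** First order expansion, with control of the constant term and of the
    coefficients of the cofactor.  When the derivative does not vanish the cofactor
    is invertible; after subtraction of the linear part it has no constant term,
    which makes iterations converge. *)
Lemma horner_diff (E F : comNzRingType) (ev : {rmorphism E -> F}) (q : {poly E}) y y' :
  exists U, [/\ q.[y] - q.[y'] = (y - y') * U,
    ev y = ev y' -> ev U = (map_poly ev q)^`().[ev y] &
    forall B : E -> Prop, subring B -> (forall i, B q`_i) -> B y -> B y' -> B U].
Proof.
elim/poly_ind: q => [|q c [U [UE Uev UB]]].
  exists 0; rewrite !horner0 subrr mulr0 !rmorph0 derivC horner0.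
  by split=> // B sB _ _ _; apply: subring0.
exists (U * y + q.[y']); split.
- rewrite !hornerMXaddC; have -> : q.[y] = q.[y'] + (y - y') * U by rewrite -UE addrC subrK.
  ring.
- move=> yy; rewrite !rmorphD !rmorphM /= Uev // map_polyX map_polyC /=.
  rewrite derivD derivC addr0 derivM derivX mulr1 hornerD hornerM hornerX.
  by rewrite -horner_map yy.
- move=> B sB Bq By By'.
  have Bq' i : B q`_i by have := Bq i.+1; rewrite coefD coefMX coefC /= addr0.
  by apply: subringD => //; [apply: subringM => //; apply: UB|apply: subring_horner].
Qed.

(** * Power series in one variable *)

Section PowerSeries.
Variable C : numFieldType.

Definition pseries : Type := nat -> C.

HB.instance Definition _ := gen_eqMixin pseries.
HB.instance Definition _ := gen_choiceMixin pseries.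

Implicit Types u v w : pseries.

Let trunc (d : nat) (u : pseries) : {poly C} := \poly_(i < d) u i.

Fact mul1_trunc d u w m : (m < d)%N -> mul1 u w m = (trunc d u * trunc d w)`_m.
Proof.
move=> md; rewrite coefM; apply: eq_bigr => i _; rewrite !coef_poly.
by rewrite !ifT //; have := ltn_ord i; lia.
Qed.

Fact coefM_eq (p q q' : {poly C}) m :
  (forall i, (i <= m)%N -> q`_i = q'`_i) -> (p * q)`_m = (p * q')`_m.
Proof. by move=> qq; rewrite !coefM; apply: eq_bigr => i _; rewrite qq // leq_subr. Qed.

Fact trunc_mul d u w m : (m < d)%N -> (trunc d (mul1 u w))`_m = (trunc d u * trunc d w)`_m.
Proof. by move=> md; rewrite coef_poly md -mul1_trunc. Qed.

Fact addpA : associative (fun u w : pseries => (fun i => u i + w i) : pseries).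
Proof. by move=> u v w; apply: funext => i; rewrite addrA. Qed.
Fact addpC : commutative (fun u w : pseries => (fun i => u i + w i) : pseries).
Proof. by move=> u v; apply: funext => i; rewrite addrC. Qed.
Fact add0p : left_id ((fun=> 0) : pseries) (fun u w : pseries => (fun i => u i + w i) : pseries).
Proof. by move=> u; apply: funext => i; rewrite add0r. Qed.
Fact addNp : left_inverse ((fun=> 0) : pseries) (fun u : pseries => (fun i => - u i) : pseries)
  (fun u w : pseries => (fun i => u i + w i) : pseries).
Proof. by move=> u; apply: funext => i; rewrite addNr. Qed.

HB.instance Definition _ := GRing.isZmodule.Build pseries addpA addpC add0p addNp.

Fact mulpC : commutative (@mul1 C : pseries -> pseries -> pseries).
Proof.
by move=> u w; apply: funext => m; rewrite !(@mul1_trunc m.+1) // mulrC.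
Qed.
Fact mulpA : associative (@mul1 C : pseries -> pseries -> pseries).
Proof.
move=> u v w; apply: funext => m; rewrite !(@mul1_trunc m.+1) //.
rewrite (@coefM_eq _ _ (trunc m.+1 v * trunc m.+1 w)); last first.
  by move=> i im; rewrite trunc_mul.
rewrite mulrA mulrC [in RHS]mulrC; apply: coefM_eq => i im.
by rewrite trunc_mul.
Qed.
Fact mul1p : left_id (const1 1 : pseries) (@mul1 C : pseries -> pseries -> pseries).
Proof.
move=> u; apply: funext => m; rewrite /mul1 big_ord_recl /= mul1r subn0.
by rewrite big1 ?addr0 // => i _; rewrite mul0r.
Qed.
Fact mulpDl : left_distributive (@mul1 C : pseries -> pseries -> pseries) +%R.
Proof.
move=> u v w; apply: funext => m; rewrite -[RHS]big_split /=.
by apply: eq_bigr => i _; rewrite -mulrDl.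
Qed.
Fact onep_neq0 : (const1 1 : pseries) != 0.
Proof. by apply/eqP => /(congr1 (fun u : pseries => u 0%N)) /eqP; rewrite oner_eq0. Qed.

HB.instance Definition _ :=
  GRing.Zmodule_isComNzRing.Build pseries mulpA mulpC mul1p mulpDl onep_neq0.

Lemma pseriesD u w m : (u + w) m = u m + w m. Proof. by []. Qed.
Lemma pseriesB u w m : (u - w) m = u m - w m. Proof. by []. Qed.
Lemma pseries0 m : (0 : pseries) m = 0. Proof. by []. Qed.
Lemma pseriesM u w m : (u * w) m = \sum_(i < m.+1) u i * w (m - i)%N.
Proof. by []. Qed.
Lemma pseries_sum (J : Type) (r : seq J) (P : pred J) (F : J -> pseries) m :
  (\sum_(j <- r | P j) F j) m = \sum_(j <- r | P j) F j m.
Proof. by elim/big_rec2: _ => // j x y _ <-. Qed.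
Lemma exp1E u k : exp1 u k = u ^+ k.
Proof. by elim: k => // k IH; rewrite exprS /exp1 iterS -/(exp1 u k) IH. Qed.

Definition pconst (c : C) : pseries := const1 c.

Lemma pconstM c u m : (pconst c * u) m = c * u m.
Proof.
rewrite pseriesM big_ord_recl /= subn0 big1 ?addr0 // => i _; exact: mul0r.
Qed.

Fact pconst_zmod : zmod_morphism pconst.
Proof. by move=> a b; apply: funext => -[|m] //; rewrite pseriesB subr0. Qed.
Fact pconst_monoid : monoid_morphism pconst.
Proof. by split=> // a b; apply: funext => -[|m]; rewrite pconstM // mulr0. Qed.
HB.instance Definition _ := GRing.isZmodMorphism.Build C pseries pconst pconst_zmod.
HB.instance Definition _ := GRing.isMonoidMorphism.Build C pseries pconst pconst_monoid.

Definition pseries_of (p : {poly C}) : pseries := fun i => p`_i.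

Fact pseries_of_zmod : zmod_morphism pseries_of.
Proof. by move=> p q; apply: funext => m; rewrite pseriesB /pseries_of coefB. Qed.
Fact pseries_of_monoid : monoid_morphism pseries_of.
Proof.
split=> [|p q]; apply: funext => m; first by case: m => [|m]; rewrite /pseries_of coef1.
by rewrite pseriesM /pseries_of coefM.
Qed.
HB.instance Definition _ := GRing.isZmodMorphism.Build {poly C} pseries pseries_of pseries_of_zmod.
HB.instance Definition _ :=
  GRing.isMonoidMorphism.Build {poly C} pseries pseries_of pseries_of_monoid.

Definition pvar (d : nat) : pseries := pseries_of 'X^d.

Lemma pvarD d e : pvar (d + e) = pvar d * pvar e.
Proof. by rewrite /pvar exprD rmorphM. Qed.

Lemma pvarM d u m : (pvar d * u) m = if (m < d)%N then 0 else u (m - d)%N.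
Proof.
rewrite -[LHS]/(mul1 _ u m) (@mul1_trunc m.+1) //.
rewrite mulrC (@coefM_eq _ _ 'X^d) => [|i im]; last by rewrite coef_poly ltnS im.
by rewrite coefMXn; case: ltnP => // dm; rewrite coef_poly ltnS leq_subr.
Qed.

Definition pshift (d : nat) u : pseries := fun i => u (d + i)%N.

Lemma pvar_shift d u : (forall i, (i < d)%N -> u i = 0) -> u = pvar d * pshift d u.
Proof.
move=> u0; apply: funext => m; rewrite pvarM; case: ltnP => [/u0 //|dm].
by rewrite /pshift subnKC.
Qed.

Lemma pvarM_shift d u : pshift d (pvar d * u) = u.
Proof.
by apply: funext => m; rewrite /pshift pvarM ltnNge leq_addr /= addKn.
Qed.

Definition pcoef0 (u : pseries) : C := u 0%N.

Fact pcoef0_zmod : zmod_morphism pcoef0. Proof. by []. Qed.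
Fact pcoef0_monoid : monoid_morphism pcoef0.
Proof. by split=> // u w; rewrite /pcoef0 pseriesM big_ord1. Qed.
HB.instance Definition _ := GRing.isZmodMorphism.Build pseries C pcoef0 pcoef0_zmod.
HB.instance Definition _ := GRing.isMonoidMorphism.Build pseries C pcoef0 pcoef0_monoid.

Definition pscale (t : C) (u : pseries) : pseries := fun i => t ^+ i * u i.

Fact pscale_zmod t : zmod_morphism (pscale t).
Proof. by move=> u w; apply: funext => m; rewrite /pscale !pseriesB mulrBr. Qed.
Fact pscale_monoid t : monoid_morphism (pscale t).
Proof.
split=> [|u w]; apply: funext => m.
  by case: m => [|m]; rewrite /pscale ?expr0 ?mul1r //; apply: mulr0.
rewrite /pscale !pseriesM mulr_sumr; apply: eq_bigr => i _.
have -> : t ^+ m = t ^+ i * t ^+ (m - i) by rewrite -exprD subnKC // -ltnS.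
by rewrite mulrACA.
Qed.
HB.instance Definition _ t := GRing.isZmodMorphism.Build pseries pseries (pscale t) (pscale_zmod t).
HB.instance Definition _ t :=
  GRing.isMonoidMorphism.Build pseries pseries (pscale t) (pscale_monoid t).

Section Subring.
Variable D : C -> Prop.
Hypothesis sD : subring D.

Definition pseries_over (u : pseries) : Prop := forall i, D (u i).

Lemma pseries_over_subring : subring pseries_over.
Proof.
split.
- by move=> [|i]; [apply: subring1|apply: subring0].
- by move=> u w Du Dw i; apply: subringD.
- by move=> u Du i; apply: subringN.
- by move=> u w Du Dw i; apply: subring_sum => // j _; apply: subringM.
Qed.

Lemma pconst_over c : D c -> pseries_over (pconst c).
Proof. by move=> Dc [|i] //; apply: subring0. Qed.

Lemma pvar_over d : pseries_over (pvar d).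
Proof. by move=> i; rewrite /pvar /pseries_of coefXn; apply: subring_nat. Qed.

Lemma pscale_over t u : D t -> pseries_over u -> pseries_over (pscale t u).
Proof. by move=> Dt Du i; apply: subringM => //; apply: subringX. Qed.

(** A solution of [y = - Phi(y)] has its coefficients in any ring containing
    those of [Phi], as the coefficient of degree [m] of [Phi(y)] involves only
    coefficients of [y] of degree less than [m]. *)
Lemma fixpoint_over (Phi : {poly pseries}) (y : pseries) :
  (forall k, pseries_over Phi`_k) -> y 0%N = 0 -> Phi`_1 0%N = 0 ->
  y + Phi.[y] = 0 -> pseries_over y.
Proof.
move=> DP y0 P10 eqy i; have [k] := ubnP i; elim: k i => // k IH i ik.
have [->|i0] := eqVneq i 0%N; first by rewrite y0; apply: subring0.
pose yt : pseries := fun j => if (j < i)%N then y j else 0.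
have Dyt : pseries_over yt.
  by move=> j; rewrite /yt; case: ltnP => ji; [apply: IH; lia|apply: subring0].
have [U [UE U0 _]] := horner_diff pcoef0 Phi y yt.
have yt0 : pcoef0 y = pcoef0 yt by rewrite /pcoef0 /yt; case: ifP.
have U00 : U 0%N = 0.
  rewrite -[LHS]/(pcoef0 U) U0 //=.
  rewrite [pcoef0 y]y0 horner_coef0 coef_deriv mulr1n coef_map /=; exact: P10.
have Ei : (Phi.[y] - Phi.[yt]) i = 0.
  rewrite UE pseriesM big_ord_recr /= subnn U00 mulr0 addr0 big1 // => j _.
  by rewrite pseriesB /yt ltn_ord subrr mul0r.
have -> : y i = - Phi.[yt] i.
  move/(congr1 (fun u : pseries => u i)): eqy Ei; rewrite pseriesB !pseriesD pseries0.
  by move=> /eqP; rewrite addr_eq0 => /eqP -> /eqP; rewrite subr_eq0 => /eqP ->.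
by apply: subringN => //; apply: (subring_horner pseries_over_subring DP Dyt).
Qed.

(** Newton's iteration in integral form.  Let [p] be the part of [u] of degree
    at most [e], and [u = p + s^e w]; expanding [P] at [p], the equation
    [P(u) = 0] is divisible by [s^(2e)], and becomes [c w + ... = 0], where the
    dots stand for terms of higher order.  The substitution [s -> c^2 s], with
    [w(c^2 s) = c y(s)], makes [c^2] a common factor of all the terms. *)
Lemma simple_root_over (P : {poly pseries}) (u : pseries) e (V0 : pseries) :
  (forall k, pseries_over P`_k) -> (forall i, (i <= e)%N -> D (u i)) ->
  P.[u] = 0 -> P^`().[u] = pvar e * V0 -> V0 0%N != 0 ->
  exists c, [/\ D c, c != 0 & forall m, (0 < m)%N -> D (c ^+ (2 * m) * u (e + m)%N)].
Proof.
move=> DP Du Pu dPu V00; have sP := pseries_over_subring.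
have sPP := subring_poly sP.
pose p : pseries := fun i => if (i <= e)%N then u i else 0.
pose w : pseries := fun i => if i is 0 then 0 else u (e + i)%N.
have uE : u = p + pvar e * w.
  apply: funext => i; rewrite pseriesD pvarM /p /w; case: ltngtP => [ie|ei|->].
  - by rewrite addr0.
  - by rewrite add0r; case E: (i - e)%N => [|k]; [lia|congr u; lia].
  - by rewrite subnn addr0.
have Dp : pseries_over p.
  by move=> i; rewrite /p; case: ifP => [/Du //|_]; apply: subring0.
pose r := P \Po ('X + p%:P).
have Dr k : pseries_over r`_k.
  apply: (subring_comp_poly sP) => // i; rewrite coefD coefX coefC.
  apply: (subringD sP); first by apply: (subring_nat sP).
  by case: eqP => // _; apply: (subring0 sP).
have rE y : r.[y] = r`_0 + r`_1 * y + (drop_poly 2 r).[y] * y ^+ 2.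
  rewrite -{1}(poly_take_drop 2 r) hornerD hornerM hornerXn; congr (_ + _).
  rewrite (horner_coef_wide _ (size_take_poly 2 r)) big_ord_recl big_ord1 /=.
  by rewrite !coef_take_poly expr0 expr1 mulr1.
have ru : r.[pvar e * w] = 0.
  by rewrite /r horner_comp hornerD hornerX hornerC addrC -uE.
have r1E : r`_1 = P^`().[p].
  have := coef_deriv r 0; rewrite mulr1n => <-.
  rewrite -horner_coef0 /r deriv_comp hornerM horner_comp hornerD hornerX hornerC add0r.
  by rewrite derivD derivX derivC addr0 hornerC mulr1.
have [U [UE _ _]] := horner_diff pcoef0 P^`() u p.
pose V := V0 - w * U.
have r1V : r`_1 = pvar e * V.
  rewrite r1E /V mulrBr -dPu mulrA.
  have -> : pvar e * w = u - p by rewrite uE addrC addKr.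
  by rewrite -UE opprB addrC subrK.
pose c := V 0%N.
have cE : c = V0 0%N.
  rewrite /c /V pseriesB -[(w * U) 0%N]/(pcoef0 (w * U)) rmorphM /=.
  by rewrite [pcoef0 w]/(0) mul0r subr0.
have DV i : D (V i).
  by have := Dr 1%N (e + i)%N; rewrite r1V -[_ (e + i)%N]/(pshift e _ i) pvarM_shift.
pose Z := - (V * w + (drop_poly 2 r).[pvar e * w] * w ^+ 2).
have r0Z : r`_0 = pvar (e + e) * Z.
  apply/eqP; rewrite -subr_eq0 -[X in _ == X]ru rE r1V /Z pvarD.
  by apply/eqP; ring.
have DZ i : D (Z i).
  by have := Dr 0%N (e + e + i)%N; rewrite r0Z -[_ (_ + i)%N]/(pshift _ _ i) pvarM_shift.
have Z0 : Z 0%N = 0.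
  rewrite -[LHS]/(pcoef0 Z) rmorphN rmorphD !rmorphM /= [pcoef0 w]/(0).
  by rewrite !mulr0 addr0 oppr0.
have c0 : c != 0 by rewrite cE.
have Dc : D c by exact: DV.
pose T := pscale (c ^+ 2).
pose y := pconst c^-1 * T w.
have TwE : T w = pconst c * y.
  by rewrite mulrA -rmorphM mulfV // rmorph1 mul1r.
pose V1 : pseries := fun i => if i is 0 then 0 else (c ^+ 2) ^+ i.-1 * V i.
pose Z1 : pseries := fun i => if i is 0 then 0 else (c ^+ 2) ^+ i.-1 * Z i.
have TV : T V = pconst c + pconst (c ^+ 2) * V1.
  apply: funext => -[|i]; rewrite pseriesD pconstM /T /pscale /V1.
    by rewrite mul1r mulr0 addr0.
  by rewrite exprS mulrA [pconst c _]/(0) add0r.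
have TZ : T Z = pconst (c ^+ 2) * Z1.
  apply: funext => -[|i]; rewrite pconstM /T /pscale /Z1; first by rewrite Z0 !mulr0.
  by rewrite exprS mulrA.
pose q := map_poly T (drop_poly 2 r).
pose kappa := T (pvar e) * pconst c.
pose Phi := Z1%:P + (pconst c * V1)%:P * 'X + (q \Po (kappa%:P * 'X)) * 'X^2.
have PhiE : Phi.[y] = Z1 + pconst c * V1 * y + q.[kappa * y] * y ^+ 2.
  by rewrite /Phi !(hornerD, hornerM, hornerC, hornerX, hornerXn, horner_comp).
have D2 : D (c ^+ 2) by apply: subringX.
have Dq k : pseries_over q`_k.
  by rewrite coef_map coef_drop_poly; apply: pscale_over.
have DV1 : pseries_over V1.
  by move=> [|i]; [apply: subring0|apply: subringM => //; apply: subringX].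
have DZ1 : pseries_over Z1.
  by move=> [|i]; [apply: subring0|apply: subringM => //; apply: subringX].
have DC (a : pseries) : pseries_over a -> forall k, pseries_over (a%:P)`_k.
  by move=> Da k; rewrite coefC; case: eqP => // _; apply: (subring0 sP).
have DX k : pseries_over ('X : {poly pseries})`_k.
  by rewrite coefX; apply: (subring_nat sP).
have Dkappa : pseries_over kappa.
  by apply: (subringM sP); [apply: pscale_over => //; apply: pvar_over|apply: pconst_over].
have DPhi k : pseries_over Phi`_k.
  move: k; apply: (subringD sPP); first apply: (subringD sPP).
  - exact: DC.
  - apply: (subringM sPP) => //; apply: DC; apply: (subringM sP) => //.
    exact: pconst_over.
  - apply: (subringM sPP); last exact: (subringX sPP).
    by apply: (subring_comp_poly sP) => //; apply: (subringM sPP) => //; apply: DC.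
have Dy : pseries_over y.
  apply: (fixpoint_over DPhi).
  - by rewrite /y pconstM /T /pscale /w !mulr0.
  - rewrite /Phi !coefD coefC coefCM coefX /= add0r mulr1 coefMXn /= addr0.
    by rewrite pconstM /V1 mulr0.
  - have E : T V * T w + q.[T (pvar e) * T w] * T w ^+ 2 + T Z = 0.
      have eqZ : V * w + (drop_poly 2 r).[pvar e * w] * w ^+ 2 + Z = 0 by rewrite subrr.
      rewrite -[RHS](rmorph0 (pscale (c ^+ 2))) -eqZ !rmorphD !rmorphM /=.
      by rewrite -horner_map /= !rmorphM /= expr2.
    rewrite TV TZ TwE in E; rewrite PhiE.
    have c2 : pconst (c ^- 2) * pconst (c ^+ 2) = 1.
      by rewrite -rmorphM mulVf ?rmorph1 // expf_neq0.
    rewrite -[LHS]mul1r -c2 -mulrA -[RHS](mulr0 (pconst (c ^- 2))) -E; congr (_ * _).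
    have -> : kappa * y = T (pvar e) * (pconst c * y) by rewrite mulrA.
    set Q := q.[_]; rewrite !rmorphXn /=; ring.
exists c; split=> // m m0.
have := congr1 (fun x : pseries => x m) TwE.
rewrite pconstM /T /pscale /w; case: m m0 => // m _.
by rewrite -exprM => ->; apply: subringM.
Qed.

End Subring.

End PowerSeries.

(** * Eisenstein's theorem *)

Section Eisenstein.
Variable C : numFieldType.

Definition fraction_of (D : C -> Prop) (c : C) : Prop :=
  exists b, [/\ D b, b != 0 & D (b * c)].

Lemma fraction_subring (D : C -> Prop) : subring D -> subring (fraction_of D).
Proof.
move=> sD; split.
- by exists 1; rewrite oner_eq0 mulr1; split=> //; apply: subring1.
- move=> x y [a [Da a0 Dax]] [b [Db b0 Dby]]; exists (a * b).
  rewrite mulf_neq0 //; split=> //; first exact: subringM.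
  have -> : a * b * (x + y) = b * (a * x) + a * (b * y) by ring.
  by apply: subringD => //; apply: subringM.
- by move=> x [a [Da a0 Dax]]; exists a; split=> //; rewrite mulrN; apply: subringN.
- move=> x y [a [Da a0 Dax]] [b [Db b0 Dby]]; exists (a * b).
  rewrite mulf_neq0 //; split=> //; first exact: subringM.
  by rewrite mulrACA; apply: subringM.
Qed.

Lemma common_denominator (D : C -> Prop) (J : eqType) (s : seq J) (F : J -> C) :
  subring D -> (forall j, fraction_of D (F j)) ->
  exists b, [/\ D b, b != 0 & forall j, j \in s -> D (b * F j)].
Proof.
move=> sD frF; elim: s => [|j s [b [Db b0 Hb]]].
  by exists 1; rewrite oner_eq0; split=> //; apply: subring1.
have [a [Da a0 Haj]] := frF j; exists (a * b).
rewrite mulf_neq0 //; split=> // [|i]; first exact: subringM.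
rewrite inE => /orP[/eqP ->|/Hb Hi]; first by rewrite mulrAC; apply: subringM.
by rewrite -mulrA; apply: subringM.
Qed.

(** Gaussian elimination of one unknown after the other does not leave the
    subring, when the equations are cross-multiplied instead of divided. *)
Lemma dependent_over (D : C -> Prop) (J : eqType) (s : seq J) (w : J -> nat -> C) :
  subring D -> uniq s -> (forall j m, D (w j m)) ->
  (exists2 a : J -> C, exists2 j, j \in s & a j != 0 &
     forall m, \sum_(j <- s) a j * w j m = 0) ->
  exists a : J -> C, [/\ forall j, D (a j), exists2 j, j \in s & a j != 0 &
     forall m, \sum_(j <- s) a j * w j m = 0].
Proof.
move=> sD; elim: s w => [|j0 s IH] w; first by move=> _ _ [a [j]].
rewrite cons_uniq => /andP[j0s us] Dw [a [j1 j1s aj1] sum0].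
have nej0 j : j \in s -> (j == j0) = false.
  by move=> js; apply: contraNF j0s => /eqP <-.
have [w0|] := pselect (forall m, w j0 m = 0).
  exists (fun j => (j == j0)%:R); split.
  - by move=> j; apply: subring_nat.
  - by exists j0; rewrite ?mem_head // eqxx oner_eq0.
  - move=> m; rewrite big_cons w0 mulr0 add0r big_seq big1 // => j js.
    by rewrite nej0 // mul0r.
move=> /existsNP[m0 /eqP wm0].
have sumE m : \sum_(j <- s) a j * w j m = - (a j0 * w j0 m).
  by apply/eqP; rewrite -addr_eq0 addrC; have := sum0 m; rewrite big_cons => ->.
(* Equation m0 eliminates the unknown j0. *)
pose w' j m := w j0 m0 * w j m - w j m0 * w j0 m.
have [| |b [Db [j2 j2s bj2] sumb]] := IH w' us.
- by move=> j m; apply: subringB => //; apply: subringM.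
- exists a => [|m]; last first.
    rewrite (eq_bigr (fun j => w j0 m0 * (a j * w j m) - a j * w j m0 * w j0 m)).
      2: by move=> j _; rewrite /w'; ring.
    rewrite sumrB -mulr_sumr -mulr_suml !sumE; ring.
  have [j1s'|j1s'] := boolP (j1 \in s); first by exists j1.
  move: j1s; rewrite inE (negPf j1s') orbF => /eqP j10.
  apply: contrapT => no; move: (sumE m0).
  rewrite big_seq big1 => [|j js].
    by move=> /eqP; rewrite eq_sym oppr_eq0 mulf_eq0 (negPf wm0) -j10 (negPf aj1).
  by apply/eqP; rewrite mulf_eq0; apply/orP; left; apply: contrapT => /negP aj;
    apply: no; exists j.
exists (fun j => if j == j0 then - \sum_(i <- s) b i * w i m0 else w j0 m0 * b j).
split.
- move=> j; case: eqP => _; last exact: subringM.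
  by apply: subringN => //; apply: subring_sum => // i _; apply: subringM.
- by exists j2; rewrite ?inE ?j2s ?orbT // nej0 // mulf_neq0.
- move=> m; rewrite big_cons eqxx big_seq.
  under eq_bigr => j js do rewrite nej0 //.
  rewrite -big_seq mulNr mulr_suml addrC -sumrB -[RHS](sumb m).
  by apply: eq_bigr => j _; rewrite /w'; ring.
Qed.

Lemma horner_pseriesE (P : {poly {poly C}}) (u : pseries C) n m : (size P <= n)%N ->
  (map_poly (@pseries_of C) P).[u] m =
  \sum_(k < n) mul1 (fun i => (P`_k)`_i) (exp1 u k) m.
Proof.
move=> sP; rewrite (horner_coef_wide _ (leq_trans (size_poly _ _) sP)) pseries_sum.
by apply: eq_bigr => k _; rewrite coef_map exp1E.
Qed.

(** The coefficients of a polynomial equation for [u] solve a linear system whose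
    coefficients are polynomials in those of [u]; clear denominators at the end. *)
Lemma algebraic_over (D : C -> Prop) (u : pseries C) :
  subring D -> (forall m, fraction_of D (u m)) -> Defs.algebraic1 u ->
  exists P : {poly {poly C}}, [/\ P != 0, forall k i, D (P`_k)`_i &
    (map_poly (@pseries_of C) P).[u] = 0].
Proof.
move=> sD fru [P [P0 Pu]].
pose L := (\max_(k < size P) size (P`_k)%R)%N.
pose w (j : 'I_(size P) * 'I_L) m := (pvar C j.2 * u ^+ j.1) m.
have sF := fraction_subring sD.
have expand (Q : {poly {poly C}}) : (size Q <= size P)%N ->
    (forall k, (size (Q`_k)%R <= L)%N) -> forall m,
    (map_poly (@pseries_of C) Q).[u] m =
    \sum_(j <- enum {: 'I_(size P) * 'I_L}) (Q`_j.1)`_j.2 * w j m.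
  move=> sQ sQk m; rewrite (horner_pseriesE _ _ sQ) big_enum /=.
  rewrite -(pair_bigA _ (fun (k : 'I_(size P)) (i : 'I_L) => (Q`_k)`_i * w (k, i) m)) /=.
  apply: eq_bigr => k _; rewrite exp1E -/(pseries_of Q`_k).
  rewrite -[LHS]/((pseries_of Q`_k * u ^+ k) m).
  have -> : pseries_of Q`_k = \sum_(i < L) pconst (Q`_k)`_i * pvar C i.
    apply: funext => l; rewrite pseries_sum.
    under eq_bigr => i _ do rewrite pconstM /pvar /pseries_of coefXn.
    have [lL|Ll] := ltnP l L.
      rewrite (bigD1 (Ordinal lL)) //= eqxx mulr1 big1 ?addr0 // => i il.
      by rewrite (_ : (l == i) = false) ?mulr0 //; apply: contraNF il => /eqP li; apply/eqP/val_inj.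
    rewrite big1 => [|i _]; first by rewrite /pseries_of nth_default // (leq_trans (sQk _)).
    by rewrite (_ : (l == i) = false) ?mulr0 //; have := ltn_ord i; lia.
  rewrite mulr_suml pseries_sum; apply: eq_bigr => i _.
  by rewrite -mulrA pconstM.
have sPL k : (size (P`_k)%R <= L)%N.
  have [kP|Pk] := ltnP k (size P); last by rewrite nth_default ?size_poly0.
  exact: (leq_bigmax (Ordinal kP)).
have [| | |a [Da [[k i] _ ai] suma]] := @dependent_over (fraction_of D) _
  (enum {: 'I_(size P) * 'I_L}) w sF.
- exact: enum_uniq.
- move=> j m; apply: (subringM (pseries_over_subring sF)).
    exact: pvar_over.
  exact: (subringX (pseries_over_subring sF)).
- exists (fun j : 'I_(size P) * 'I_L => (P`_j.1)`_j.2) => [|m].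
    have lP : ((size P).-1 < size P)%N by rewrite prednK ?size_poly_gt0.
    have lc0 : lead_coef P != 0 by rewrite lead_coef_eq0.
    have lL : ((size (lead_coef P)).-1 < L)%N.
      by apply: leq_trans (sPL (size P).-1); rewrite prednK ?size_poly_gt0.
    exists (Ordinal lP, Ordinal lL); rewrite ?mem_enum //=.
    by rewrite -lead_coefE lead_coef_eq0.
  by rewrite -expand // (horner_pseriesE _ _ (leqnn _)).
have [b [Db b0 Hb]] := common_denominator (enum {: 'I_(size P) * 'I_L}) sD Da.
pose a' (k i : nat) := if insub k is Some k' then
  if insub i is Some i' then b * a (k', i') else 0 else 0.
have Da' k' i' : D (a' k' i').
  rewrite /a'; case: insubP => [k'' _ _|_]; last exact: subring0.
  case: insubP => [i'' _ _|_]; last exact: subring0.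
  by apply: Hb; rewrite mem_enum.
pose Q := \poly_(k' < size P) \poly_(i' < L) a' k' i'.
have QE k' i' : (Q`_k')`_i' = if (k' < size P)%N && (i' < L)%N then a' k' i' else 0.
  rewrite coef_poly; case: ifP => _; last by rewrite coef0.
  by rewrite coef_poly; case: ifP.
exists Q; split.
- apply/eqP => /(congr1 (fun R : {poly {poly C}} => (R`_k)`_i)).
  rewrite QE !ltn_ord /= !coef0 /a' !valK => /eqP; rewrite mulf_eq0.
  by rewrite (negPf b0) (negPf ai).
- by move=> k' i'; rewrite QE; case: ifP => // _; apply: subring0.
- have sQ k' : (size (Q`_k')%R <= L)%N.
    by rewrite coef_poly; case: ifP; rewrite ?size_poly0 ?size_poly.
  apply: funext => m; rewrite pseries0 (expand Q (size_poly _ _) sQ).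
  have := congr1 ( *%R b) (suma m); rewrite mulr0 mulr_sumr; apply: etrans.
  apply: eq_bigr => -[k' i'] _.
  by rewrite QE !ltn_ord /= /a' !valK mulrA.
Qed.

(** Choose [P] of least degree with coefficients in [D] and [P(u) = 0]; then
    [P'(u) <> 0], and after multiplying [u] by a common denominator of its first
    coefficients the criterion for simple roots applies. *)
Theorem eisenstein (D : C -> Prop) (u : pseries C) :
  subring D -> D (u 0%N) -> (forall m, fraction_of D (u m)) -> Defs.algebraic1 u ->
  exists N, [/\ D N, N != 0 & forall m, D (N ^+ m * u m)].
Proof.
move=> sD Du0 fru /(algebraic_over sD fru) algu.
have ex : exists n, `[< exists P : {poly {poly C}}, [/\ P != 0,
    forall k i, D (P`_k)`_i, (map_poly (@pseries_of C) P).[u] = 0 & size P = n] >].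
  by have [P [P0 DP Pu]] := algu; exists (size P); apply/asboolP; exists P.
case: (ex_minnP ex) => n /asboolP[P [P0 DP Pu sP]] minP.
set ev := @pseries_of C in Pu minP.
have sP1 : (1 < size P)%N.
  rewrite ltnNge; apply/negP => /size1_polyC PE; move: Pu P0.
  rewrite PE map_polyC hornerC => P00; rewrite polyC_eq0; case/eqP.
  by apply/polyP => i; rewrite coef0; apply: (congr1 (fun q : pseries C => q i) P00).
have char0 k : k.+1%:R != 0 :> {poly C} by rewrite -polyC_natr polyC_eq0 pnatr_eq0.
have dP0 := deriv_neq0 char0 sP1.
pose W := (map_poly ev P^`()).[u].
have /existsNP[m0 Wm] : ~ (forall m, W m = 0).
  move=> W0; have := lt_size_deriv P0; rewrite sP ltnNge => /negP; apply.
  apply: minP; apply/asboolP; exists P^`(); split=> //.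
    by move=> k i; rewrite coef_deriv coefMn -mulr_natr; apply: subringM;
      last exact: subring_nat.
  exact: funext.
have exW : exists m, W m != 0 by exists m0; apply/eqP.
case: (ex_minnP exW) => e We mine.
have WE : W = pvar C e * pshift e W.
  by apply: pvar_shift => i ie; apply/eqP; apply: contraTT ie => /mine; rewrite -leqNgt.
have [b [Db b0 Hb]] := common_denominator (iota 0 e.+1) sD fru.
pose d := size P.
pose Q := \poly_(k < d) (pconst (b ^+ (d - k)) * ev P`_k).
pose x : pseries C := pconst b * u.
have xX k : x ^+ k = pconst (b ^+ k) * u ^+ k by rewrite exprMn rmorphXn.
have DQ k : pseries_over D Q`_k.
  rewrite coef_poly; case: ifP => _; last exact: (subring0 (pseries_over_subring sD)).
  apply: (subringM (pseries_over_subring sD)); last exact: DP.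
  by apply: pconst_over => //; apply: subringX.
have Qx : Q.[x] = 0.
  transitivity (pconst (b ^+ d) * (map_poly ev P).[u]); last by rewrite Pu mulr0.
  rewrite (horner_coef_wide _ (size_poly _ _)) (horner_coef_wide _ (size_poly _ _)).
  rewrite mulr_sumr; apply: eq_bigr => k _.
  rewrite coef_poly ltn_ord coef_map xX mulrACA -rmorphM -exprD subnK ?mulrA //.
  exact: ltnW.
have dQx : Q^`().[x] = pvar C e * (pconst (b ^+ d.-1) * pshift e W).
  rewrite mulrCA -WE /W.
  have sdQ : (size Q^`() <= d)%N.
    by apply: leq_trans (size_poly _ _) _; rewrite (leq_trans (leq_pred _)) // size_poly.
  have sdP : (size (map_poly ev P^`()) <= d)%N.
    by rewrite (leq_trans (size_poly _ _)) // ltnW // lt_size_deriv.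
  rewrite (horner_coef_wide _ sdQ) (horner_coef_wide _ sdP) mulr_sumr.
  apply: eq_bigr => k _; rewrite coef_deriv coef_map coef_deriv coef_poly xX.
  rewrite /ev; case: ltnP => kd; last first.
    by rewrite nth_default // !mul0rn raddf0 !mul0r mulr0.
  rewrite raddfMn -mulrnAr mulrACA -rmorphM -exprD; congr (pconst (_ ^+ _) * _).
  lia.
have [i|/=|c [Dc c0 Hc]] := simple_root_over sD DQ _ Qx dQx.
- by rewrite /x pconstM => ie; apply: Hb; rewrite mem_iota add0n ltnS.
- by rewrite pconstM mulf_neq0 ?expf_neq0 // /pshift addn0.
exists (b * c ^+ 2); split; first by apply: subringM => //; apply: subringX.
  by rewrite mulf_neq0 ?expf_neq0.
move=> m; have [->|m1] := posnP m; first by rewrite mul1r.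
rewrite exprMn -[in b ^+ m](prednK m1) exprSr.
have [me|em] := leqP m e.
  have -> : b ^+ m.-1 * b * c ^+ 2 ^+ m * u m = b ^+ m.-1 * c ^+ 2 ^+ m * (b * u m) by ring.
  apply: subringM; first exact: sD.
    by apply: subringM; rewrite // -?exprM; apply: subringX.
  by apply: Hb; rewrite mem_iota add0n ltnS.
have me : (0 < m - e)%N by rewrite subn_gt0.
have := Hc _ me; rewrite /x pconstM subnKC 1?ltnW // => Dm.
have -> : b ^+ m.-1 * b * c ^+ 2 ^+ m * u m =
    b ^+ m.-1 * c ^+ (2 * e) * (c ^+ (2 * (m - e)) * (b * u m)).
  have -> : c ^+ 2 ^+ m = c ^+ (2 * e) * c ^+ (2 * (m - e)).
    by rewrite -exprM -exprD; congr (_ ^+ _); lia.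
  ring.
by apply: subringM => //; apply: subringM => //; apply: subringX.
Qed.

End Eisenstein.

(** * Solutions of a vector field *)

Lemma generates_ind (A : comNzRingType) (O : comAlgType A) n (g : 'I_n -> O)
    (Q : O -> Prop) :
  generates (in_alg O : A -> O) g -> (forall a : A, Q a%:A) -> (forall i, Q (g i)) ->
  (forall f h, Q f -> Q h -> Q (f + h)) -> (forall f h, Q f -> Q h -> Q (f * h)) ->
  forall f, Q f.
Proof.
move=> gen QA Qg QD QM f.
have sQ : subring Q.
  split=> //; first by rewrite -(scale1r 1); apply: QA.
  by move=> a Qa; rewrite -mulN1r; apply: QM; rewrite // -scaleN1r; apply: QA.
have [p <-] := gen f; have [r ->] := tower_mpoly p.
apply: (@subring_tower_eval A O Q (in_alg O) (extend0 g) n r sQ QA) => j jn.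
by rewrite (_ : j = Ordinal jn) // extend0E.
Qed.

Section PowerSeriesNorm.
Variable C : numFieldType.
Implicit Types u w : pseries C.

Definition pnorm (d : nat) (rho : C) u : C := \sum_(m < d) `|u m| * rho ^+ m.

Lemma pnorm_ge0 d rho u : 0 <= rho -> 0 <= pnorm d rho u.
Proof. by move=> rho0; apply: sumr_ge0 => m _; rewrite mulr_ge0 ?exprn_ge0. Qed.

Lemma pnormD d rho u w : 0 <= rho -> pnorm d rho (u + w) <= pnorm d rho u + pnorm d rho w.
Proof.
move=> rho0; rewrite -big_split /=; apply: ler_sum => m _; rewrite -mulrDl.
by rewrite ler_wpM2r ?exprn_ge0 // ler_normD.
Qed.

Lemma pnormM d rho u w : 0 <= rho -> pnorm d rho (u * w) <= pnorm d rho u * pnorm d rho w.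
Proof.
move=> rho0.
pose p := \poly_(i < d) `|u i|; pose q := \poly_(i < d) `|w i|.
have pE (x : pseries C) : pnorm d rho x = (\poly_(i < d) `|x i|).[rho].
  rewrite (horner_coef_wide _ (size_poly _ _)); apply: eq_bigr => i _.
  by rewrite coef_poly ltn_ord.
rewrite (pE u) (pE w) -hornerM -/p -/q.
have spq : (size (p * q)%R <= d + d)%N.
  rewrite (leq_trans (size_polyMleq _ _)) //.
  by have := size_poly d (fun i => `|u i|); have := size_poly d (fun i => `|w i|);
    rewrite -/p -/q; lia.
have pq0 m : 0 <= (p * q)`_m.
  rewrite coefM; apply: sumr_ge0 => i _; rewrite !coef_poly.
  by do 2 case: ifP => _; rewrite ?mulr0 ?mul0r ?mulr_ge0.
rewrite (horner_coef_wide _ spq) big_split_ord /= -[X in X <= _]addr0.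
apply: lerD; last by apply: sumr_ge0 => m _; rewrite mulr_ge0 ?exprn_ge0.
apply: ler_sum => m _; rewrite ler_wpM2r ?exprn_ge0 //.
rewrite pseriesM (le_trans (ler_norm_sum _ _ _)) // coefM; apply: ler_sum => i _.
rewrite normrM !coef_poly !ifT //; have := ltn_ord i; have := ltn_ord m; lia.
Qed.

End PowerSeriesNorm.

Section Solution.
Variables (C : numFieldType) (A : comNzRingType) (O : comAlgType A).
Variables (v : {linear O -> O}) (v_der : derivation v) (y : {rmorphism O -> C}).

Definition solution_series (f : O) : pseries C := fun m => y (iter m v f) / (m`!)%:R.

Lemma derivation_scalar (a : A) : v a%:A = 0.
Proof.
rewrite linearZ /= (_ : v 1 = 0) ?scaler0 //; have := v_der 1 1.
by rewrite !mulr1 mul1r => /eqP; rewrite -subr_eq subrr eq_sym => /eqP.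
Qed.

Lemma iter_derivationD m f h : iter m v (f + h) = iter m v f + iter m v h.
Proof. by elim: m => //= m ->; rewrite linearD. Qed.

Lemma iter_derivationM m f h : iter m v (f * h) =
  \sum_(i < m.+1) (iter i v f * iter (m - i) v h) *+ 'C(m, i).
Proof.
elim: m => [|m IH]; first by rewrite big_ord1 bin0.
pose G i := (iter i v f * iter (m.+1 - i) v h) *+ 'C(m, i).
transitivity (\sum_(i < m.+1) (iter i.+1 v f * iter (m - i) v h) *+ 'C(m, i) +
              \sum_(i < m.+2) G i).
  rewrite [X in _ = _ + X]big_ord_recr /= {2}/G bin_small // mulr0n addr0.
  rewrite IH linear_sum /= -big_split /=; apply: eq_bigr => i _.
  by rewrite raddfMn /= v_der mulrnDl /G subSn // -ltnS.
rewrite [X in _ + X = _]big_ord_recl [RHS]big_ord_recl /G !bin0 addrCA; congr (_ + _).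
rewrite -big_split /=; apply: eq_bigr => i _.
by rewrite /bump /= !add1n subSS binS mulrnDr addrC.
Qed.

Lemma solution_scalar (a : A) : solution_series a%:A = pconst (y a%:A).
Proof.
apply: funext => -[|m]; first by rewrite /solution_series /= divr1.
rewrite /solution_series iterSr derivation_scalar.
have -> : iter m v 0 = 0 by elim: m => //= m ->; rewrite linear0.
by rewrite rmorph0 mul0r.
Qed.

Lemma solutionD f h : solution_series (f + h) = solution_series f + solution_series h.
Proof.
apply: funext => m.
by rewrite pseriesD /solution_series iter_derivationD rmorphD mulrDl.
Qed.

Lemma solutionM f h : solution_series (f * h) = solution_series f * solution_series h.
Proof.
apply: funext => m; rewrite pseriesM /solution_series iter_derivationM.
rewrite rmorph_sum mulr_suml; apply: eq_bigr => i _; have im : (i <= m)%N by rewrite -ltnS.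
rewrite rmorphMn rmorphM -mulr_natr /= -(bin_fact im) !natrM.
have fact0 k : (k`!)%:R != 0 :> C by rewrite pnatr_eq0 -lt0n fact_gt0.
have bin0 : 'C(m, i)%:R != 0 :> C by rewrite pnatr_eq0 -lt0n bin_gt0.
by field; rewrite !fact0 bin0.
Qed.

Lemma solution_derive f m :
  solution_series (v f) m = deriv1 (solution_series f) m.
Proof.
rewrite /deriv1 /solution_series iterSr -mulrnAr; congr (_ * _).
by rewrite factS natrM invfM -mulrnAl -[_ *+ m.+1]mulr_natr mulVf ?mul1r ?pnatr_eq0.
Qed.

Variables (n : nat) (g : 'I_n -> O).
Hypothesis g_gen : generates (in_alg O : A -> O) g.

(** By Eisenstein's theorem for the generators; a product of series with
    denominators [N^m] has such denominators too. *)
Lemma solution_integral (D : C -> Prop) :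
  subring D -> (forall f, D (y f)) ->
  (forall i, Defs.algebraic1 (solution_series (g i))) ->
  exists N, [/\ D N, N != 0 & forall m f, D (N ^+ m * solution_series f m)].
Proof.
move=> sD Dy alg.
have fr f m : fraction_of D (solution_series f m).
  have fact0 : (m`!)%:R != 0 :> C by rewrite pnatr_eq0 -lt0n fact_gt0.
  exists (m`!)%:R; split=> //; first exact: subring_nat.
  by rewrite mulrC /solution_series divfK.
have /choice[M HM] i : exists N,
    [/\ D N, N != 0 & forall m, D (N ^+ m * solution_series (g i) m)].
  apply: (eisenstein sD) => //; rewrite /solution_series /= divr1; exact: Dy.
exists (\prod_i M i); split.
- by apply: subring_prod => // i _; case: (HM i).
- by apply/prodf_neq0 => i _; case: (HM i).
move=> m f; move: m.
apply: (generates_ind (Q := fun f => forall m, D ((\prod_i M i) ^+ m * solution_series f m)))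
  => // {f} [a m|i m|f h Df Dh m|f h Df Dh m].
- rewrite solution_scalar; case: m => [|m]; first by rewrite mul1r; apply: Dy.
  by rewrite mulr0; apply: subring0.
- rewrite (bigD1 i) //= exprMn mulrAC; apply: subringM => //; first by case: (HM i).
  by apply: subringX => //; apply: subring_prod => // j _; case: (HM j).
- by rewrite solutionD pseriesD mulrDr; apply: subringD.
- rewrite solutionM pseriesM mulr_sumr; apply: subring_sum => // i _.
  have -> : (\prod_i M i) ^+ m = (\prod_i M i) ^+ i * (\prod_i M i) ^+ (m - i).
    by rewrite -exprD subnKC // -ltnS.
  by rewrite mulrACA; apply: subringM.
Qed.

(** The norms on the disc of radius [rho] of the partial sums of the solutions
    [u] for the generators stay below a fixed [B]: as [u' = Q(u)] for some
    polynomials [Q], the next partial sum is at most [|u(0)| + rho |Q|], where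
    [|Q|] is bounded in terms of [B] only. *)
Lemma solution_convergent f : convergent1 (solution_series f).
Proof.
(* The margin 1 over all the |u(0)| leaves room for the term rho |Q|. *)
pose B := 1 + \sum_i `|y (g i)|.
have B1 i : `|y (g i)| + 1 <= B.
  rewrite addrC lerD2l (bigD1 i) //= lerDl; exact: sumr_ge0.
pose Q f := exists2 M, 0 <= M & forall rho d, 0 <= rho ->
  (forall i, pnorm d rho (solution_series (g i)) <= B) ->
  pnorm d rho (solution_series f) <= M.
have Qf : forall f, Q f.
  apply: (generates_ind (g := g)) => //
    [a|i|f1 f2 [M1 M10 H1] [M2 M20 H2]|f1 f2 [M1 M10 H1] [M2 M20 H2]].
  - exists `|y a%:A| => // rho [|d] rho0 _; first by rewrite /pnorm big_ord0.
    rewrite solution_scalar /pnorm big_ord_recl big1 => [|m _].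
      by rewrite mulr1 addr0.
    by rewrite normr0 mul0r.
  - exists B => [|rho d _]; last exact.
    by apply: le_trans (B1 i); rewrite addr_ge0.
  - exists (M1 + M2) => [|rho d rho0 Hg]; first by rewrite addr_ge0.
    rewrite solutionD (le_trans (pnormD _ _ _ rho0)) // lerD //.
      exact: H1.
    exact: H2.
  - exists (M1 * M2) => [|rho d rho0 Hg]; first by rewrite mulr_ge0.
    rewrite solutionM (le_trans (pnormM _ _ _ rho0)) // ler_pM ?pnorm_ge0 //.
      exact: H1.
    exact: H2.
have /choice[M HM] i : exists M, 0 <= M /\ forall rho d, 0 <= rho ->
    (forall j, pnorm d rho (solution_series (g j)) <= B) ->
    pnorm d rho (solution_series (v (g i))) <= M.
  by have [M M0 H] := Qf (v (g i)); exists M.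
pose S := 1 + \sum_i M i.
have S0 : 0 < S by rewrite ltr_pwDl // sumr_ge0 // => i _; case: (HM i).
pose rho := S^-1; have rho0 : 0 < rho by rewrite invr_gt0.
have rhoM i : rho * M i <= 1.
  rewrite mulrC ler_pdivrMr // mul1r /S (bigD1 i) //= addrCA lerDl.
  by rewrite addr_ge0 // sumr_ge0 // => j _; case: (HM j).
have bound d i : pnorm d rho (solution_series (g i)) <= B.
  elim: d i => [|d IH] i.
    by rewrite /pnorm big_ord0; apply: le_trans (B1 i); rewrite addr_ge0.
  apply: le_trans (B1 i); rewrite /pnorm big_ord_recl /= mulr1.
  rewrite {1}/solution_series /= divr1 lerD2l.
  apply: le_trans (rhoM i).
  apply: le_trans (_ : rho * pnorm d rho (solution_series (v (g i))) <= _).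
    rewrite /pnorm mulr_sumr; apply: ler_sum => m _.
    rewrite /bump /= add1n exprS mulrCA ler_wpM2l ?(ltW rho0) //.
    rewrite ler_wpM2r ?exprn_ge0 ?(ltW rho0) //.
    rewrite solution_derive /deriv1 normrMn -mulr_natr ler_peMr // ler1n //.
  by rewrite ler_wpM2l ?(ltW rho0) //; apply: (HM i).2 => //; apply: ltW.
have [M' M'0 HM'] := Qf f.
by exists rho, M'; split=> // d; apply: HM' => //; apply: ltW.
Qed.

End Solution.

(** * Power series in several variables *)

Section MultiSeries.
Variables (C : numFieldType) (n : nat).

Definition mseries : Type := series C n.

HB.instance Definition _ := gen_eqMixin mseries.
HB.instance Definition _ := gen_choiceMixin mseries.

Implicit Types F G H : mseries.

Definition mtrunc (d : nat) F : {mpoly C[n]} :=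
  \sum_(m : 'X_{1..n < d}) F m *: 'X_[m].

Lemma mtruncE d F m : (mdeg m < d)%N -> (mtrunc d F)@_m = F m.
Proof. exact: mcoeff_mpoly. Qed.

Fact smul_mtrunc d F G m : (mdeg m < d)%N -> smul F G m = (mtrunc d F * mtrunc d G)@_m.
Proof.
move=> md; rewrite mcoeffM; apply: eq_bigr => -[k1 k2] _ /=.
by rewrite !mtruncE // (leq_trans (bmdeg _)).
Qed.

Fact mcoeffM_agree (p q q' : {mpoly C[n]}) m :
  (forall k, (mdeg k <= mdeg m)%N -> q@_k = q'@_k) -> (p * q)@_m = (p * q')@_m.
Proof.
move=> qq; rewrite !mcoeffM; apply: eq_bigr => -[k1 k2] _ /=.
by rewrite qq // -ltnS bmdeg.
Qed.

Definition sadd F G : mseries := fun m => F m + G m.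
Definition sopp F : mseries := fun m => - F m.
Definition szero : mseries := fun=> 0.

Fact saddA : associative sadd.
Proof. by move=> F G H; apply: funext => m; apply: addrA. Qed.
Fact saddC : commutative sadd.
Proof. by move=> F G; apply: funext => m; apply: addrC. Qed.
Fact sadd0 : left_id szero sadd.
Proof. by move=> F; apply: funext => m; apply: add0r. Qed.
Fact saddN : left_inverse szero sopp sadd.
Proof. by move=> F; apply: funext => m; apply: addNr. Qed.
HB.instance Definition _ := GRing.isZmodule.Build mseries saddA saddC sadd0 saddN.

Fact smulC : commutative (@smul C n : mseries -> mseries -> mseries).
Proof.
by move=> F G; apply: funext => m; rewrite !(@smul_mtrunc (mdeg m).+1) // mulrC.
Qed.
Fact smulA : associative (@smul C n : mseries -> mseries -> mseries).
Proof.
move=> F G H; apply: funext => m; rewrite !(@smul_mtrunc (mdeg m).+1) //.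
have tr F' G' k : (mdeg k <= mdeg m)%N ->
    (mtrunc (mdeg m).+1 (smul F' G'))@_k = (mtrunc (mdeg m).+1 F' * mtrunc (mdeg m).+1 G')@_k.
  by move=> km; rewrite mtruncE -?smul_mtrunc.
rewrite (mcoeffM_agree _ (tr G H)) mulrA mulrC [in RHS]mulrC.
by rewrite (mcoeffM_agree _ (tr F G)).
Qed.
Fact smul1 : left_id (@sone C n : mseries) (@smul C n : mseries -> mseries -> mseries).
Proof.
move=> F; apply: funext => m; rewrite (@smul_mtrunc (mdeg m).+1) //.
rewrite mulrC (@mcoeffM_agree _ _ 1) ?mulr1 ?mtruncE // => k km.
by rewrite mtruncE // mcoeff1.
Qed.
Fact smulDl : left_distributive (@smul C n : mseries -> mseries -> mseries) +%R.
Proof.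
move=> F G H; apply: funext => m; rewrite -[RHS]big_split /=.
by apply: eq_bigr => k _; rewrite -mulrDl.
Qed.
Fact sone_neq0 : (@sone C n : mseries) != 0.
Proof.
by apply/eqP => /(congr1 (fun F : mseries => F 0%MM)) /eqP; rewrite /sone eqxx oner_eq0.
Qed.
HB.instance Definition _ :=
  GRing.Zmodule_isComNzRing.Build mseries smulA smulC smul1 smulDl sone_neq0.

Lemma mseriesD F G m : (F + G) m = F m + G m. Proof. by []. Qed.
Lemma mseriesB F G m : (F - G) m = F m - G m. Proof. by []. Qed.
Lemma mseriesN F m : (- F) m = - F m. Proof. by []. Qed.
Lemma mseries1 m : (1 : mseries) m = (m == 0%MM)%:R. Proof. by []. Qed.
Lemma mseriesM F G m : (F * G) m =
  \sum_(k : 'X_{1..n < (mdeg m).+1, (mdeg m).+1} | m == (k.1 + k.2)%MM) F k.1 * G k.2.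
Proof. by []. Qed.
Lemma mseries_sum (J : Type) (r : seq J) (P : pred J) (F : J -> mseries) m :
  (\sum_(j <- r | P j) F j) m = \sum_(j <- r | P j) F j m.
Proof. by elim/big_rec2: _ => // j x y _ <-. Qed.

Definition mseries_of (p : {mpoly C[n]}) : mseries := fun m => p@_m.

Fact mseries_of_zmod : zmod_morphism mseries_of.
Proof. by move=> p q; apply: funext => m; rewrite mseriesB /mseries_of mcoeffB. Qed.
Fact mseries_of_monoid : monoid_morphism mseries_of.
Proof.
split=> [|p q]; apply: funext => m; first by rewrite /mseries_of mcoeff1.
by rewrite mseriesM /mseries_of mcoeffM.
Qed.
HB.instance Definition _ :=
  GRing.isZmodMorphism.Build {mpoly C[n]} mseries mseries_of mseries_of_zmod.
HB.instance Definition _ :=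
  GRing.isMonoidMorphism.Build {mpoly C[n]} mseries mseries_of mseries_of_monoid.

Definition mconst (c : C) : mseries := mseries_of c%:MP.

Fact mconst_zmod : zmod_morphism mconst.
Proof. by move=> a b; rewrite /mconst mpolyCB rmorphB. Qed.
Fact mconst_monoid : monoid_morphism mconst.
Proof. by split=> [|a b]; rewrite /mconst ?mpolyC1 ?rmorph1 // mpolyCM rmorphM. Qed.
HB.instance Definition _ := GRing.isZmodMorphism.Build C mseries mconst mconst_zmod.
HB.instance Definition _ := GRing.isMonoidMorphism.Build C mseries mconst mconst_monoid.

Definition mvar (i : 'I_n) : mseries := mseries_of 'X_i.

Lemma mconstE c m : mconst c m = c * (m == 0%MM)%:R.
Proof. exact: mcoeffC. Qed.

Lemma mvarE i m : mvar i m = (m == U_(i)%MM)%:R.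
Proof. by rewrite /mvar /mseries_of mcoeffX eq_sym. Qed.

Lemma mconstM c F m : (mconst c * F) m = c * F m.
Proof.
rewrite -[LHS]/(smul _ F m) (@smul_mtrunc (mdeg m).+1) //.
rewrite mulrC (@mcoeffM_agree _ _ c%:MP) => [|k km]; last by rewrite mtruncE.
by rewrite mulrC mcoeffCM mtruncE.
Qed.

Definition mcoef0 F : C := F 0%MM.

Fact mcoef0_zmod : zmod_morphism mcoef0. Proof. by []. Qed.
Fact mcoef0_monoid : monoid_morphism mcoef0.
Proof.
split=> [|F G]; first by rewrite /mcoef0 mseries1 eqxx.
rewrite /mcoef0 -[LHS]/(smul F G 0%MM) (@smul_mtrunc 1) ?mdeg0 //.
by rewrite [LHS]rmorphM /= !mtruncE ?mdeg0.
Qed.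
HB.instance Definition _ := GRing.isZmodMorphism.Build mseries C mcoef0 mcoef0_zmod.
HB.instance Definition _ := GRing.isMonoidMorphism.Build mseries C mcoef0 mcoef0_monoid.

Lemma mcoef0_const c : mcoef0 (mconst c) = c.
Proof. by rewrite /mcoef0 mconstE eqxx mulr1. Qed.

Lemma mcoef0_var i : mcoef0 (mvar i) = 0.
Proof. by rewrite /mcoef0 mvarE eq_sym mnm1_eq0. Qed.

Definition order_ge (d : nat) F : Prop := forall m, (mdeg m < d)%N -> F m = 0.

Lemma order_geM d e F G : order_ge d F -> order_ge e G -> order_ge (d + e) (F * G).
Proof.
move=> oF oG m mde; rewrite mseriesM big1 // => -[k1 k2] /= /eqP mk.
have [kd|dk] := ltnP (mdeg k1) d; first by rewrite oF // mul0r.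
by rewrite [G _]oG ?mulr0 //; have := congr1 mdeg mk; rewrite mdegD; lia.
Qed.

Lemma order_geW d e F : (d <= e)%N -> order_ge e F -> order_ge d F.
Proof. by move=> de oF m md; apply: oF; apply: leq_trans de. Qed.

Lemma order_geD d F G : order_ge d F -> order_ge d G -> order_ge d (F + G).
Proof. by move=> oF oG m md; rewrite mseriesD oF // oG // addr0. Qed.

Lemma order_ge1 F : mcoef0 F = 0 -> order_ge 1 F.
Proof. by move=> F0 m; rewrite ltnS leqn0 mdeg_eq0 => /eqP ->. Qed.

Lemma order_ge_agree d F G m : order_ge d (F - G) -> (mdeg m < d)%N -> F m = G m.
Proof. by move=> oFG md; apply/eqP; rewrite -subr_eq0; apply/eqP; apply: oFG. Qed.

(** ** Norms on polydiscs *)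

Definition mnorm (d : nat) (rho : C) F : C :=
  \sum_(m : 'X_{1..n < d}) `|F m| * rho ^+ mdeg m.

Lemma mnorm_ge0 d rho F : 0 <= rho -> 0 <= mnorm d rho F.
Proof. by move=> rho0; apply: sumr_ge0 => m _; rewrite mulr_ge0 ?exprn_ge0. Qed.

Lemma mnormN d rho F : mnorm d rho (- F) = mnorm d rho F.
Proof. by apply: eq_bigr => m _; rewrite mseriesN normrN. Qed.

Lemma mnormD d rho F G : 0 <= rho -> mnorm d rho (F + G) <= mnorm d rho F + mnorm d rho G.
Proof.
move=> rho0; rewrite -big_split /=; apply: ler_sum => m _; rewrite -mulrDl.
by rewrite ler_wpM2r ?exprn_ge0 // ler_normD.
Qed.

Lemma mnorm_sum d rho (J : Type) (r : seq J) (P : pred J) (F : J -> mseries) : 0 <= rho ->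
  mnorm d rho (\sum_(j <- r | P j) F j) <= \sum_(j <- r | P j) mnorm d rho (F j).
Proof.
move=> rho0; elim/big_rec2: _ => [|j x y _ IH].
  by rewrite /mnorm big1 // => m _; rewrite normr0 mul0r.
by apply: le_trans (mnormD _ _ _ rho0) _; rewrite lerD2l.
Qed.

Lemma mnormM d rho F G : 0 <= rho -> mnorm d rho (F * G) <= mnorm d rho F * mnorm d rho G.
Proof.
move=> rho0; rewrite /mnorm big_distrlr /= pair_bigA /=.
apply: (@le_trans _ _ (\sum_(m : 'X_{1..n < d}) \sum_(k : 'X_{1..n < d, d})
   if (m : 'X_{1..n}) == (k.1 + k.2)%MM then
     `|F k.1| * rho ^+ mdeg k.1 * (`|G k.2| * rho ^+ mdeg k.2) else 0)).
  apply: ler_sum => m _; rewrite -big_mkcond /=.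
  have -> : (F * G) m = \sum_(k : 'X_{1..n < d, d} | (m : 'X_{1..n}) == (k.1 + k.2)%MM)
      F k.1 * G k.2.
    rewrite -[LHS]/(smul F G m) (@smul_mtrunc d) ?bmdeg // (mcoeff_poly_mul _ _ (bmdeg m)).
    by apply: eq_bigr => -[k1 k2] _ /=; rewrite !mtruncE ?bmdeg.
  rewrite (le_trans (ler_wpM2r _ (ler_norm_sum _ _ _))) ?exprn_ge0 // mulr_suml.
  apply: ler_sum => k /eqP ->; rewrite mdegD exprD normrM.
  by rewrite mulrACA.
rewrite exchange_big /=; apply: ler_sum => -[k1 k2] _ /=.
set X := _ * _ * _; have X0 : 0 <= X by rewrite !mulr_ge0 ?exprn_ge0.
have [kd|dk] := ltnP (mdeg (k1 + k2)%MM) d; last first.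
  rewrite big1 // => m _; case: eqP => // mk.
  by have := bmdeg m; rewrite mk ltnNge dk.
rewrite (bigD1 (BMultinom kd)) //= eqxx big1 ?addr0 // => m mk.
by case: eqP => // mE; case/eqP: mk; apply/val_inj.
Qed.

Lemma mnorm_const d rho c : 0 <= rho -> mnorm d rho (mconst c) <= `|c|.
Proof.
move=> rho0; case: d => [|d]; first by rewrite /mnorm big1 // => -[].
rewrite /mnorm (bigD1 bm0) //= mconstE eqxx !mulr1 mdeg0 mulr1 big1 ?addr0 // => m m0.
rewrite mconstE (_ : _ == _ = false) ?mulr0 ?normr0 ?mul0r //.
by apply: contraNF m0 => /eqP mE; apply/eqP/val_inj.
Qed.

Lemma mnorm1 d rho : 0 <= rho -> mnorm d rho 1 <= 1.
Proof. by move=> /(mnorm_const d 1); rewrite normr1 rmorph1. Qed.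

Lemma mnormX d rho F k : 0 <= rho -> mnorm d rho F <= 1 -> mnorm d rho (F ^+ k) <= 1.
Proof.
move=> rho0 F1; elim: k => [|k IH]; first exact: mnorm1.
rewrite exprS (le_trans (mnormM _ _ _ rho0)) // -[X in _ <= X]mulr1.
by rewrite ler_pM ?mnorm_ge0.
Qed.

Lemma mnorm_constM d rho c F : mnorm d rho (mconst c * F) = `|c| * mnorm d rho F.
Proof. by rewrite /mnorm mulr_sumr; apply: eq_bigr => m _; rewrite mconstM normrM mulrA. Qed.

Lemma mnormW d rho rho' F : 0 <= rho' <= rho -> mnorm d rho' F <= mnorm d rho F.
Proof.
case/andP=> r0 rr; apply: ler_sum => m _; rewrite ler_wpM2l //.
by rewrite lerXn2r // ?nnegrE // (le_trans r0).
Qed.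

Lemma mnorm_shrink d rho t F : 0 <= rho -> 0 <= t <= 1 -> mcoef0 F = 0 ->
  mnorm d (t * rho) F <= t * mnorm d rho F.
Proof.
move=> rho0 /andP[t0 t1] F0; rewrite /mnorm mulr_sumr; apply: ler_sum => m _.
have [m0|m0] := eqVneq (m : 'X_{1..n}) 0%MM.
  by rewrite m0 [F _]F0 normr0 !mul0r mulr0.
rewrite mulrCA ler_wpM2l // exprMn ler_wpM2r ?exprn_ge0 //.
have : (0 < mdeg m)%N by rewrite lt0n mdeg_eq0.
by case: (mdeg m) => // k _; rewrite exprS ler_piMr // exprn_ile1.
Qed.

Lemma convergentP F : convergent F <->
  exists rho M, [/\ 0 < rho, 0 <= M & forall d, mnorm d rho F <= M].
Proof.
split=> [[rho [M [rho0 FM]]]|[rho [M [rho0 _ FM]]]]; last by exists rho, M.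
exists rho, M; split=> //; apply: le_trans (FM 0%N).
by apply: mnorm_ge0; apply: ltW.
Qed.

Lemma convergent_family (s : seq mseries) : (forall F, F \in s -> convergent F) ->
  exists rho M, [/\ 0 < rho, 0 <= M & forall F d, F \in s -> mnorm d rho F <= M].
Proof.
elim: s => [|F s IH] cs; first by exists 1, 0.
have [|rho1 [M1 [rho10 M10 H1]]] := IH; first by move=> G Gs; apply: cs; rewrite inE Gs orbT.
have /convergentP[rho2 [M2 [rho20 M20 H2]]] := cs F (mem_head _ _).
have rho0 : 0 < rho1 + rho2 by rewrite addr_gt0.
pose rho := rho1 * rho2 / (rho1 + rho2).
have rho_gt0 : 0 < rho by rewrite !mulr_gt0 ?invr_gt0.
exists rho, (M1 + M2); split=> // [|G d]; first by rewrite addr_ge0.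
rewrite inE => /orP[/eqP ->|Gs].
  apply: le_trans (_ : M2 <= _); last by rewrite lerDr.
  apply: le_trans (H2 d); apply: mnormW; rewrite (ltW rho_gt0) /=.
  by rewrite ler_pdivrMr // mulrC ler_wpM2l ?ltW // ltrDl.
apply: le_trans (_ : M1 <= _); last by rewrite lerDl.
apply: le_trans (H1 G d Gs); apply: mnormW; rewrite (ltW rho_gt0) /=.
by rewrite ler_pdivrMr // ler_wpM2l ?ltW // ltrDr.
Qed.

Lemma convergent_subring : subring (@convergent C n : mseries -> Prop).
Proof.
have fam F G : convergent F -> convergent G -> exists rho M, [/\ 0 < rho, 0 <= M,
    forall d, mnorm d rho F <= M & forall d, mnorm d rho G <= M].
  move=> cF cG; have [|rho [M [rho0 M0 H]]] := @convergent_family [:: F; G].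
    by move=> H; rewrite !inE => /orP[] /eqP ->.
  by exists rho, M; split=> // d; apply: H; rewrite !inE eqxx ?orbT.
split.
- by apply/convergentP; exists 1, 1; split=> // d; apply: mnorm1.
- move=> F G cF cG; have [rho [M [rho0 M0 HF HG]]] := fam F G cF cG.
  apply/convergentP; exists rho, (M + M); rewrite addr_ge0 //; split=> // d.
  by apply: le_trans (mnormD _ _ _ (ltW rho0)) _; rewrite lerD ?HF ?HG.
- move=> F /convergentP[rho [M [rho0 M0 H]]]; apply/convergentP; exists rho, M.
  by split=> // d; rewrite mnormN.
- move=> F G cF cG; have [rho [M [rho0 M0 HF HG]]] := fam F G cF cG.
  apply/convergentP; exists rho, (M * M); rewrite mulr_ge0 //; split=> // d.
  by apply: le_trans (mnormM _ _ _ (ltW rho0)) _; rewrite ler_pM ?HF ?HG ?mnorm_ge0 ?(ltW rho0).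
Qed.

Lemma convergent_const c : convergent (mconst c).
Proof. by apply/convergentP; exists 1, `|c|; split=> // d; apply: mnorm_const. Qed.

Lemma mnorm_var d rho i : 0 <= rho -> mnorm d rho (mvar i) <= rho.
Proof.
move=> rho0; rewrite /mnorm.
have [d2|d1] := ltnP 1 d; last first.
  rewrite big1 // => m _; rewrite mvarE (_ : _ == _ = false) ?normr0 ?mul0r //.
  by apply/eqP => mE; have := bmdeg m; rewrite mE mdeg1 ltnNge d1.
have ud : (mdeg (U_(i)%MM : 'X_{1..n}) < d)%N by rewrite mdeg1.
rewrite (bigD1 (BMultinom ud)) //= mvarE eqxx normr1 mul1r mdeg1 big1 ?addr0 // => m mi.
rewrite mvarE (_ : _ == _ = false) ?normr0 ?mul0r //.
by apply: contraNF mi => /eqP mE; apply/eqP/val_inj.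
Qed.

Lemma convergent_var i : convergent (mvar i).
Proof. by apply/convergentP; exists 1, 1; split=> // d; apply: mnorm_var. Qed.

Definition supported (I : nat -> bool) F : Prop :=
  forall m, F m != 0 -> forall j : 'I_n, m j != 0%N -> I j.

Lemma supported_subring I : subring (supported I).
Proof.
split.
- move=> m; rewrite mseries1; case: (m =P 0%MM) => [-> _ j|_]; last by rewrite eqxx.
  by rewrite mnm0E.
- move=> F G sF sG m FGm j mj; have [F0|F0] := eqVneq (F m) 0.
    by apply: (sG m) => //; apply: contraNneq FGm => G0; rewrite mseriesD F0 G0 addr0.
  exact: (sF m).
- by move=> F sF m; rewrite mseriesN oppr_eq0; apply: sF.
- move=> F G sF sG m FGm j mj; apply: contrapT => nI; case/eqP: FGm.
  rewrite mseriesM big1 // => -[k1 k2] /= /eqP mk.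
  have := mj; have -> : m j = (k1 j + k2 j)%N by rewrite -mnmDE -mk.
  rewrite addn_eq0 negb_and.
  case/orP => kj; apply/eqP; rewrite mulf_eq0; apply/orP; [left|right];
    apply: contrapT => /negP F0; apply: nI.
    exact: (sF k1).
  exact: (sG k2).
Qed.

Lemma supported_const I c : supported I (mconst c).
Proof.
move=> m; rewrite mconstE; case: (m =P 0%MM) => [-> _ j|_]; last by rewrite mulr0 eqxx.
by rewrite mnm0E.
Qed.

Lemma supported_var (I : nat -> bool) (i : 'I_n) : I i -> supported I (mvar i).
Proof.
move=> Ii m; rewrite mvarE; case: (m =P U_(i)%MM) => [-> _ j|_]; last by rewrite eqxx.
by rewrite mnm1E; case: (i =P j) => // <-.
Qed.

Lemma supportedW (I J : nat -> bool) F :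
  (forall i, I i -> J i) -> supported I F -> supported J F.
Proof. by move=> IJ sF m Fm j mj; apply: IJ; apply: (sF m). Qed.

Definition analytic_in (I : nat -> bool) F : Prop := convergent F /\ supported I F.

Lemma analytic_subring I : subring (analytic_in I).
Proof.
have sC := convergent_subring; have sS := supported_subring I; split.
- by split; [apply: (subring1 sC)|apply: (subring1 sS)].
- by move=> F G [? ?] [? ?]; split; [apply: (subringD sC)|apply: (subringD sS)].
- by move=> F [? ?]; split; [apply: (subringN sC)|apply: (subringN sS)].
- by move=> F G [? ?] [? ?]; split; [apply: (subringM sC)|apply: (subringM sS)].
Qed.

End MultiSeries.

(** ** Hensel's lemma for convergent series *)

Section Hensel.
Variables (C : numFieldType) (n : nat).
Local Notation E := (mseries C n).
Local Notation cst := (@mconst C n).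

(** The iteration [y -> y - r(y)/r'(0)] converges coefficientwise, since
    it multiplies the difference of two series without constant term by a
    series without constant term.  It maps the ball of radius [eps] for the norm
    on a small enough polydisc to itself, hence the limit converges. *)
Lemma hensel0 (I : nat -> bool) (r : {poly E}) :
  (forall k, analytic_in I r`_k) -> mcoef0 r`_0 = 0 -> mcoef0 r`_1 != 0 ->
  exists h : E, [/\ analytic_in I h, mcoef0 h = 0 & r.[h] = 0].
Proof.
move=> an r00; set u := mcoef0 r`_1 => u0.
have sA := analytic_subring C n I.
pose Psi (y : E) := y - cst u^-1 * r.[y].
have Psi0 (y : E) : mcoef0 y = 0 -> mcoef0 (Psi y) = 0.
  move=> y0; rewrite /Psi rmorphB rmorphM -horner_map /= y0 horner_coef0 coef_map /=.
  by rewrite r00 mulr0 subr0.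
have contract (y y' : E) : mcoef0 y = 0 -> mcoef0 y' = 0 -> exists2 U,
    Psi y - Psi y' = (y - y') * U & order_ge 1 U.
  move=> y0 y'0; have [U [UE U0 _]] := horner_diff (@mcoef0 C n) r y y'.
  exists (1 - cst u^-1 * U).
    have -> : Psi y - Psi y' = (y - y') - cst u^-1 * (r.[y] - r.[y']).
      by rewrite /Psi; ring.
    by rewrite UE; ring.
  apply: order_ge1; rewrite rmorphB rmorphM rmorph1 /= U0 /= ?y0 ?y'0 //.
  rewrite horner_coef0 coef_deriv coef_map mulr1n mcoef0_const /= -/u.
  by rewrite mulVf // subrr.
pose it d := iter d Psi 0.
have it0 d : mcoef0 (it d) = 0.
  by elim: d => [|d IH]; [rewrite rmorph0|apply: Psi0].
have itS d : order_ge d.+1 (it d.+1 - it d).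
  elim: d => [|d IH].
    apply: order_ge1; transitivity (mcoef0 (it 1%N) - mcoef0 (it 0%N)); first exact: rmorphB.
    by rewrite !it0 subrr.
  have [U UE oU] := contract (it d.+1) (it d) (it0 _) (it0 _).
  rewrite -[it d.+2 - _]/(Psi (it d.+1) - Psi (it d)) UE -addn1.
  exact: order_geM.
have itW d e : (d <= e)%N -> order_ge d.+1 (it e - it d).
  move=> de; rewrite -(subnKC de); elim: (e - d)%N => [|k IH].
    by rewrite addn0 subrr.
  rewrite addnS -[it _ - _](subrKA (it (d + k))); apply: order_geD => //.
  by apply: order_geW (itS _); rewrite ltnS leq_addr.
pose h : E := fun m => it (mdeg m) m.
have hit d : order_ge d.+1 (h - it d).
  move=> m md; rewrite mseriesB /h.
  by rewrite -(order_ge_agree (itW _ _ (_ : mdeg m <= d)%N) (ltnSn _)) ?subrr.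
have h0 : mcoef0 h = 0 by rewrite /mcoef0 /h mdeg0.
have hfix : Psi h = h.
  apply: funext => m; have [U UE oU] := contract h (it (mdeg m)) h0 (it0 _).
  have o : order_ge (mdeg m).+1 (Psi h - Psi (it (mdeg m))).
    by rewrite UE -[_.+1]addn0; apply: order_geM => // k; rewrite ltn0.
  rewrite (order_ge_agree o) // -[Psi _]/(it (mdeg m).+1).
  by rewrite (order_ge_agree (itW _ _ (leqnSn _))).
exists h; split=> //; last first.
  have : cst u^-1 * r.[h] = 0.
    by rewrite -[LHS](subKr h) -/(Psi h) hfix subrr.
  move/(congr1 (fun y => cst u * y)); rewrite mulr0 mulrA -rmorphM mulfV //.
  by rewrite rmorph1 mul1r.
have supit d : supported I (it d).
  have sS := supported_subring C n I.
  elim: d => [|d IH]; first exact: (subring0 sS).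
  apply: (subringB sS) => //; apply: (subringM sS); first exact: supported_const.
  by apply: (subring_horner sS) => // k; case: (an k).
split; last by move=> m; apply: supit.
have [|rho0 [M [rho00 M0 HM]]] := @convergent_family C n (r`_1 - cst u :: r).
  move=> F; rewrite inE => /orP[/eqP ->|/(nthP 0)[k _ <-]]; last by case: (an k).
  apply: (subringB (convergent_subring C n)); last exact: convergent_const.
  by case: (an 1%N).
have HMr k d : mnorm d rho0 r`_k <= M.
  have [kr|rk] := ltnP k (size r).
    by apply: HM; rewrite inE mem_nth ?orbT.
  rewrite nth_default // /mnorm big1 // => m _; by rewrite normr0 mul0r.
(* With w = 1/|u|: the choice of eps makes the terms of degree at least two
   contribute at most eps/2; the polydisc is then shrunk by the factor t, so that
   the constant and the linear term contribute at most eps/2. *)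
pose L : C := (size (drop_poly 2 r))%:R.
pose w := `|u|^-1; have w0 : 0 <= w by rewrite invr_ge0.
have L0 : 0 <= L by rewrite ler0n.
pose eps := (1 + 2 * (w * L * M))^-1.
have eps_d : 0 < 1 + 2 * (w * L * M) by rewrite ltr_pwDl // !mulr_ge0.
have eps0 : 0 < eps by rewrite invr_gt0.
have eps1 : eps <= 1 by rewrite invf_le1 // lerDl !mulr_ge0.
have epsM : 2 * (w * L * M) * eps <= 1 by rewrite ler_pdivrMr // mul1r lerDr.
pose t := eps * (1 + 4 * (w * M))^-1.
have t_d : 0 < 1 + 4 * (w * M) by rewrite ltr_pwDl // !mulr_ge0.
have t0 : 0 < t by rewrite mulr_gt0 ?invr_gt0.
have t1 : t <= 1.
  apply: mulr_ile1 => //; first exact: ltW.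
    by rewrite invr_ge0 ltW.
  by rewrite invf_le1 // lerDl !mulr_ge0.
have tM : 4 * (w * M) * t <= eps.
  rewrite /t mulrCA -[X in _ <= X]mulr1 ler_wpM2l ?(ltW eps0) //.
  by rewrite ler_pdivrMr // mul1r lerDr.
pose rho := t * rho0.
have rho_gt0 : 0 < rho by rewrite mulr_gt0.
have rho_ge0 := ltW rho_gt0.
have rhoW (F : E) d : mnorm d rho F <= mnorm d rho0 F.
  by apply: mnormW; rewrite rho_ge0 ler_piMl ?(ltW rho00).
have PsiE y : Psi y = - (cst u^-1 *
    (r`_0 + ((r`_1 - cst u) * y + (drop_poly 2 r).[y] * y ^+ 2))).
  have rE : r.[y] = r`_0 + r`_1 * y + (drop_poly 2 r).[y] * y ^+ 2.
    rewrite -{1}(poly_take_drop 2 r) hornerD hornerM hornerXn; congr (_ + _).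
    rewrite (horner_coef_wide _ (size_take_poly 2 r)) big_ord_recl big_ord1 /=.
    by rewrite !coef_take_poly expr0 expr1 mulr1.
  rewrite /Psi rE.
  have uu : cst u^-1 * cst u = 1 by rewrite -rmorphM mulVf // rmorph1.
  apply/eqP; rewrite -subr_eq0; apply/eqP.
  transitivity ((1 - cst u^-1 * cst u) * y); first by ring.
  by rewrite uu subrr mul0r.
have bound k d : mnorm d rho (it k) <= eps.
  elim: k => [|k IH].
    by rewrite /mnorm big1 ?(ltW eps0) // => m _; rewrite normr0 mul0r.
  have -> : it k.+1 = Psi (it k) by [].
  rewrite PsiE mnormN mnorm_constM normfV -/w.
  have b0 : mnorm d rho r`_0 <= t * M.
    apply: le_trans (mnorm_shrink _ (ltW rho00) _ r00) _; first by rewrite (ltW t0).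
    by rewrite ler_wpM2l ?(ltW t0).
  have b1 : mnorm d rho (r`_1 - cst u) <= t * M.
    apply: le_trans (mnorm_shrink _ (ltW rho00) _ _) _; first by rewrite (ltW t0).
      by rewrite rmorphB /= mcoef0_const subrr.
    by rewrite ler_wpM2l ?(ltW t0) // HM // mem_head.
  have b2 : mnorm d rho (drop_poly 2 r).[it k] <= L * M.
    rewrite horner_coef; apply: le_trans (mnorm_sum _ _ _ _ rho_ge0) _.
    apply: le_trans (_ : \sum_(i < size (drop_poly 2 r)) M <= _); last first.
      by rewrite sumr_const card_ord -mulr_natl.
    apply: ler_sum => i _; apply: le_trans (mnormM _ _ _ rho_ge0) _.
    rewrite -[X in _ <= X]mulr1 ler_pM ?mnorm_ge0 //.
      by rewrite coef_drop_poly; apply: le_trans (rhoW _ _) (HMr _ _).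
    exact: mnormX rho_ge0 (le_trans IH eps1).
  have sq : mnorm d rho (it k ^+ 2) <= eps ^+ 2.
    rewrite !expr2; apply: le_trans (mnormM _ _ _ rho_ge0) _.
    by rewrite ler_pM ?mnorm_ge0.
  have b12 : mnorm d rho ((r`_1 - cst u) * it k) <= t * M.
    apply: le_trans (mnormM _ _ _ rho_ge0) _; rewrite -[X in _ <= X]mulr1.
    by rewrite ler_pM ?mnorm_ge0 // (le_trans IH).
  have b22 : mnorm d rho ((drop_poly 2 r).[it k] * it k ^+ 2) <= L * M * eps ^+ 2.
    by apply: le_trans (mnormM _ _ _ rho_ge0) _; rewrite ler_pM ?mnorm_ge0.
  apply: le_trans (_ : w * (t * M + (t * M + L * M * eps ^+ 2)) <= _).
    rewrite ler_wpM2l //; apply: le_trans (mnormD _ _ _ rho_ge0) _; rewrite lerD //.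
    by apply: le_trans (mnormD _ _ _ rho_ge0) _; rewrite lerD.
  have two0 : 0 < (2 : C) by rewrite ltr0n.
  rewrite -(ler_pM2l two0).
  have -> : 2 * (w * (t * M + (t * M + L * M * eps ^+ 2))) =
     4 * (w * M) * t + 2 * (w * L * M) * eps * eps by ring.
  have -> : 2 * eps = eps + eps by ring.
  rewrite lerD // -[X in _ <= X]mul1r ler_wpM2r ?(ltW eps0) //.
apply/convergentP; exists rho, eps; split=> // [|d]; first exact: ltW.
apply: le_trans (bound d d); rewrite le_eqVlt; apply/orP; left; apply/eqP.
apply: eq_bigr => m _; congr (`|_| * _).
by apply: order_ge_agree (hit d) _; rewrite ltnW // ltnS bmdeg.
Qed.

(** Translate the root to the origin. *)
Theorem hensel (I : nat -> bool) (q : {poly E}) (c : C) :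
  (forall k, analytic_in I q`_k) ->
  (map_poly (@mcoef0 C n) q).[c] = 0 -> (map_poly (@mcoef0 C n) q)^`().[c] != 0 ->
  exists h : E, [/\ analytic_in I h, mcoef0 h = 0 & q.[ cst c + h] = 0].
Proof.
move=> an qc dqc; have sA := analytic_subring C n I.
pose r := q \Po ('X + (cst c)%:P).
have r0E : r`_0 = q.[ cst c].
  by rewrite -horner_coef0 horner_comp hornerD hornerX hornerC add0r.
have r1E : r`_1 = q^`().[ cst c].
  have := coef_deriv r 0; rewrite mulr1n => <-.
  rewrite -horner_coef0 /r deriv_comp hornerM horner_comp hornerD hornerX hornerC add0r.
  by rewrite derivD derivX derivC addr0 hornerC mulr1.
have cc : mcoef0 (cst c) = c by exact: mcoef0_const.
have [| | |h [anh h0 rh]] := @hensel0 I r.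
- apply: (subring_comp_poly sA) => // i; rewrite coefD coefX coefC.
  apply: (subringD sA); first exact: (subring_nat sA).
  case: eqP => _; last exact: (subring0 sA).
  by split; [apply: convergent_const|apply: supported_const].
- by rewrite r0E -[LHS]horner_map /= cc.
- by rewrite r1E -[X in X != 0]horner_map /= -deriv_map /= cc.
by exists h; split=> //; rewrite addrC -rh horner_comp hornerD hornerX hornerC.
Qed.

(** The inverse of [F] is the root of the polynomial [F Y - 1]. *)
Lemma analytic_inverse (I : nat -> bool) (F : E) :
  analytic_in I F -> mcoef0 F != 0 -> exists2 G, analytic_in I G & F * G = 1.
Proof.
move=> anF F0; have sA := analytic_subring C n I.
have [| | |h [anh _]] := @hensel I (F *: 'X - 1) (mcoef0 F)^-1.
- move=> k; rewrite coefB coefZ coefX coef1; apply: (subringB sA).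
    by apply: (subringM sA) => //; apply: (subring_nat sA).
  exact: (subring_nat sA).
- by rewrite rmorphB /= map_polyZ /= map_polyX rmorph1 hornerD hornerN hornerZ hornerX
    hornerC mulfV // subrr.
- by rewrite rmorphB /= map_polyZ /= map_polyX rmorph1 derivB derivZ derivX derivC subr0
    hornerZ hornerC mulr1.
rewrite hornerD hornerN hornerZ hornerX hornerC => /eqP; rewrite subr_eq0 => /eqP FG.
exists (cst (mcoef0 F)^-1 + h) => //; apply: (subringD sA) => //.
by split; [apply: convergent_const|apply: supported_const].
Qed.

End Hensel.

(** ** Substitution *)

Section Substitution.
Variables (C : numFieldType) (n : nat).
Local Notation E := (mseries C n).
Local Notation cst := (@mconst C n).
Local Notation var := (@mvar C n).
Implicit Types (F G : E) (m : 'X_{1..n}).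

Lemma sum_degree_widen (V : nmodType) (G : 'X_{1..n} -> V) k l : (k <= l)%N ->
  (forall m, (k <= mdeg m)%N -> G m = 0) ->
  \sum_(m : 'X_{1..n < l}) G m = \sum_(m : 'X_{1..n < k}) G m.
Proof.
move=> kl G0; pose I1 : subFinType _ := 'X_{1..n < k}.
pose I2 : subFinType _ := 'X_{1..n < l}.
rewrite [RHS](ssrcomplements.big_sub_widen I1 I2 xpredT G) /=; last first.
  by move=> m mk; apply: leq_trans kl.
rewrite [RHS]big_mkcond /=; apply: eq_bigr => m _.
by case: ltnP => // /G0.
Qed.

(** Sums [sum_m F_m B_m]; when [B_m] has order at least [|m| - 1], each
    coefficient is a finite sum. *)
Definition mcombine (B : 'X_{1..n} -> E) (F : E) : E := fun m0 =>
  \sum_(m : 'X_{1..n < (mdeg m0).+2}) F m * B m m0.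

Lemma mcombineE (B : 'X_{1..n} -> E) F d m0 :
  (forall m, order_ge (mdeg m).-1 (B m)) -> (mdeg m0 < d)%N ->
  mcombine B F m0 = (\sum_(m : 'X_{1..n < d.+1}) cst (F m) * B m) m0.
Proof.
move=> oB md; rewrite /mcombine mseries_sum.
under [RHS]eq_bigr => m _ do rewrite mconstM.
rewrite (@sum_degree_widen C (fun m => F m * B m m0) (mdeg m0).+2 d.+1) // => m dm.
by rewrite (oB m) ?mulr0 //; lia.
Qed.

Lemma mcombine_norm (B : 'X_{1..n} -> E) F rho R L M :
  0 <= rho -> 0 <= L -> (forall m, order_ge (mdeg m).-1 (B m)) ->
  (forall m d, mnorm d rho (B m) <= L * R ^+ mdeg m) ->
  (forall d, mnorm d R F <= M) ->
  forall d, mnorm d rho (mcombine B F) <= L * M.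
Proof.
move=> rho0 L0 oB nB nF d.
apply: (@le_trans _ _ (mnorm d rho (\sum_(m : 'X_{1..n < d.+1}) cst (F m) * B m))).
  rewrite le_eqVlt; apply/orP; left; apply/eqP; apply: eq_bigr => m _.
  by rewrite (mcombineE _ oB (bmdeg m)).
apply: le_trans (mnorm_sum _ _ _ _ rho0) _.
apply: le_trans (_ : L * mnorm d.+1 R F <= _); last by rewrite ler_wpM2l.
rewrite /(mnorm d.+1) mulr_sumr; apply: ler_sum => m _.
by rewrite mnorm_constM mulrCA ler_wpM2l.
Qed.

Lemma mcombine_supported (I : nat -> bool) (B : 'X_{1..n} -> E) F :
  (forall m, supported I (B m)) -> supported I (mcombine B F).
Proof.
move=> sB m0 nz j mj; apply: contrapT => nI; case/eqP: nz.
rewrite /mcombine big1 // => m _; apply/eqP; rewrite mulf_eq0; apply/orP; right.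
by apply: contrapT => /negP nz; apply: nI; apply: (sB m m0).
Qed.

Lemma mmap1D (h : 'I_n -> E) m1 m2 : mmap1 h (m1 + m2)%MM = mmap1 h m1 * mmap1 h m2.
Proof. by apply: commr_mmap1_M => i x; apply: mulrC. Qed.

Lemma mmap1_var m : mmap1 var m = mseries_of 'X_[m].
Proof.
by rewrite mpolyXE_id rmorph_prod /=; apply: eq_bigr => i _; rewrite rmorphXn.
Qed.

(** Every monomial other than [1] is divisible by a variable. *)
Lemma mnm_ind (P : 'X_{1..n} -> Prop) :
  P 0%MM -> (forall i m, P m -> P (U_(i) + m)%MM) -> forall m, P m.
Proof.
move=> P0 PU m; have [k] := ubnP (mdeg m); elim: k m => // k IH m; rewrite ltnS => mk.
have [->//|m0] := eqVneq m 0%MM.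
have [i mi] : exists i, m i != 0%N.
  apply: contrapT => no; case/eqP: m0; apply/mnmP => i; rewrite mnm0E; apply/eqP.
  by apply: contrapT => /negP mi; apply: no; exists i.
have mE : m = (U_(i) + (m - U_(i)))%MM.
  apply/mnmP => j; rewrite mnmDE mnmBE mnm1E; case: eqP => [<-|_]; last by rewrite subn0.
  by rewrite subnKC // lt0n.
rewrite mE; apply: PU; apply: IH.
by move: mk; rewrite {1}mE mdegD mdeg1 add1n.
Qed.

Section Point.
Variable h : 'I_n -> E.
Hypothesis h0 : forall j, mcoef0 (h j) = 0.

Lemma order_mmap1 m : order_ge (mdeg m) (mmap1 h m).
Proof.
elim/mnm_ind: m => [|i m IH]; first by move=> k; rewrite mdeg0.
rewrite mdegD mdeg1 mmap1D mmap1U; apply: order_geM => //.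
by apply: order_ge1.
Qed.

Lemma order_mmap1W m : order_ge (mdeg m).-1 (mmap1 h m).
Proof. exact: order_geW (leq_pred _) (@order_mmap1 m). Qed.

Lemma mnorm_mmap1 d rho eps m : 0 <= rho -> (forall j, mnorm d rho (h j) <= eps) ->
  mnorm d rho (mmap1 h m) <= eps ^+ mdeg m.
Proof.
move=> rho0 nh; elim/mnm_ind: m => [|i m IH].
  by rewrite mmap11 mdeg0; apply: mnorm1.
rewrite mdegD mdeg1 mmap1D mmap1U add1n exprS.
by apply: le_trans (mnormM _ _ _ rho0) _; rewrite ler_pM ?mnorm_ge0.
Qed.

Definition msubst (F : E) : E := mcombine (mmap1 h) F.

Lemma msubstE F d m : (mdeg m < d)%N -> msubst F m = mmap cst h (mtrunc d.+1 F) m.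
Proof.
move=> md; rewrite /msubst (mcombineE _ order_mmap1W md).
rewrite /mtrunc raddf_sum /= !mseries_sum; apply: eq_bigr => k _.
by rewrite mmapZ mmapX.
Qed.

Lemma msubst_poly p : msubst (mseries_of p) = mmap cst h p.
Proof.
apply: funext => m; pose d := maxn (mdeg m).+1 (msize p).
rewrite /msubst (mcombineE _ order_mmap1W (leq_maxl _ _ : (mdeg m < d)%N)).
have pd : (msize p <= d.+1)%N by apply: leqW; apply: leq_maxr.
by rewrite (mmapE d.+1 pd); apply: (congr1 (fun G : E => G m)); apply: eq_bigr.
Qed.

Lemma msubstD F G : msubst (F + G) = msubst F + msubst G.
Proof.
apply: funext => m; rewrite mseriesD /msubst /mcombine -big_split /=.
by apply: eq_bigr => k _; rewrite mseriesD mulrDl.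
Qed.

Lemma msubst_sum (J : Type) (r : seq J) (F : J -> E) :
  msubst (\sum_(j <- r) F j) = \sum_(j <- r) msubst (F j).
Proof.
elim: r => [|j r IH]; last by rewrite !big_cons msubstD IH.
by rewrite !big_nil; apply: funext => m; rewrite /msubst /mcombine big1 // => k _; apply: mul0r.
Qed.

(** Modulo series of order [d], both factors are polynomials. *)
Lemma msubstM F G : msubst (F * G) = msubst F * msubst G.
Proof.
apply: funext => m; pose d := (mdeg m).+1.
pose t := mmap cst h \o mtrunc d.+1.
have tE H : order_ge d (msubst H - t H).
  by move=> k kd; rewrite mseriesB (msubstE _ kd) subrr.
rewrite (order_ge_agree (tE _) (ltnSn _)).
have oFG : order_ge d (msubst F * msubst G - t F * t G).
  have -> : msubst F * msubst G - t F * t G =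
     (msubst F - t F) * msubst G + t F * (msubst G - t G) by ring.
  apply: order_geD; first by rewrite -[d]addn0; apply: order_geM => // k; rewrite ltn0.
  by rewrite -[d]add0n; apply: order_geM => // k; rewrite ltn0.
rewrite (order_ge_agree oFG (ltnSn _)) /t /= -rmorphM.
apply/eqP; rewrite -subr_eq0 -mseriesB -raddfB /=; apply/eqP.
set p := _ - _; have p0 k : (mdeg k < d.+1)%N -> p@_k = 0.
  by move=> kd; rewrite mcoeffB mtruncE // -(smul_mtrunc _ _ kd) subrr.
rewrite /mmap mseries_sum big1 // => k _; rewrite mconstM.
have [kd|dk] := ltnP (mdeg k) d.+1; first by rewrite p0 // mul0r.
by rewrite (order_mmap1 (m := k)) ?mulr0 // (leq_trans _ dk).
Qed.

(** Replace the factors [X_j] of [X^m] by [h_j] one at a time.  In the norm bound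
    the number of summands, at most [|m|], is absorbed into the power of [2]. *)
Lemma monomial_difference m : exists B : 'I_n -> E, [/\
  mmap1 var m - mmap1 h m = \sum_j (var j - h j) * B j,
  forall j, order_ge (mdeg m).-1 (B j) &
  forall rho eps d, 0 <= rho -> 0 < eps -> rho <= eps ->
    (forall j, mnorm d rho (h j) <= eps) ->
    forall j, mnorm d rho (B j) <= eps^-1 * (2 * eps) ^+ mdeg m].
Proof.
elim/mnm_ind: m => [|i m [B [BE oB nB]]].
  exists (fun=> 0); split.
  - by rewrite !mmap11 subrr big1 // => j _; rewrite mulr0.
  - by [].
  - move=> rho eps d rho0 eps0 _ _ j; rewrite mdeg0 mulr1 /mnorm big1 ?invr_ge0 ?ltW //.
    by move=> k _; rewrite normr0 mul0r.
exists (fun j => (if j == i then mmap1 var m else 0) + h i * B j); split.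
- rewrite !mmap1D !mmap1U.
  have -> : var i * mmap1 var m - h i * mmap1 h m =
     (var i - h i) * mmap1 var m + h i * (mmap1 var m - mmap1 h m) by ring.
  under eq_bigr => j _ do rewrite mulrDr.
  rewrite big_split /= BE mulr_sumr [X in _ = X + _](bigD1 i) //= eqxx.
  rewrite [X in _ + X + _]big1 ?addr0 => [|j ji]; last by rewrite (negPf ji) mulr0.
  by congr (_ + _); apply: eq_bigr => j _; ring.
- move=> j; rewrite mdegD mdeg1 add1n /=; apply: order_geD.
    case: eqP => // _ k km; rewrite mmap1_var /mseries_of mcoeffX.
    by case: eqP km => // ->; rewrite ltnn.
  have [->|m0] := eqVneq (mdeg m) 0%N; first by [].
  rewrite -(prednK (n := mdeg m)) ?lt0n // -add1n; apply: order_geM => //.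
  exact: order_ge1.
- move=> rho eps d rho0 eps0 rhoe nh j; rewrite mdegD mdeg1 add1n.
  apply: le_trans (mnormD _ _ _ rho0) _.
  have -> : eps^-1 * (2 * eps) ^+ (mdeg m).+1 =
     (2 * eps) ^+ mdeg m + eps * (eps^-1 * (2 * eps) ^+ mdeg m).
    by rewrite exprS; field; rewrite gt_eqF.
  apply: lerD; last first.
    apply: le_trans (mnormM _ _ _ rho0) _; rewrite ler_pM ?mnorm_ge0 //.
    exact: nB.
  case: eqP => _; last first.
    rewrite /mnorm big1 ?exprn_ge0 ?mulr_ge0 ?ltW // => k _; by rewrite normr0 mul0r.
  have nvar k : mnorm d rho (var k) <= eps by apply: le_trans (mnorm_var _ _ rho0) _.
  apply: (@le_trans _ _ (eps ^+ mdeg m)).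
    elim/mnm_ind: (m) => [|l m' IH].
      by rewrite mmap11 mdeg0; apply: mnorm1.
    rewrite mdegD mdeg1 mmap1D mmap1U add1n exprS.
    by apply: le_trans (mnormM _ _ _ rho0) _; rewrite ler_pM ?mnorm_ge0.
  rewrite lerXn2r ?nnegrE ?mulr_ge0 ?ltW //.
  by rewrite ltr_pMl // ltr1n.
Qed.

Lemma mcombine_var F : mcombine (mmap1 var) F = F.
Proof.
apply: funext => m; rewrite /mcombine.
have md : (mdeg m < (mdeg m).+2)%N by [].
rewrite (bigD1 (BMultinom md)) //= mmap1_var /mseries_of mcoeffX eqxx mulr1.
rewrite big1 ?addr0 // => k km; rewrite mmap1_var /mseries_of mcoeffX.
by case: eqP => kE; rewrite ?mulr0 //; case/eqP: km; apply/val_inj.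
Qed.

Lemma msubst_id (I : nat -> bool) F : (forall i : 'I_n, I i -> h i = var i) -> supported I F ->
  msubst F = F.
Proof.
move=> hI sF; rewrite -[RHS]mcombine_var; apply: funext => m0.
apply: eq_bigr => m _; have [->|Fm] := eqVneq (F m) 0; first by rewrite !mul0r.
congr (_ * _ m0); apply: eq_bigr => i _.
have [->|mi] := eqVneq ((m : 'X_{1..n}) i) 0%N; first by rewrite !expr0.
by rewrite hI //; apply: (sF m).
Qed.

Lemma msubst_supported (I : nat -> bool) F :
  (forall j, supported I (h j)) -> supported I (msubst F).
Proof.
move=> sh; apply: mcombine_supported => m; apply: (subring_prod (supported_subring C n I)).
by move=> i _; apply: (subringX (supported_subring C n I)).
Qed.

Hypothesis ch : forall j, convergent (h j).

(** As the [h_j] have no constant term, they are small on small polydiscs. *)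
Lemma convergence_radius F : convergent F -> exists rho eps M,
  [/\ 0 < rho, rho <= eps, forall j d, mnorm d rho (h j) <= eps, 0 <= M
    & forall d, mnorm d (2 * eps) F <= M].
Proof.
move=> /convergentP[r [M [r0 M0 HM]]].
have [|rho0 [M1 [rho00 M10 HM1]]] := @convergent_family C n (map h (enum 'I_n)).
  by move=> G /mapP[j _ ->].
pose eps := r / 2; have eps0 : 0 < eps by rewrite divr_gt0.
have den0 : 0 < eps + rho0 + M1 by rewrite ltr_wpDr // addr_gt0.
pose t := eps / (eps + rho0 + M1).
have t0 : 0 < t by rewrite divr_gt0.
have t1 : t <= 1.
  by rewrite ler_pdivrMr // mul1r -addrA lerDl addr_ge0 // ltW.
exists (t * rho0), eps, M; split=> //.
- by rewrite mulr_gt0.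
- rewrite /t mulrAC ler_pdivrMr // ler_wpM2l ?(ltW eps0) //.
  by rewrite -addrA addrCA lerDl addr_ge0 // ltW.
- move=> j d; apply: le_trans (mnorm_shrink _ (ltW rho00) _ (h0 j)) _.
    by rewrite (ltW t0).
  apply: le_trans (_ : t * M1 <= _).
    rewrite ler_wpM2l ?(ltW t0) // HM1 //.
    by apply: map_f; rewrite mem_enum.
  rewrite /t mulrAC ler_pdivrMr // ler_wpM2l ?(ltW eps0) //.
  by rewrite lerDr addr_ge0 // ltW.
- by move=> d; rewrite /eps mulrC divfK ?pnatr_eq0 //; apply: HM.
Qed.

Lemma msubst_convergent F : convergent F -> convergent (msubst F).
Proof.
move=> /convergence_radius[rho [eps [M [rho0 re nh M0 HM]]]].
have eps0 : 0 <= eps by apply: le_trans re; apply: ltW.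
apply/convergentP; exists rho, (1 * M); rewrite mul1r; split=> // d.
rewrite -[M]mul1r; apply: (mcombine_norm (R := 2 * eps)) => //; first exact: ltW.
  exact: order_mmap1W.
move=> m e; rewrite mul1r; apply: le_trans (mnorm_mmap1 _ (ltW rho0) _) _ => //.
rewrite lerXn2r ?nnegrE ?mulr_ge0 //.
by rewrite ler_peMl // ler1n.
Qed.

Lemma msubst_difference F : convergent F -> exists2 Q : 'I_n -> E,
  forall j, convergent (Q j) & F - msubst F = \sum_j (var j - h j) * Q j.
Proof.
move=> /convergence_radius[rho [eps [M [rho0 re nh M0 HM]]]].
have /choice[B HB] := monomial_difference.
have oB j m : order_ge (mdeg m).-1 (B m j) by case: (HB m).
exists (fun j => mcombine (fun m => B m j) F) => [j|].
  have eps0 : 0 < eps by apply: lt_le_trans re.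
  apply/convergentP; exists rho, (eps^-1 * M); split=> // [|d].
    by rewrite mulr_ge0 // invr_ge0 ltW.
  apply: (mcombine_norm (R := 2 * eps)); rewrite ?invr_ge0 ?(ltW eps0) ?(ltW rho0) //.
  by move=> m e; case: (HB m) => _ _; apply; rewrite // ltW.
apply: funext => m0; pose d := (mdeg m0).+1.
rewrite mseriesB -{1}[F]mcombine_var.
have -> : mcombine (mmap1 var) F m0 - msubst F m0 =
    \sum_(m : 'X_{1..n < (mdeg m0).+2}) F m * (mmap1 var m - mmap1 h m) m0.
  by rewrite -sumrB; apply: eq_bigr => m _; rewrite mseriesB mulrBr.
transitivity ((\sum_j (var j - h j) * \sum_(m : 'X_{1..n < d.+1}) cst (F m) * B m j) m0).
  under [in RHS]eq_bigr => j _ do rewrite mulr_sumr.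
  rewrite exchange_big /= mseries_sum; apply: eq_bigr => m _.
  case: (HB m) => -> _ _; rewrite -mconstM mulr_sumr !mseries_sum.
  by apply: eq_bigr => j _; rewrite mulrCA.
rewrite !mseries_sum; apply: eq_bigr => j _.
apply/eqP; rewrite eq_sym -subr_eq0 -mseriesB -mulrBr; apply/eqP.
have od : order_ge d (mcombine (B^~ j) F - \sum_(m : 'X_{1..n < d.+1}) cst (F m) * B m j).
  by move=> k kd; rewrite mseriesB (mcombineE _ (oB j) kd) subrr.
by apply: (order_geM (d := 0) (e := d)).
Qed.

End Point.
End Substitution.

(** * Transcendental numbers *)

(** Cantor's argument: choose nested intervals, the [k]-th of which avoids [e k]. *)
Lemma real_uncountable (K : realType) (e : nat -> K) : exists x, forall k, e k != x.
Proof.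
pose step k (ab : K * K) := let: (a, b) := ab in
  if e k <= (2 * a + b) / 3 then ((a + 2 * b) / 3, b) else (a, (2 * a + b) / 3).
pose ab := fix ab k : K * K := if k is k'.+1 then step k' (ab k') else (0, 1).
have abS k : ab k.+1 = step k (ab k) by [].
have lt k : (ab k).1 < (ab k).2.
  elim: k => [|k]; first by rewrite ltr01.
  rewrite abS /step; case: (ab k) => a b /= ab'.
  by case: ifP => _ /=; rewrite ?ltr_pdivrMr ?ltr_pdivlMr; lra.
have mono k l : (ab k).1 <= (ab (k + l)%N).1 /\ (ab (k + l)%N).2 <= (ab k).2.
  elim: l => [|l [IH1 IH2]]; first by rewrite addn0.
  rewrite addnS abS; move: (lt (k + l)%N) IH1 IH2; rewrite /step.
  by case: (ab (k + l)%N) => a b /=; case: ifP => _ /=; lra.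
have cross k l : (ab k).1 <= (ab l).2.
  apply: le_trans (mono k l).1 _; apply: le_trans (ltW (lt _)) _.
  by rewrite addnC; case: (mono l k).
pose S : set K := fun y => exists k, y = (ab k).1.
have S0 : (S !=set0)%classic by exists (ab 0%N).1, 0%N.
exists (sup S) => k.
have ge : (ab k.+1).1 <= sup S.
  apply: ub_le_sup; last by exists k.+1.
  by exists (ab 0%N).2 => _ [j ->]; apply: cross.
have le : sup S <= (ab k.+1).2 by apply: ge_sup => // _ [j ->]; apply: cross.
apply/eqP => ek; move: ge le (lt k); rewrite abS /step -ek.
by case: (ab k) => a b /=; case: ifP => /= [|/negbT]; rewrite -?ltNge; lra.
Qed.

Definition has_transcendentals (C : fieldType) : Prop :=
  forall (R : comNzRingType) (x : {rmorphism R -> C}), enumerable R ->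
  exists c, forall q : {poly R}, (map_poly x q).[c] = 0 -> map_poly x q = 0.

(** Countably many polynomials have countably many roots. *)
Lemma complex_transcendentals (K : realType) : has_transcendentals K[i]%C.
Proof.
move=> R x /enumerable_poly[e eP].
have roots k : exists s : seq K[i]%C, map_poly x (e k) <> 0 ->
    forall c, root (map_poly x (e k)) c -> c \in s.
  have [r rE] := closed_field_poly_normal (map_poly x (e k)).
  exists r => /eqP nz c; rewrite rE rootZ ?lead_coef_eq0 //.
  by rewrite root_prod_XsubC.
have [r rP] := choice roots.
pose e' j := let: (k, l) := odflt (0%N, 0%N) (unpickle j) in complex.Re (nth 0 (r k) l).
have [c cP] := real_uncountable e'.
exists (c%:C)%C => q q0; apply: contrapT => nz.
have [k ek] := eP q; have := rP k; rewrite ek => /(_ nz (c%:C)%C).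
rewrite /root q0 eqxx => /(_ isT) cr.
have /eqP := cP (pickle (k, index (c%:C)%C (r k))); apply.
by rewrite /e' pickleK /= nth_index.
Qed.

(** * Algebraic points *)

Definition prime_ideal (R : comNzRingType) (P : R -> Prop) : Prop :=
  [/\ ideal P, ~ P 1 & forall a b, P (a * b) -> P a \/ P b].

Lemma prime_idealX (R : comNzRingType) (P : R -> Prop) a k :
  prime_ideal P -> P (a ^+ k) -> P a.
Proof.
case=> iP P1 PM; elim: k => [|k IH]; first by rewrite expr0.
by rewrite exprS => /PM[].
Qed.

Section AlgebraicPoint.
Variables (C : numClosedFieldType) (R : comNzRingType) (x : {rmorphism R -> C}).
Variable P : {poly R} -> Prop.
Hypothesis primeP : prime_ideal P.
Hypothesis P_const : forall a : R, P a%:P <-> x a = 0.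

Lemma prime_kernel s : map_poly x s = 0 -> P s.
Proof.
move=> s0; case: primeP => iP _ _; rewrite -[s]coefK poly_def.
apply: ideal_sum => // i _; rewrite -mul_polyC mulrC; case: (iP) => _ _; apply.
by apply/P_const; rewrite -coef_map s0 coef0.
Qed.

(** The coefficients of high degree in the kernel of [x] can be dropped. *)
Lemma kernel_truncate s : map_poly x s != 0 -> exists s', [/\
  map_poly x s' = map_poly x s, size s' = size (map_poly x s),
  x (lead_coef s') != 0 & P s' <-> P s].
Proof.
move=> nz; pose d := size (map_poly x s); exists (take_poly d s).
have d0 : (0 < d)%N by rewrite size_poly_gt0.
have lead : (take_poly d s)`_d.-1 = s`_d.-1 by rewrite coef_take_poly prednK // leqnn.
have xlead : x s`_d.-1 != 0.
  by rewrite -coef_map -lead_coefE lead_coef_eq0.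
have mapE : map_poly x (take_poly d s) = map_poly x s.
  apply/polyP => i; rewrite !coef_map coef_take_poly; case: ltnP => // di.
  by rewrite raddf0 -coef_map nth_default.
have sz : size (take_poly d s) = d.
  have : (d.-1 < size (take_poly d s))%N.
    rewrite ltnNge; apply/negP => /leq_sizeP/(_ _ (leqnn _)); rewrite lead => s0.
    by move: xlead; rewrite s0 rmorph0 eqxx.
  by rewrite prednK // => lt; apply/eqP; rewrite eqn_leq size_take_poly.
split=> //; first by rewrite lead_coefE sz lead.
case: primeP => iP _ _; have Pd : P (s - take_poly d s).
  by apply: prime_kernel; rewrite rmorphB /= mapE subrr.
split=> Ps; first by rewrite -[s](subrK (take_poly d s)); case: iP => _ iD _; apply: iD.
by rewrite -[take_poly d s](subKr s); apply: idealB.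
Qed.

(** The adjunction of an algebraic element to the image of [x], without fields of
    fractions.  Let [q] in [P] be of least degree among those not killed by [x].
    Pseudo-division by [q] shows that all of [P] vanishes at any root [c] of the
    image of [q], which is therefore the minimal polynomial of [c]. *)
Lemma algebraic_point : (exists2 q, P q & map_poly x q != 0) ->
  exists c q, [/\ P q, x (lead_coef q) != 0, (map_poly x q)^`().[c] != 0,
    forall s, P s <-> (map_poly x s).[c] = 0 &
    forall s, P s -> exists k u r,
      (lead_coef q ^+ k)%:P * s = u * q + r /\ map_poly x r = 0].
Proof.
case: (primeP) => iP P1 PM [q1 Pq1 q1nz]; case: (iP) => P0 PD PMl.
have ex : exists m, `[< exists q, [/\ P q, map_poly x q != 0 & size (map_poly x q) = m] >].
  by exists (size (map_poly x q1)); apply/asboolP; exists q1.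
case: (ex_minnP ex) => m /asboolP[q0 [Pq0 q0nz sq0]] minm.
have [q [qE sq lq Pq']] := kernel_truncate q0nz; have Pq := Pq'.2 Pq0.
have qnz : q != 0 by rewrite -size_poly_gt0 sq size_poly_gt0.
have minq s : P s -> map_poly x s != 0 -> (size q <= size (map_poly x s))%N.
  by move=> Ps snz; rewrite sq sq0; apply: minm; apply/asboolP; exists s.
have small s : P s -> (size s < size q)%N -> map_poly x s = 0.
  move=> Ps lt; apply/eqP; apply: contraT => nz; move: (minq s Ps nz).
  by rewrite leqNgt (leq_ltn_trans (size_poly _ _) lt).
have pdiv (d s : {poly R}) : d != 0 -> exists k u r,
    (lead_coef d ^+ k)%:P * s = u * d + r /\ (size r < size d)%N.
  move=> d0; exists (Pdiv.Ring.rscalp s d), (Pdiv.Ring.rdivp s d), (Pdiv.Ring.rmodp s d).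
  by rewrite mul_polyC Pdiv.ComRing.rdivp_eq; split=> //; apply: Pdiv.CommonRing.ltn_rmodpN0.
have divq s : P s -> exists k u r,
    (lead_coef q ^+ k)%:P * s = u * q + r /\ map_poly x r = 0.
  move=> Ps; have [k [u [r [E sr]]]] := pdiv q s qnz.
  exists k, u, r; split=> //; apply: small => //.
  have -> : r = (lead_coef q ^+ k)%:P * s - u * q by rewrite E addrC addKr.
  by apply: idealB => //; apply: PMl.
have size_q : (1 < size q)%N.
  rewrite ltnNge; apply/negP => /size1_polyC qc; case/eqP: lq.
  by apply/P_const; rewrite qc lead_coefC -qc.
have size_xq : (1 < size (map_poly x q))%N by rewrite qE -sq.
have [c rc] : exists c, root (map_poly x q) c.
  by apply/closed_rootP; rewrite neq_ltn size_xq orbT.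
move/eqP: rc => rc.
have evalE s k u r : (lead_coef q ^+ k)%:P * s = u * q + r -> map_poly x r = 0 ->
    x (lead_coef q) ^+ k * (map_poly x s).[c] = 0.
  move=> /(congr1 (map_poly x)); rewrite rmorphD !rmorphM /= map_polyC /= rmorphXn.
  move=> E r0; rewrite r0 addr0 in E; move/(congr1 (horner^~ c)): E.
  by rewrite !hornerM hornerC rc mulr0.
have PevL s : P s -> (map_poly x s).[c] = 0.
  move=> Ps; have [k [u [r [E r0]]]] := divq s Ps.
  by have /eqP := evalE s k u r E r0; rewrite mulf_eq0 expf_eq0 (negPf lq) andbF => /eqP.
(* Conversely, let s0 be of least degree in the ideal of all polynomials that
   vanish at c.  It divides q up to kernel and constants, the cofactor is not in P
   for reasons of degree, hence s0 is in the prime ideal P. *)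
have ex2 : exists m', `[< exists s, [/\ (map_poly x s).[c] = 0, map_poly x s != 0
    & size (map_poly x s) = m'] >].
  by exists (size (map_poly x q)); apply/asboolP; exists q; split=> //; rewrite qE.
case: (ex_minnP ex2) => m2 /asboolP[s0 [s0c s0nz ss0]] minm2.
have [s1 [s1E ss1 ls1 _]] := kernel_truncate s0nz.
have s1nz : s1 != 0 by rewrite -size_poly_gt0 ss1 size_poly_gt0.
have s1c : (map_poly x s1).[c] = 0 by rewrite s1E.
have small2 s : (map_poly x s).[c] = 0 -> (size s < size s1)%N -> map_poly x s = 0.
  move=> sc lt; apply/eqP; apply: contraT => nz.
  have : (size s1 <= size (map_poly x s))%N.
    by rewrite ss1 ss0; apply: minm2; apply/asboolP; exists s.
  by rewrite leqNgt (leq_ltn_trans (size_poly _ _) lt).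
have div2 s : (map_poly x s).[c] = 0 -> exists k u r,
    (lead_coef s1 ^+ k)%:P * s = u * s1 + r /\ map_poly x r = 0.
  move=> sc; have [k [u [r [E sr]]]] := pdiv s1 s s1nz.
  exists k, u, r; split=> //; apply: small2 => //.
  have -> : r = (lead_coef s1 ^+ k)%:P * s - u * s1 by rewrite E addrC addKr.
  by rewrite rmorphB !rmorphM /= hornerD hornerN !hornerM sc s1c !mulr0 subrr.
have Ps1 : P s1.
  have [k [u [r [E r0]]]] := div2 q rc.
  have : P (u * s1).
    have -> : u * s1 = (lead_coef s1 ^+ k)%:P * q - r by rewrite E addrK.
    by apply: idealB; [|apply: PMl|apply: prime_kernel].
  case/PM=> // Pu.
  have /(congr1 (map_poly x)) := E; rewrite rmorphD !rmorphM /= map_polyC /= rmorphXn r0 addr0.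
  have lk : x (lead_coef s1) ^+ k != 0 by rewrite expf_neq0.
  have [u0|unz] := eqVneq (map_poly x u) 0.
    move=> /eqP; rewrite u0 mul0r mul_polyC scaler_eq0 (negPf lk) /=.
    by rewrite qE (negPf q0nz).
  move=> /(congr1 (fun p : {poly C} => size p)); rewrite mul_polyC size_scale //.
  rewrite size_mul ?s1E // qE -sq => sz; have := minq u Pu unz.
  rewrite sz => le1.
  have : (size (map_poly x s0) <= 1)%N.
    have : (0 < size (map_poly x u))%N by rewrite size_poly_gt0.
    by move: le1; clear; case: (size _) => // a; case: (size _) => [|[|b]] //; lia.
  move/size1_polyC => s0C; move: s0c s0nz; rewrite s0C hornerC => ->.
  by rewrite polyC0 eqxx.
have Pev s : P s <-> (map_poly x s).[c] = 0.
  split=> [|sc]; first exact: PevL.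
  have [k [u [r [E r0]]]] := div2 s sc.
  have : P ((lead_coef s1 ^+ k)%:P * s).
    by rewrite E; apply: PD; [apply: PMl|apply: prime_kernel].
  case/PM => //; rewrite polyC_exp => /(prime_idealX primeP)/P_const l0.
  by rewrite l0 eqxx in ls1.
exists c, q; split=> //.
apply/eqP => dc; have Pdq : P q^`() by apply/Pev; rewrite -deriv_map.
have char0 k : k.+1%:R != 0 :> C by rewrite pnatr_eq0.
have dnz := deriv_neq0 char0 size_xq.
move: (minq _ Pdq); rewrite -deriv_map => /(_ dnz); rewrite leqNgt sq -qE.
by rewrite lt_size_deriv // -size_poly_gt0 ltnW.
Qed.

End AlgebraicPoint.

(** * A generic point and its germ *)

Section GenericPoint.
Variables (C : numClosedFieldType) (n : nat).
Local Notation E := (mseries C n).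
Local Notation cst := (@mconst C n).
Local Notation X := (extend0 (@mvar C n)).

Lemma convergent_X j : convergent (X j).
Proof.
rewrite /extend0; case: insubP => [i _ _|_]; first exact: convergent_var.
exact: subring0 (convergent_subring C n).
Qed.

Lemma mcoef0_X j : mcoef0 (X j) = 0.
Proof. by rewrite /extend0; case: insubP => [i _ _|_]; rewrite ?mcoef0_var. Qed.

Lemma supported_X (I : nat -> bool) j : I j -> supported I (X j).
Proof.
rewrite /extend0; case: insubP => [i _ <-|_ _]; first exact: supported_var.
exact: subring0 (supported_subring C n I).
Qed.

Lemma analytic_const (I : nat -> bool) c : analytic_in I (cst c).
Proof. by split; [apply: convergent_const|apply: supported_const]. Qed.

Lemma analytic_convergent (F : E) : convergent F -> analytic_in xpredT F.
Proof. by move=> cF; split=> // m _ j _. Qed.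

(** Ideals of the ring of convergent series, as predicates on formal series. *)
Definition germ_ideal (Q : E -> Prop) : Prop :=
  [/\ Q 0, forall F G : E, Q F -> Q G -> Q (F + G) &
    forall F G : E, convergent G -> Q F -> Q (G * F)].

Lemma germ_ideal_sum (Q : E -> Prop) (J : Type) (r : seq J) (F : J -> E) :
  germ_ideal Q -> (forall j, Q (F j)) -> Q (\sum_(j <- r) F j).
Proof. by case=> Q0 QD _ QF; elim/big_ind: _ => // F' G; apply: (QD). Qed.

Lemma germ_idealB (Q : E -> Prop) (F G : E) : germ_ideal Q -> Q F -> Q G -> Q (F - G).
Proof.
case=> Q0 QD QM QF QG; apply: (QD) => //; rewrite -mulN1r; apply: (QM) => //.
have sC := convergent_subring C n.
by apply: (subringN sC); apply: (subring1 sC).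
Qed.

Lemma tower_eval_congruence (A : comNzRingType) (f : {rmorphism A -> E}) (k k' : nat -> E)
    i (Q : E -> Prop) (r : tower A i) :
  germ_ideal Q -> (forall a, convergent (f a)) ->
  (forall j, (j < i)%N -> [/\ convergent (k j), convergent (k' j) & Q (k j - k' j)]) ->
  Q (tower_eval f k i r - tower_eval f k' i r).
Proof.
move=> iQ cf; have sC := convergent_subring C n; case: (iQ) => Q0 QD QM.
elim: i r => [|i IH] r kk; first by rewrite subrr.
rewrite !tower_evalS !(horner_coef_wide _ (size_poly _ _)) -sumrB.
apply: germ_ideal_sum => // l; rewrite !coef_map /=.
set a := tower_eval f k i _; set a' := tower_eval f k' i _.
have [ck ck' Qk] := kk i (ltnSn i).
have -> : a * k i ^+ l - a' * k' i ^+ l =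
    k i ^+ l * (a - a') + a' * (k i ^+ l - k' i ^+ l) by ring.
have kj j : (j < i)%N -> (j < i.+1)%N by move/ltnW.
apply: (QD).
  apply: (QM); first exact: (subringX sC).
  by apply: IH => j ji; apply: kk; apply: kj.
apply: (QM).
  apply: (@subring_tower_eval A E (@convergent C n) f k' i _ sC cf) => j ji.
  by case: (kk j (kj j ji)).
rewrite subrXX mulrC; apply: (QM) => //; apply: (subring_sum sC) => j _.
by apply: (subringM sC); apply: (subringX sC).
Qed.

Variables (A : comNzRingType) (iota : {rmorphism A -> C}).
Variables (O : comNzRingType) (phi0 : {rmorphism A -> O}) (g : nat -> O).
Variable P : O -> Prop.
Hypothesis primeP : prime_ideal P.
Hypothesis P_const : forall a, P (phi0 a) <-> iota a = 0.
Hypothesis A_enum : enumerable A.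
Hypothesis transc : has_transcendentals C.

Local Notation phi := (tower_eval phi0 g).
Let iotaE : {rmorphism A -> E} := GRing.RMorphism.clone _ _ (@mconst C n \o iota) _.

Definition point (c : nat -> C) i := tower_eval iota c i.
Definition germ (c : nat -> C) (h : nat -> E) i :=
  tower_eval iotaE (fun j => cst (c j) + h j) i.

(** The germ at a generic point of the variety of [P], in the space of the first
    [i] coordinates.  The point is [c]; the coordinates in [I] form a transcendence
    basis, and near [c] the variety is the graph of [h], a family of series in the
    displacements [X_j], [j] in [I].  The third clause says that the graph lies in
    the variety, the fourth that the equations [X_j = h_j] of the graph belong to
    the ideal generated by the expansions of the relations in [P]. *)
Definition generic_germ (i : nat) (c : nat -> C) (h : nat -> E) (I : nat -> bool) : Prop :=
  [/\ forall r, P (phi i r) <-> point c i r = 0,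
      forall j, (j < i)%N ->
        [/\ analytic_in I (h j), mcoef0 (h j) = 0 & I j -> h j = X j],
      forall r, point c i r = 0 -> germ c h i r = 0,
      forall Q, germ_ideal Q ->
        (forall r, point c i r = 0 -> Q (germ c X i r)) ->
        forall j, (j < i)%N -> Q (X j - h j) &
      forall j, I j -> (j < i)%N].

Lemma germ_coef0 c h i r : (forall j, (j < i)%N -> mcoef0 (h j) = 0) ->
  mcoef0 (germ c h i r) = point c i r.
Proof.
move=> h0; rewrite /germ (rmorph_tower_eval (f' := iota)) => [|a].
  apply: eq_tower_eval => // j ji.
  by rewrite /= rmorphD /= mcoef0_const h0 ?addr0.
exact: mcoef0_const.
Qed.

Lemma germ_analytic (I : nat -> bool) c h i r :
  (forall j, (j < i)%N -> analytic_in I (h j)) -> analytic_in I (germ c h i r).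
Proof.
move=> ah; have sA := analytic_subring C n I.
apply: (@subring_tower_eval A E (analytic_in I) _ _ i r sA) => [a|j ji].
  exact: analytic_const.
by apply: (subringD sA); [apply: analytic_const|apply: ah].
Qed.

Lemma germ_convergent c h i r :
  (forall j, (j < i)%N -> convergent (h j)) -> convergent (germ c h i r).
Proof.
move=> ch; have [|//] := @germ_analytic xpredT c h i r.
by move=> j ji; apply: analytic_convergent; apply: ch.
Qed.

(** Induction on the number of generators.  If the new generator is transcendental
    over the previous ones modulo [P], give it a transcendental value, and let it be
    a new coordinate.  If it is algebraic, its value is a simple root of its minimal
    equation, which Hensel's lemma continues to a series [h0]; the expansion of the
    minimal equation is [X - h0] times a unit, modulo the previous equations. *)
Lemma generic_germ_exists i : exists c h I, generic_germ i c h I.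
Proof.
have sC := convergent_subring C n.
elim: i => [|i [c [h [I [kerP hP kerT idealh I_lt]]]]].
  exists (fun=> 0), (fun=> 0), xpred0; split=> // r.
  by rewrite /point /germ /= => ->; apply: rmorph0.
pose x := point c i; pose T := germ c h i; pose tau := germ c X i.
pose PS (q : {poly (tower A i)}) := P (phi i.+1 q).
have primePS : prime_ideal PS.
  case: primeP => -[P0 PD PM] P1 PMM; split; first split.
  - by rewrite /PS rmorph0.
  - by move=> a b; rewrite /PS rmorphD; apply: PD.
  - by move=> a b; rewrite /PS rmorphM; apply: PM.
  - by rewrite /PS rmorph1.
  - by move=> a b; rewrite /PS rmorphM; apply: PMM.
have PS_const r : PS r%:P <-> x r = 0 by rewrite /PS tower_evalC; apply: kerP.
have evalE (S : comNzRingType) (f : {rmorphism A -> S}) (k k' : nat -> S) q :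
    (forall j, (j < i)%N -> k' j = k j) ->
    tower_eval f k' i.+1 q = (map_poly (tower_eval f k i) q).[k' i].
  move=> kk; rewrite tower_evalS; congr (_.[_]); apply: eq_map_poly => r.
  exact: eq_tower_eval.
have T0 r : mcoef0 (T r) = x r by apply: germ_coef0 => j /hP[].
have map_T0 q : map_poly (@mcoef0 C n) (map_poly T q) = map_poly x q.
  by rewrite -map_poly_comp; apply: eq_map_poly.
have anT r : analytic_in I (T r) by apply: germ_analytic => j /hP[].
pose upd (S : Type) (k : nat -> S) a j := if j == i then a else k j.
have upd_i S k a : @upd S k a i = a by rewrite /upd eqxx.
have upd_lt S k a j : (j < i)%N -> @upd S k a j = k j.
  by move=> ji; rewrite /upd ltn_eqF.
have pointE c0 q : point (upd _ c c0) i.+1 q = (map_poly x q).[c0].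
  by rewrite /point (evalE _ _ c) ?upd_i // => j; apply: upd_lt.
have germE c0 h0 q : germ (upd _ c c0) (upd _ h h0) i.+1 q =
    (map_poly T q).[cst c0 + h0].
  rewrite /germ (evalE _ _ (fun j => cst (c j) + h j)) ?upd_i // => j ji.
  by rewrite !upd_lt.
have germXE c0 q : germ (upd _ c c0) X i.+1 q = (map_poly tau q).[cst c0 + X i].
  rewrite /germ (evalE _ _ (fun j => cst (c j) + X j)) ?upd_i // => j ji.
  by rewrite !upd_lt.
have idealh' c0 Q : germ_ideal Q ->
    (forall r, point (upd _ c c0) i.+1 r = 0 -> Q (germ (upd _ c c0) X i.+1 r)) ->
    forall j, (j < i)%N -> Q (X j - h j).
  move=> iQ Qr; apply: idealh => // r r0.
  have := Qr (r%:P : {poly (tower A i)}); rewrite pointE germXE !map_polyC !hornerC.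
  exact.
have [[q1 Pq1 q1nz]|noalg] := pselect (exists2 q, PS q & map_poly x q != 0); last first.
  have [c0 c0P] := transc x (enumerable_tower i A_enum).
  exists (upd _ c c0), (upd _ h (X i)), (fun j => I j || (j == i)).
  have ker q : (map_poly x q).[c0] = 0 -> forall k, x q`_k = 0.
    by move=> /c0P q0 k; rewrite -coef_map q0 coef0.
  split.
  - move=> q; rewrite pointE; split=> [Pq|/c0P]; last first.
      exact: (@prime_kernel _ _ x PS).
    have [->|qnz] := eqVneq (map_poly x q) 0; first by rewrite horner0.
    by case: noalg; exists q.
  - move=> j; rewrite ltnS leq_eqVlt => /orP[/eqP ->|ji].
      rewrite upd_i; split=> //; last exact: mcoef0_X.
      split; first exact: convergent_X.
      by apply: supported_X; rewrite eqxx orbT.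
    rewrite upd_lt //; have [[ch sh] h0 hX] := hP j ji; split=> //.
      by split=> //; apply: supportedW sh => l ->.
    by rewrite ltn_eqF ?orbF.
  - move=> q; rewrite pointE germE => /ker q0.
    by rewrite horner_coef big1 // => k _; rewrite coef_map /= [T _](kerT _ (q0 k)) mul0r.
  - move=> Q iQ Qr j; rewrite ltnS leq_eqVlt => /orP[/eqP ->|ji].
      by rewrite upd_i subrr; case: iQ.
    by rewrite upd_lt //; apply: idealh' Qr _ ji.
  - move=> j /orP[/I_lt/ltnW|/eqP ->] //; by rewrite ltnS.
have [|c0 [q [Pq lq dq Pev divq]]] := @algebraic_point C _ x PS primePS PS_const.
  by exists q1.
have [|||h0 [an0 h00 Th0]] := @hensel C n I (map_poly T q) c0.
- by move=> k; rewrite coef_map; apply: anT.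
- by rewrite map_T0; apply/Pev.
- by rewrite map_T0.
exists (upd _ c c0), (upd _ h h0), I; split.
- by move=> s; rewrite pointE; apply: Pev.
- move=> j; rewrite ltnS leq_eqVlt => /orP[/eqP ->|ji]; last by rewrite upd_lt //; apply: hP.
  by rewrite upd_i; split=> // /I_lt; rewrite ltnn.
- move=> s; rewrite pointE germE => /Pev Ps.
  have [k [u [r [Es r0]]]] := divq s Ps.
  have Tr0 : map_poly T r = 0.
    by apply/polyP => l; rewrite coef_map coef0; apply: kerT; rewrite -[LHS]coef_map r0 coef0.
  have Tlq : mcoef0 (T (lead_coef q)) != 0 by rewrite T0.
  have [G _ GE] := analytic_inverse (anT _) Tlq.
  have := congr1 (fun p => (map_poly T p).[cst c0 + h0]) Es.
  rewrite /= rmorphD !rmorphM /= Tr0 addr0 map_polyC /= !hornerM hornerC Th0 mulr0 rmorphXn /=.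
  move=> /(congr1 (fun F => G ^+ k * F)); rewrite mulr0 mulrA -exprMn mulrC.
  by rewrite [G * _]mulrC GE expr1n mulr1.
- move=> Q iQ Qr j; rewrite ltnS leq_eqVlt => /orP[/eqP ->|ji]; last first.
    by rewrite upd_lt //; apply: idealh' Qr _ ji.
  rewrite upd_i; case: (iQ) => Q0 QD QM.
  pose Y : E := cst c0 + X i.
  have cY : convergent Y.
    by apply: (subringD sC); [apply: convergent_const|apply: convergent_X].
  have Qtau : Q (map_poly tau q).[Y] by rewrite -germXE; apply: Qr; rewrite pointE; apply/Pev.
  have QT : Q (map_poly T q).[Y].
    rewrite -[(map_poly T q).[Y]](subKr (map_poly tau q).[Y]).
    apply: germ_idealB => //.
    rewrite !(horner_coef_wide _ (size_poly _ _)) -sumrB.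
    apply: germ_ideal_sum => // k; rewrite !coef_map -mulrBl mulrC; apply: (QM).
      exact: (subringX sC).
    apply: tower_eval_congruence => // [a|l li]; first exact: convergent_const.
    have [[ch _] _ _] := hP l li.
    split; try (by apply: (subringD sC); [apply: convergent_const|
      first [apply: convergent_X|apply: ch]]).
    have -> : cst (c l) + X l - (cst (c l) + h l) = X l - h l by ring.
    exact: idealh' Qr _ li.
  have [U [UE U0 Uc]] := horner_diff (@mcoef0 C n) (map_poly T q) Y (cst c0 + h0).
  have mY : mcoef0 Y = c0 by rewrite rmorphD /= mcoef0_const mcoef0_X addr0.
  have mh : mcoef0 (cst c0 + h0) = c0 by rewrite rmorphD /= mcoef0_const h00 addr0.
  have Unz : mcoef0 U != 0 by rewrite U0 /= ?mY ?mh // map_T0.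
  have cU : convergent U.
    apply: Uc => // [k|]; first by rewrite coef_map; case: (anT q`_k).
    by apply: (subringD sC); [apply: convergent_const|case: an0].
  have [G [cG _] GE] := analytic_inverse (analytic_convergent cU) Unz.
  have -> : X i - h0 = G * (map_poly T q).[Y].
    move: UE; rewrite Th0 subr0 => ->.
    have -> : Y - (cst c0 + h0) = X i - h0 by rewrite /Y; ring.
    by rewrite mulrCA [G * U]mulrC GE mulr1.
  exact: QM.
- by move=> j /I_lt/ltnW.
Qed.

End GenericPoint.

(** * Smoothness of a generic point *)

Section Coordinates.
Variables (C : numFieldType) (n : nat) (I : nat -> bool).
Local Notation E := (mseries C n).

Local Notation J := [pred j : 'I_n | I j].
Local Notation r := #|J|.
Let coord (i : 'I_r) : 'I_n := enum_val i.

Definition monom_embed (a : 'X_{1..r}) : 'X_{1..n} :=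
  (\sum_(i < r) U_(coord i) *+ a i)%MM.

Definition monom_restrict (m : 'X_{1..n}) : 'X_{1..r} :=
  [multinom m (coord i) | i < r].

Lemma monom_embedE a i : monom_embed a (coord i) = a i.
Proof.
rewrite /monom_embed mnm_sumE (bigD1 i) //= mulmnE mnm1E eqxx mul1n big1 ?addn0 // => k ki.
rewrite mulmnE mnm1E (_ : _ == _ = false) //.
by apply: contraNF ki => /eqP/enum_val_inj ->.
Qed.

Lemma monom_embed_supp a (j : 'I_n) : monom_embed a j != 0%N -> I j.
Proof.
apply: contraNT => nI; rewrite /monom_embed mnm_sumE big1 // => i _.
rewrite mulmnE mnm1E (_ : _ == _ = false) //.
by apply: contraNF nI => /eqP <-; have := enum_valP i.
Qed.

Lemma monom_embedK : cancel monom_embed monom_restrict.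
Proof. by move=> a; apply/mnmP => i; rewrite mnmE monom_embedE. Qed.

Lemma monom_restrictK (m : 'X_{1..n}) : (forall j : 'I_n, m j != 0%N -> I j) ->
  monom_embed (monom_restrict m) = m.
Proof.
move=> mI; apply/mnmP => j; have [Ij|nI] := boolP (I j); last first.
  rewrite (_ : m j = 0%N); last by apply/eqP; apply: contraNT nI => /mI.
  by apply/eqP; apply: contraNT nI => /monom_embed_supp.
have Jj : j \in J by [].
by rewrite -[j](enum_rankK_in Jj Jj) monom_embedE mnmE.
Qed.

Lemma mdeg_embed a : mdeg (monom_embed a) = mdeg a.
Proof.
rewrite /monom_embed mdeg_sum mdegE; apply: eq_bigr => i _.
by rewrite mdegMn mdeg1 mul1n.
Qed.

Definition coordinates (i : 'I_r) : series C n := mvar C (coord i).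

Lemma smonom_coordinates a : smonom coordinates a = mseries_of 'X_[monom_embed a].
Proof.
rewrite /monom_embed -mprodXnE rmorph_prod /=; apply: eq_bigr => i _.
rewrite rmorphXn /=; elim: (a i) => // k IH.
by rewrite iterS IH exprS.
Qed.

Lemma scomp_coordinates (G : series C r) m :
  scomp G coordinates m =
  if [forall j : 'I_n, (m j != 0%N) ==> I j] then G (monom_restrict m) else 0.
Proof.
rewrite /scomp; under eq_bigr => a _ do rewrite smonom_coordinates /mseries_of mcoeffX.
case: forallP => [mI|nI]; last first.
  rewrite big1 // => a _; case: eqP => [am|]; rewrite ?mulr0 //; case: nI => j.
  by apply/implyP; rewrite -am; apply: monom_embed_supp.
have mE : monom_embed (monom_restrict m) = m.
  by apply: monom_restrictK => j; apply/implyP.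
have md : (mdeg (monom_restrict m) < (mdeg m).+1)%N by rewrite -mdeg_embed mE.
rewrite (bigD1 (BMultinom md)) //= mE eqxx mulr1 big1 ?addr0 // => a am.
case: eqP => [aE|]; rewrite ?mulr0 //; case/eqP: am; apply/val_inj => /=.
by have /(congr1 monom_restrict) := aE; rewrite monom_embedK.
Qed.

Lemma scomp_supported (G : series C r) :
  supported I (scomp G coordinates).
Proof.
move=> m; rewrite scomp_coordinates; case: forallP => [mI _ j|_]; last by rewrite eqxx.
by apply/implyP.
Qed.

Lemma supported_scomp (F : E) : supported I F ->
  scomp (F \o monom_embed) coordinates = F.
Proof.
move=> sF; apply: funext => m; rewrite scomp_coordinates.
case: forallP => [mI|nI] /=.
  by rewrite monom_restrictK // => j; apply/implyP.
apply/esym/eqP; apply: contrapT => /negP Fm; apply: nI => j; apply/implyP.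
exact: sF.
Qed.

Lemma convergent_embed (F : E) : convergent F ->
  @convergent C r (F \o monom_embed).
Proof.
case=> rho [M [rho0 FM]]; exists rho, M; split=> // d; apply: le_trans (FM d).
have emb_d (a : 'X_{1..r < d}) : (mdeg (monom_embed a) < d)%N by rewrite mdeg_embed bmdeg.
pose emb (a : 'X_{1..r < d}) := BMultinom (emb_d a).
have emb_inj : injective emb.
  move=> a b /(congr1 val) /= /(congr1 monom_restrict); rewrite !monom_embedK.
  exact: val_inj.
pose H (m : 'X_{1..n < d}) := `|F m| * rho ^+ mdeg m.
rewrite (eq_bigr (fun a => H (emb a))) => [|a _]; last by rewrite /H /= mdeg_embed.
rewrite -(big_map emb xpredT H) /= big_uniq /=; last first.
  by rewrite map_inj_uniq // /index_enum -enumT enum_uniq.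
rewrite big_mkcond; apply: ler_sum => m _; case: ifP => // _.
by rewrite mulr_ge0 // exprn_ge0 // ltW.
Qed.

End Coordinates.

Section SmoothPoint.
Variables (C : numClosedFieldType) (A : comNzRingType) (iota : {rmorphism A -> C}).
Variables (O : comAlgType A) (n : nat) (g : 'I_n -> O).
Local Notation E := (mseries C n).
Local Notation cst := (@mconst C n).
Local Notation D := (@all_scalars C).

(** Sums over a sequence are easier to combine than sums over ['I_l]. *)
Lemma hol_idealP (x : O -> C) (F : series C n) : hol_ideal iota g D x F <->
  exists s : seq (E * {mpoly A[n]}), (forall Gp, Gp \in s -> convergent Gp.1 /\ relation g Gp.2) /\
    F = \sum_(Gp <- s) Gp.1 * (taylor iota g x Gp.2 : E).
Proof.
split=> [[l [G [p [hG rp FE]]]]|[s [sP FE]]].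
  exists [seq ((G j : E), p j) | j <- enum 'I_l]; split.
    by move=> _ /mapP[j _ ->] /=; split=> //; case: (hG j).
  rewrite big_map big_enum /=; apply: funext => m.
  by rewrite FE mseries_sum.
have sP' j : convergent (tnth (in_tuple s) j).1 /\ relation g (tnth (in_tuple s) j).2.
  by apply: sP; apply: mem_tnth.
exists (size s), (fun j => (tnth (in_tuple s) j).1), (fun j => (tnth (in_tuple s) j).2); split.
- move=> j; split; last by case: (sP' j).
  by move=> m; exists ((tnth (in_tuple s) j).1 m), 1%N; rewrite divr1.
- by move=> j; case: (sP' j).
- move=> m; rewrite FE (big_tnth _ _ s) mseries_sum; exact: eq_bigr.
Qed.

Lemma hol_germ_ideal (x : O -> C) : germ_ideal (hol_ideal iota g D x : E -> Prop).
Proof.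
split.
- by apply/hol_idealP; exists [::]; rewrite big_nil.
- move=> F G /hol_idealP[s [sP ->]] /hol_idealP[u [uP ->]]; apply/hol_idealP.
  exists (s ++ u); rewrite big_cat; split=> // Gp.
  by rewrite mem_cat => /orP[/sP|/uP].
- move=> F G cG /hol_idealP[s [sP ->]]; apply/hol_idealP.
  exists [seq (G * Gp.1, Gp.2) | Gp <- s]; split.
    move=> _ /mapP[Gp /sP[cGp rGp] ->]; split=> //.
    exact: (subringM (convergent_subring C n)).
  by rewrite big_map mulr_sumr; apply: eq_bigr => Gp _; rewrite mulrA.
Qed.

(** For [h] the variables this is the Taylor expansion of [p] itself, for [h] the
    graph of a germ its restriction to the graph. *)
Lemma taylorE (x : O -> C) (p : {mpoly A[n]}) (q := map_mpoly iota p \mPo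
    [tuple 'X_i + (x (g i))%:MP | i < n]) (h : 'I_n -> E) (r : tower A n) :
  (forall (S : comNzRingType) (f : {rmorphism A -> S}) (k : 'I_n -> S),
    mmap f k p = tower_eval f (extend0 k) n r) ->
  mmap cst h q = tower_eval (GRing.RMorphism.clone _ _ (cst \o iota) _)
     (fun j => cst (extend0 (x \o g) j) + extend0 h j) n r.
Proof.
move=> pr; pose e1 : {rmorphism {mpoly C[n]} -> {mpoly C[n]}} :=
  GRing.RMorphism.clone _ _ (comp_mpoly [tuple 'X_i + (x (g i))%:MP | i < n]) _.
pose e2 : {rmorphism {mpoly C[n]} -> E} := GRing.RMorphism.clone _ _ (mmap cst h) _.
pose f : {rmorphism A -> {mpoly C[n]}} := GRing.RMorphism.clone _ _ (@mpolyC n C \o iota) _.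
have -> : mmap cst h q = (e2 \o e1) (mmap f (fun i => 'X_i) p) by [].
rewrite pr (rmorph_tower_eval (f' := GRing.RMorphism.clone _ _ (cst \o iota) _)).
  apply: eq_tower_eval => // j jn /=.
  have -> : j = Ordinal jn :> nat by []; rewrite !extend0E.
  rewrite comp_mpolyXU -tnth_nth tnth_mktuple mmapD mmapC mmapX mmap1U.
  by rewrite addrC.
by move=> a /=; rewrite comp_mpolyC mmapC.
Qed.

Lemma mmap_var (q : {mpoly C[n]}) : mmap cst (@mvar C n) q = mseries_of q.
Proof.
rewrite [in RHS](mpolyE q) rmorph_sum /mmap; apply: eq_bigr => m _.
by rewrite mmap1_var -mul_mpolyC rmorphM.
Qed.

Hypothesis g_gen : generates (in_alg O : A -> O) g.
Hypothesis A_enum : enumerable A.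
Hypothesis transc : has_transcendentals C.
Variable P : O -> Prop.
Hypothesis primeP : prime_ideal P.
Hypothesis P_const : forall a : A, P a%:A <-> iota a = 0.
Variable w : O.
Hypothesis Pw : ~ P w.
Hypothesis wP : forall f, P f -> exists2 b, iota b != 0 & b *: (w * f) = 0.

(** The transcendence basis [X_j], [j] in [I], provides the coordinates.  Any series
    [F] is congruent to [F(h)], a series in the coordinates, modulo the [X_j - h_j];
    these lie in the ideal of the germ, because a relation in [P] multiplied by [w],
    which is a unit at the point, becomes a relation over the fractions of [A].
    Conversely the substitution of [h] kills that ideal, and is the identity on
    series in the coordinates. *)
Lemma smooth_generic_point : exists x : {lrmorphism O -> C | iota \; *%R},
  (forall f, P f <-> x f = 0) /\ smooth_at iota g D x.
Proof.
pose phi0 : {rmorphism A -> O} := in_alg O.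
have PC a : P (phi0 a) <-> iota a = 0 by exact: P_const.
have [c [h [I [kerP hP kerT idealh I_lt]]]] :=
  @generic_germ_exists C n A iota O phi0 (extend0 g) P primeP PC A_enum transc n.
pose phi := tower_eval phi0 (extend0 g) n.
have surj f : exists r, phi r = f.
  have [p <-] := g_gen f; have [r rp] := tower_mpoly p; exists r.
  by rewrite -[LHS](rp _ phi0).
have [lift liftK] := choice surj.
have pointE r r' : phi r = phi r' -> point iota c n r = point iota c n r'.
  move=> rr; apply/eqP; rewrite -subr_eq0 -rmorphB; apply/eqP; apply/kerP.
  by rewrite rmorphB /= -/phi rr subrr; case: primeP => -[].
pose xf f := point iota c n (lift f).
have xE r : xf (phi r) = point iota c n r by apply: pointE; rewrite liftK.
have xfB : zmod_morphism xf.
  by move=> f f'; rewrite -[f]liftK -[f']liftK -rmorphB !xE rmorphB.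
have xfM : monoid_morphism xf.
  split=> [|f f']; first by rewrite -(rmorph1 phi) xE rmorph1.
  by rewrite -[f]liftK -[f']liftK -rmorphM !xE rmorphM.
have cstr a : exists r, phi r = a%:A /\ point iota c n r = iota a.
  have [r rp] := tower_mpoly (a%:MP : {mpoly A[n]}); exists r.
  split; first by have := rp _ phi0 g; rewrite mmapC => <-.
  have := rp _ iota (fun i => c i); rewrite mmapC => ->.
  by apply: eq_tower_eval => // j jn; rewrite -[j]/(val (Ordinal jn)) extend0E.
have xfZ : scalable_for (iota \; *%R) xf.
  move=> a f; have [r [ra pr]] := cstr a.
  by rewrite -[f]liftK -mulr_algl -ra -rmorphM !xE rmorphM pr.
pose x : {lrmorphism O -> C | iota \; *%R} := HB.pack xf
  (GRing.isZmodMorphism.Build O C xf xfB)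
  (GRing.isMonoidMorphism.Build O C xf xfM)
  (GRing.isScalable.Build A O C (iota \; *%R) xf xfZ).
exists x; split=> [f|].
  by rewrite -[f]liftK; split=> [/kerP|xf0]; [rewrite -xE|apply/kerP; rewrite -xE].
have xg (i : 'I_n) : x (g i) = c i.
  have [r rp] := tower_mpoly ('X_i : {mpoly A[n]}).
  have <- : phi r = g i by have := rp _ phi0 g; rewrite mmapX mmap1U => ->.
  rewrite [LHS]xE; have := rp _ iota (fun i => c i); rewrite mmapX mmap1U => ->.
  by apply: eq_tower_eval => // j jn; rewrite -[j]/(val (Ordinal jn)) extend0E.
have extE (k : nat -> E) j : (j < n)%N -> extend0 (fun i : 'I_n => k i) j = k j.
  by move=> jn; rewrite -[j]/(val (Ordinal jn)) extend0E.
have extx j : (j < n)%N -> extend0 (x \o g) j = c j.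
  by move=> jn; rewrite -[j]/(val (Ordinal jn)) extend0E; apply: xg.
pose is_lift (p : {mpoly A[n]}) (r : tower A n) :=
  forall (S : comNzRingType) (f : {rmorphism A -> S}) (k : 'I_n -> S),
    mmap f k p = tower_eval f (extend0 k) n r.
pose hh (j : 'I_n) : E := h j.
have hh0 j : mcoef0 (hh j) = 0 by case: (hP j (ltn_ord j)).
have tayE p r : is_lift p r -> taylor iota g x p = germ iota c (extend0 (@mvar C n)) n r.
  move=> pr; rewrite -[LHS]/(mseries_of _) -mmap_var (taylorE _ _ pr) /germ.
  by apply: (@eq_tower_eval A E) => // j jn; rewrite extx.
have substE p r : is_lift p r -> msubst hh (taylor iota g x p) = germ iota c h n r.
  move=> pr; rewrite -[taylor _ _ _ _]/(mseries_of _) (msubst_poly hh0) (taylorE _ _ pr) /germ.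
  by apply: (@eq_tower_eval A E) => // j jn; rewrite extx // extE.
pose Q : E -> Prop := hol_ideal iota g D x.
have iQ : germ_ideal Q := hol_germ_ideal x.
have Q_germ r : point iota c n r = 0 -> Q (germ iota c (extend0 (@mvar C n)) n r).
  move=> /kerP Pr; have [b b0 bwr] := wP Pr.
  have [rb rbP] := tower_mpoly (b%:MP : {mpoly A[n]}).
  pose pm s : {mpoly A[n]} := tower_eval (@mpolyC n A) (extend0 (fun i => 'X_i)) n s.
  have pmP s : is_lift (pm s) s.
    move=> S f k; rewrite -[LHS]/((mmap f k : {rmorphism _ -> _}) _).
    rewrite (rmorph_tower_eval (f' := f)) => [|a]; last by rewrite /= mmapC.
    apply: eq_tower_eval => // j jn.
    by rewrite /= -[j]/(val (Ordinal jn)) !extend0E mmapX mmap1U.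
  pose W := lift w; pose p := b%:MP * pm W * pm r.
  have pP : is_lift p (rb * W * r).
    move=> S f k; rewrite -[LHS]/((mmap f k : {rmorphism _ -> _}) _) !rmorphM /=.
    by rewrite rbP !pmP.
  have phirb : phi rb = b%:A by have := rbP _ phi0 g; rewrite mmapC => <-.
  have relp : relation g p.
    rewrite /relation (pP _ phi0) -/phi !rmorphM /= -/phi phirb liftK.
    by rewrite -mulrA mulr_algl.
  have Qt : Q (taylor iota g x p).
    apply/hol_idealP; exists [:: ((1 : E), p)]; split; last by rewrite big_seq1 mul1r.
    move=> _ /predU1P[->|//]; split=> //; exact: subring1 (convergent_subring C n).
  pose F := germ iota c (extend0 (@mvar C n)) n (rb * W).
  have cF : convergent F by apply: germ_convergent => j _; apply: convergent_X.
  have F0 : mcoef0 F != 0.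
    rewrite germ_coef0 => [|j _]; last exact: mcoef0_X.
    rewrite -xE rmorphM /= -/phi phirb liftK mulr_algl [xf _](xfZ b w) /= mulf_neq0 //.
    apply/eqP => xw; apply: Pw; rewrite -[w]liftK; apply/kerP; exact: xw.
  have [G [cG _] FG] := analytic_inverse (analytic_convergent cF) F0.
  have -> : germ iota c (extend0 (@mvar C n)) n r = G * (taylor iota g x p : E).
    by rewrite (tayE _ _ pP) [X in G * X]rmorphM mulrA -/F [G * F]mulrC FG mul1r.
  by case: iQ => _ _; apply.
have ch j : convergent (hh j) by case: (hP j (ltn_ord j)) => -[].
have sh j : supported I (hh j) by case: (hP j (ltn_ord j)) => -[].
have hI (j : 'I_n) : I j -> hh j = mvar C j.
  by case: (hP j (ltn_ord j)) => _ _ H /H; rewrite extend0E.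
have Qh (j : 'I_n) : Q (mvar C j - hh j).
  by have := idealh Q iQ Q_germ j (ltn_ord j); rewrite extend0E.
have allD k (F : series C k) : convergent F -> hol D F.
  by move=> cF; split=> // m; exists (F m), 1%N; rewrite divr1.
exists #|[pred j : 'I_n | I j]|, (@coordinates C n I); split.
- move=> i; split; first by apply: allD; apply: convergent_var.
  exact: mcoef0_var.
- move=> F [_ cF]; have cF' : convergent (msubst hh F) by apply: msubst_convergent.
  exists (msubst hh F \o @monom_embed n I).
    by apply: allD; apply: convergent_embed.
  have -> : (fun m => F m - scomp (msubst hh F \o @monom_embed n I) (@coordinates C n I) m) =
      (F : E) - msubst hh F.
    rewrite supported_scomp //; exact: msubst_supported.
  have [R cR ->] := msubst_difference hh0 ch cF.
  rewrite -[hol_ideal _ _ _ _ _]/(Q _); apply: germ_ideal_sum => // j.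
  by rewrite mulrC; case: iQ => _ _; apply.
- move=> G _ QG a.
  have F0 : scomp G (@coordinates C n I) = (0 : E).
    rewrite -(msubst_id hI (@scomp_supported C n I G)).
    have /hol_idealP[s [sP ->]] := QG.
    rewrite msubst_sum big_seq big1 // => Gp /sP[cG rG].
    rewrite (msubstM hh0); have [r rp] := tower_mpoly Gp.2.
    rewrite (substE _ _ rp) [germ _ _ _ _ _]kerT ?mulr0 //; apply/kerP.
    have -> : phi r = 0 by rewrite -[LHS](rp _ phi0); exact: rG.
    by case: primeP => -[].
  have := congr1 (fun F : E => F (monom_embed a)) F0.
  rewrite /= scomp_coordinates monom_embedK; case: forallP => // no _.
  by case: no => j; apply/implyP; apply: monom_embed_supp.
Qed.

End SmoothPoint.

(** * Denominators *)

Lemma logn_fact_le p n : prime p -> (logn p n`! <= n)%N.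
Proof.
move=> pp; rewrite logn_fact //.
have H K : (\sum_(1 <= k < K.+1) n %/ p ^ k + n %/ p ^ K <= n)%N.
  elim: K => [|K IH]; first by rewrite big_geq // add0n expn0 divn1.
  rewrite big_nat_recr //= -addnA; apply: leq_trans IH; rewrite leq_add2l.
  rewrite expnSr divnMA; set a := (n %/ p ^ K)%N.
  apply: leq_trans (leq_trunc_div a p); rewrite addnn -mul2n mulnC.
  by rewrite leq_mul2l prime_gt1 ?orbT.
exact: leq_trans (leq_addr _ _) (H n).
Qed.

(** Separate the primes that divide [d]: their exponents in [m!] are at most [m], by
    Legendre's formula. *)
Lemma fact_split d m : (0 < d)%N -> exists m1 m2 e,
  [/\ m`! = (m1 * m2)%N, (d ^ m = m1 * e)%N & coprime d m2].
Proof.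
move=> d0; exists ((m`!)`_\pi(d))%N, ((m`!)`_\pi(d)^')%N, (d ^ m %/ (m`!)`_\pi(d))%N; split.
- by rewrite partnC // fact_gt0.
- rewrite mulnC divnK //; apply/dvdn_partP => [|p]; first exact: part_gt0.
  rewrite mem_primes => /and3P[pp _ pm].
  have pd : (p %| d)%N.
    have : p \in \pi(((m`!)`_\pi(d))%N) by rewrite mem_primes pp part_gt0 pm.
    move/(pnatP _ (part_gt0 _ _)): (part_pnat \pi(d) m`!) => H _.
    by have := H p pp pm; rewrite mem_primes => /and3P[].
  rewrite p_part (dvdn_trans (dvdn_exp2l p _) (dvdn_exp2r _ pd)) //.
  apply: leq_trans (logn_fact_le m pp).
  by apply: dvdn_leq_log; rewrite ?fact_gt0 // dvdn_part.
- by rewrite coprime_pi' ?part_gt0 // part_pnat.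
Qed.

Section Torsion.
Variables (A : comNzRingType) (O : comAlgType A).
Hypothesis A_domain : forall a b : A, a * b = 0 -> a = 0 \/ b = 0.

(** The kernel of the map to the base change to the quotient field of [A]. *)
Definition torsion (f : O) : Prop := exists2 b : A, b != 0 & b *: f = 0.

Lemma torsion_ideal : ideal torsion.
Proof.
split.
- by exists 1; rewrite ?oner_neq0 // scaler0.
- move=> f h [a a0 af] [b b0 bh]; exists (a * b).
    by apply/eqP => /A_domain[] /eqP; rewrite ?(negPf a0) ?(negPf b0).
  by rewrite scalerDr mulrC -scalerA af scaler0 mulrC -scalerA bh scaler0 addr0.
- by move=> c f [b b0 bf]; exists b; rewrite // scalerAr bf mulr0.
Qed.

Lemma torsion_eq_generic f h : torsion (f - h) -> eq_generic f h.
Proof.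
by case=> b b0 /eqP; rewrite scalerBr subr_eq0 => /eqP E; exists b.
Qed.

Lemma torsion_scale (a : A) f : a != 0 -> torsion (a *: f) -> torsion f.
Proof.
move=> a0 [b b0 E]; exists (b * a); last by rewrite -scalerA.
by apply/eqP => /A_domain[] /eqP; rewrite ?(negPf a0) ?(negPf b0).
Qed.

Hypothesis O_noetherian : noetherian O.
Local Notation T0 := torsion_ideal.

(** The ideal of the [f] some integral multiple of which lies in [N O] is finitely
    generated, hence one integer [d] works for all its elements.  This [d] kills the
    integral torsion of [O/N O], so [N] remains a nonzerodivisor modulo the integers
    coprime to [d]. *)
Lemma coprime_cancel (N : O) : (forall y, torsion (N * y) -> torsion y) ->
  exists2 d, (0 < d)%N & forall q y h m, coprime d q -> (0 < q)%N ->
    torsion (N ^+ m * y - h *+ q) -> exists h', torsion (y - h' *+ q).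
Proof.
move=> nzd; case: (T0) => t0 tD tM.
pose I f := exists2 k, (0 < k)%N & exists y, torsion (f *+ k - N * y).
have [|s sI sg] := O_noetherian (I := I).
  split.
  - by exists 1%N => //; exists 0; rewrite mulr0 mulr1n subrr.
  - move=> f1 f2 [k1 k10 [y1 H1]] [k2 k20 [y2 H2]]; exists (k1 * k2)%N.
      by rewrite muln_gt0 k10.
    exists (y1 *+ k2 + y2 *+ k1).
    have -> : (f1 + f2) *+ (k1 * k2) - N * (y1 *+ k2 + y2 *+ k1) =
      k2%:R * (f1 *+ k1 - N * y1) + k1%:R * (f2 *+ k2 - N * y2).
      by ring.
    by apply: (tD); apply: (tM).
  - move=> c f [k k0 [y H]]; exists k => //; exists (c * y).
    have -> : (c * f) *+ k - N * (c * y) = c * (f *+ k - N * y).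
      by ring.
    exact: (tM).
pose Id d f := exists y, torsion (f *+ d - N * y).
have Id_ideal d : ideal (Id d).
  split.
  - by exists 0; rewrite mulr0 mul0rn subrr.
  - move=> f1 f2 [y1 H1] [y2 H2]; exists (y1 + y2).
    have -> : (f1 + f2) *+ d - N * (y1 + y2) = (f1 *+ d - N * y1) + (f2 *+ d - N * y2).
      by ring.
    exact: (tD).
  - move=> c f [y H]; exists (c * y).
    have -> : (c * f) *+ d - N * (c * y) = c * (f *+ d - N * y).
      by ring.
    exact: (tM).
have [d d0 dI] : exists2 d, (0 < d)%N & forall f, f \in s -> Id d f.
  have IdM d e f : Id d f -> Id (d * e)%N f.
    move=> [y H]; exists (y *+ e).
    have -> : f *+ (d * e) - N * (y *+ e) = e%:R * (f *+ d - N * y).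
      by ring.
    exact: (tM).
  elim: (s) sI => [|f s' IH] sI; first by exists 1%N.
  have [|d d0 dI] := IH; first by move=> h hs; apply: sI; rewrite inE hs orbT.
  have [k k0 Hk] := sI f (mem_head _ _).
  exists (d * k)%N => [|h]; first by rewrite muln_gt0 d0.
  rewrite inE => /orP[/eqP ->|/dI]; last exact: IdM.
  by rewrite mulnC; apply: IdM.
have {}dI f : I f -> Id d f by move=> /sg; apply.
exists d => // q y h m dq q0; elim: m y h => [|m IH] y h.
  by rewrite expr0 mul1r; exists h.
rewrite exprS -mulrA => H.
have [y' Hy'] : Id d h.
  apply: dI; exists q => //; exists (N ^+ m * y).
  by rewrite -opprB; apply: idealN.
have qd : coprime q d by rewrite coprime_sym.
have [a b abE _] := egcdnP d q0; move: abE; rewrite (eqP qd) => abE.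
pose h' := (N ^+ m * y) *+ a - y' *+ b.
apply: (IH y h'); apply: nzd.
have abR : a%:R * q%:R = b%:R * d%:R + 1 :> O by rewrite -!natrM abE natrD.
have -> : N * (N ^+ m * y - h' *+ q) =
   (1 - a%:R * q%:R) * (N * (N ^+ m * y) - h *+ q) - b%:R * q%:R * (h *+ d - N * y')
   + (1 - a%:R * q%:R + b%:R * d%:R) * (h *+ q).
  by rewrite /h'; ring.
have -> : 1 - a%:R * q%:R + b%:R * d%:R = 0 :> O by rewrite abR; ring.
by rewrite mul0r addr0; apply: idealB => //; apply: (tM).
Qed.

(** For the [d] of the preceding lemma, [m!] divides the product of [d^m] and an
    integer coprime to [d], and the latter divides [y] when [m!] divides [N^m y]. *)
Lemma integral_denominator (N : O) : (forall y, torsion (N * y) -> torsion y) ->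
  exists2 d, (0 < d)%N & forall m y h, torsion (N ^+ m * y - h *+ m`!) ->
    exists h', torsion (h' *+ m`! - y *+ (d ^ m)%N).
Proof.
move=> /coprime_cancel[d d0 cancel]; exists d => // m y h H.
have [m1 [m2 [e [mE dE dm2]]]] := fact_split m d0.
have m20 : (0 < m2)%N by have := fact_gt0 m; rewrite mE muln_gt0 => /andP[].
have [|h' H'] := cancel m2 y (h *+ m1) m dm2 m20; first by rewrite -mulrnA -mE.
case: (T0) => _ _ tM; exists (h' *+ e).
have -> : (h' *+ e) *+ m`! - y *+ d ^ m = - (m1 * e)%:R * (y - h' *+ m2).
  by rewrite mE dE; ring.
exact: (tM).
Qed.

Hypothesis O_reduced : forall f m, torsion (f ^+ m) -> torsion f.
Variable v : {linear O -> O}.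

Definition denominator (N : O) : Prop :=
  forall m f, exists h, torsion (N ^+ m * iter m v f - h *+ m`!).

Lemma torsion_expD (N M : O) m : torsion (N * M) -> (0 < m)%N ->
  torsion ((N + M) ^+ m - (N ^+ m + M ^+ m)).
Proof.
case: (T0) => t0 tD tM NM; case: m => // m _; elim: m => [|m IH].
  by rewrite !expr1 subrr.
have -> : (N + M) ^+ m.+2 - (N ^+ m.+2 + M ^+ m.+2) =
    (N + M) * ((N + M) ^+ m.+1 - (N ^+ m.+1 + M ^+ m.+1)) +
    (N ^+ m + M ^+ m) * (N * M).
  by rewrite !exprS; ring.
by apply: (tD); apply: (tM).
Qed.

(** Take a denominator [N] with the largest double annihilator.  If it is a zero
    divisor, let [P] be maximal among the annihilators of elements [w] killed by [N]:
    it is prime, and [w] is not in [P] as the ring is reduced.  For a denominator [M] at [P], the sum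
    [N + w M] is a denominator again, since [N w] vanishes, and its double
    annihilator is larger, since [w] does not kill it. *)
Lemma nonzerodivisor_denominator :
  (forall (P : O -> Prop) (w : O), prime_ideal P -> (forall a : A, P a%:A <-> a = 0) ->
     ~ P w -> (forall f, P f -> torsion (w * f)) ->
     exists2 M, ~ P M & forall m f, exists h, P (M ^+ m * iter m v f - h *+ m`!)) ->
  exists2 N, denominator N & forall y, torsion (N * y) -> torsion y.
Proof.
move=> local; case: (T0) => t0 tD tM.
have den0 : denominator 0.
  move=> [|m] f; first by exists f; rewrite mul1r subrr.
  by exists 0; rewrite expr0n mul0r mul0rn subrr.
pose F1 (N : {N : O | denominator N}) y :=
  forall a, torsion (a * sval N) -> torsion (a * y).
have [|[N dN] /= maxN] := noetherian_max (F := F1) (exist _ 0 den0) O_noetherian.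
  move=> N; split.
  - by move=> a _; rewrite mulr0.
  - by move=> f h Ff Fh a aN; rewrite mulrDr; apply: (tD); [apply: Ff|apply: Fh].
  - by move=> c f Ff a aN; rewrite mulrCA; apply: (tM); apply: Ff.
exists N => // y0 Ny0; apply: contrapT => y0t.
pose good w := ~ torsion w /\ torsion (w * N).
have gy0 : good y0 by rewrite /good mulrC.
pose F2 (w : {w : O | good w}) f := torsion (f * sval w).
have [|[w [wt wN]] maxw] := noetherian_max (F := F2) (exist _ y0 gy0) O_noetherian.
  move=> w; split; first by rewrite /F2 mul0r.
  - by move=> f h Ff Fh; rewrite /F2 mulrDl; apply: (tD).
  - by move=> c f Ff; rewrite /F2 -mulrA; apply: (tM).
pose P f := torsion (f * w).
have iP : ideal P.
  split; first by rewrite /P mul0r.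
  - by move=> f h Ff Fh; rewrite /P mulrDl; apply: (tD).
  - by move=> c f Ff; rewrite /P -mulrA; apply: (tM).
have Pw : ~ P w by rewrite /P -expr2 => /O_reduced.
have primeP : prime_ideal P.
  split=> // [|f h Pfh]; first by rewrite /P mul1r.
  have [Ph|Ph] := pselect (P h); first by right.
  have ghw : good (h * w) by split=> //; rewrite -mulrA; apply: (tM).
  left; apply: (maxw (exist _ (h * w) ghw)) => [f' Pf'|].
    by rewrite /F2 /= mulrCA; apply: (tM).
  by rewrite /F2 /= mulrA.
have Pconst (a : A) : P a%:A <-> a = 0.
  split=> [|->]; last by rewrite scale0r /P mul0r.
  move=> Pa; apply/eqP; apply: contraT => a0; case: (wt).
  by apply: (torsion_scale a0); move: Pa; rewrite /P mulr_algl.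
have [|M PM HM] := local P w primeP Pconst Pw.
  by move=> f; rewrite /P mulrC.
have PwM : ~ P (w * M) by case: primeP => _ _ PP /PP[].
have NwM : torsion (N * (w * M)).
  have -> : N * (w * M) = M * (w * N) by ring.
  exact: (tM).
have dN' : denominator (N + w * M).
  move=> [|m] f; first by exists f; rewrite mul1r subrr.
  have [h Hh] := dN m.+1 f; have [k Hk] := HM m.+1 f.
  exists (h + w ^+ m.+1 * k).
  have -> : (N + w * M) ^+ m.+1 * iter m.+1 v f - (h + w ^+ m.+1 * k) *+ (m.+1)`! =
    iter m.+1 v f * ((N + w * M) ^+ m.+1 - (N ^+ m.+1 + (w * M) ^+ m.+1)) +
    (N ^+ m.+1 * iter m.+1 v f - h *+ (m.+1)`!) +
    w ^+ m * ((M ^+ m.+1 * iter m.+1 v f - k *+ (m.+1)`!) * w).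
    by rewrite [(w * M) ^+ _]exprMn [w ^+ m.+1]exprSr; ring.
  apply: (tD); last exact: (tM).
  by apply: (tD) => //; apply: (tM); apply: torsion_expD.
have := maxN (exist _ _ dN'); rewrite /F1 /= => max.
apply: PwM; rewrite /P.
have : torsion (w * (N + w * M)).
  apply: max => // y Fy a aN'; apply: Fy.
  apply: (O_reduced (m := 2)).
  have -> : (a * N) ^+ 2 = a * N * (a * (N + w * M)) - (a ^+ 2 * M) * (w * N) by ring.
  by apply: idealB => //; apply: (tM).
have -> : w * (N + w * M) = w * N + w * M * w by ring.
move=> H; rewrite -[_ * w](addKr (w * N)) addrC; exact: idealB.
Qed.

End Torsion.

(** * Integrality of the iterates of a vector field *)

Lemma int_enumerable : enumerable int.
Proof.
exists (fun i => odflt 0 (unpickle i)) => z; exists (pickle z).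
by rewrite pickleK.
Qed.

Lemma finitely_generated_surj (k S : comNzRingType) (f : {rmorphism k -> S}) n
    (g : 'I_n -> S) :
  generates (f : k -> S) g -> forall s, exists r, tower_eval f (extend0 g) n r = s.
Proof.
move=> gen s; have [p <-] := gen s; have [r rp] := tower_mpoly p.
by exists r; rewrite rp.
Qed.

Lemma finitely_generated_enumerable (A : comNzRingType) :
  finitely_generated_over_Z A -> enumerable A.
Proof.
case=> n [g gen]; apply: enumerable_surj (enumerable_tower n int_enumerable).
exact: (finitely_generated_surj (f := intr) gen).
Qed.

Lemma finitely_generated_noetherian (A : comNzRingType) (O : comAlgType A) n (g : 'I_n -> O) :
  finitely_generated_over_Z A -> generates (in_alg O : A -> O) g -> noetherian O.
Proof.
case=> n' [g' gen'] gen.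
have nA : noetherian A.
  apply: noetherian_quotient (finitely_generated_surj (f := intr) gen') _.
  exact: tower_noetherian int_noetherian.
apply: noetherian_quotient (finitely_generated_surj (f := in_alg O) gen) _.
exact: tower_noetherian nA.
Qed.

Section Solutions.
Variables (C : numFieldType) (A : comNzRingType) (iota : {rmorphism A -> C}).
Variables (O : comAlgType A) (v : {linear O -> O}) (v_der : derivation v).

Lemma image_subring (R : comNzRingType) (x : {rmorphism R -> C}) :
  subring (fun c => exists r, c = x r).
Proof.
split.
- by exists 1; rewrite rmorph1.
- by move=> _ _ [a ->] [b ->]; exists (a + b); rewrite rmorphD.
- by move=> _ [a ->]; exists (- a); rewrite rmorphN.
- by move=> _ _ [a ->] [b ->]; exists (a * b); rewrite rmorphM.
Qed.

(** Both sides satisfy the recursion given by the vector field. *)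
Lemma solution_unique (D : C -> Prop) (y : {rmorphism O -> C}) (phi : O -> nat -> C) :
  solution iota D v y phi -> forall f, phi f = solution_series v y f.
Proof.
case=> _ phi0 phid f; apply: funext => m; elim: m f => [|m IH] f.
  by rewrite phi0 /solution_series divr1.
have m0 : m.+1%:R != 0 :> C by rewrite pnatr_eq0.
apply: (mulIf m0); rewrite !mulr_natr.
by rewrite -[LHS]/(deriv1 (phi f) m) -phid IH solution_derive.
Qed.

Lemma solution_exists n (g : 'I_n -> O) (x : {lrmorphism O -> C | iota \; *%R}) :
  generates (in_alg O : A -> O) g ->
  solution iota (@all_scalars C) v x (solution_series v x).
Proof.
move=> gen; split; first split.
- move=> f; split; last exact: (solution_convergent v_der x gen).
  by move=> m; exists (solution_series v x f m), 1%N; rewrite divr1.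
- move=> a m; rewrite (solution_scalar v_der).
  by have <- : x a%:A = iota a by rewrite (linearZ_LR x) /= rmorph1 mulr1.
- by move=> f h m; rewrite solutionD.
- by move=> f h m; rewrite (solutionM v_der).
- by move=> f; rewrite /solution_series divr1.
- by move=> f m; rewrite solution_derive.
Qed.

(** The witness is [z - x(z)], a function on the base change. *)
Lemma nonvanishing_slice (x : {lrmorphism O -> C | iota \; *%R}) (z : O) :
  v z = 1 -> nonvanishing_at (@all_scalars C) v x.
Proof.
move=> vz; exists 2%N, (fun i => if i == ord0 then 1 else - x z),
  (fun i => if i == ord0 then z else 1); split=> //.
  by rewrite !big_ord_recl big_ord0 /= rmorph1 mul1r mulr1 addr0 subrr.
rewrite !big_ord_recl big_ord0 /= vz mul1r rmorph1 addr0.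
have -> : v 1 = 0 by have := derivation_scalar v_der 1; rewrite scale1r.
by rewrite rmorph0 mulr0 addr0 oner_eq0.
Qed.

End Solutions.

Local Open Scope complex_scope.

Theorem theorem6p3
    (K : realType)
    (A : comNzRingType) (iota : {rmorphism A -> K[i]})
    (iota_inj : injective iota) (A_fg : finitely_generated_over_Z A)
    (O : comAlgType A)
    (n : nat) (g : 'I_n -> O) (g_gen : generates (in_alg O : A -> O) g)
    (t : {lrmorphism O -> A | *%R})
    (t_smooth : smooth_at iota g (image_iota iota) (fun f => iota (t f)))
    (v : {linear O -> O}) (v_der : derivation v)
    (v_t : nonvanishing_at (image_iota iota) v (fun f => iota (t f)))
    (z : O) (t_z : t z = 0) (v_z : v z = 1) :
  (forall phi : O -> nat -> K[i],
     solution iota (image_iota iota) v (fun f => iota (t f)) phi ->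
     algebraic_solution phi ->
     exists2 N : A, N != 0 &
       forall (m : nat) (f : O), exists a : A,
         iota N ^+ m * iota (t (iter m v f)) / (m`!)%:R = iota a)
  /\
  (generically_reduced O ->
   (forall x : {lrmorphism O -> K[i] | iota \; *%R},
      smooth_at iota g (@all_scalars _) x ->
      nonvanishing_at (@all_scalars _) v x ->
      forall phi : O -> nat -> K[i],
        solution iota (@all_scalars _) v x phi -> algebraic_solution phi) ->
   exists2 N : nat, (0 < N)%N &
     forall (m : nat) (f : O), exists h : O,
       eq_generic (h *+ m`!) (iter m v f *+ (N ^ m)%N)).
Proof.
have iota0 a : iota a = 0 -> a = 0 by move=> ia; apply: iota_inj; rewrite ia rmorph0.
split.
  move=> phi phi_sol phi_alg.
  pose y : {rmorphism O -> K[i]} := GRing.RMorphism.clone _ _ (iota \o t) _.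
  have phiE := solution_unique (y := y) phi_sol.
  have [|i|_ [[N ->] N0 HN]] := solution_integral v_der (y := y) g_gen (image_subring iota).
  - by move=> f; exists (t f).
  - by rewrite -phiE; apply: phi_alg.
  exists N; first by apply: contraNneq N0 => ->; rewrite rmorph0.
  by move=> m f; have [a Ha] := HN m f; exists a; rewrite -Ha mulrA.
move=> red alg.
have A_domain (a b : A) : a * b = 0 -> a = 0 \/ b = 0.
  move=> /(congr1 iota)/eqP; rewrite rmorphM rmorph0 mulf_eq0.
  by case/orP => /eqP/iota0; [left|right].
have nO := finitely_generated_noetherian A_fg g_gen.
have torsionE (f : O) : torsion f <-> eq_generic f 0.
  by split=> [[b b0 bf]|[b b0 bf]]; exists b => //; rewrite ?scaler0 // bf scaler0.
have O_red (f : O) m : torsion (f ^+ m) -> torsion f.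
  by move/torsionE/red/torsionE.
have [|N dN nzd] := nonzerodivisor_denominator A_domain nO O_red (v := v).
  move=> P w primeP Pconst Pw wP.
  have [||x [kerx smooth_x]] := smooth_generic_point (iota := iota) g_gen
    (finitely_generated_enumerable A_fg) (@complex_transcendentals K) primeP _ Pw.
  - move=> a; rewrite Pconst; split=> [->|/iota0 //]; exact: rmorph0.
  - move=> f /wP[b b0 bf]; exists b => //.
    by apply: contraNneq b0 => /iota0 ->.
  have sol := solution_exists v_der x g_gen.
  have salg := alg x smooth_x (nonvanishing_slice v_der x v_z) _ sol.
  have [f|i|_ [[M ->] M0 HM]] := solution_integral v_der (y := x) g_gen (image_subring x).
  - by exists f.
  - exact: salg.
  exists M; first by move/kerx => xM; case/eqP: M0.
  move=> m f; have [h Hh] := HM m f; exists h; apply/kerx.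
  have fact0 : (m`!)%:R != 0 :> K[i] by rewrite pnatr_eq0 -lt0n fact_gt0.
  rewrite rmorphB rmorphMn rmorphM rmorphXn /= -mulr_natr -Hh /solution_series.
  by rewrite -mulrA divfK // subrr.
have [d d0 Hd] := integral_denominator A_domain nO nzd.
exists d => // m f; have [h Hh] := dN m f; have [h' Hh'] := Hd m _ h Hh.
by exists h'; apply: torsion_eq_generic.
Qed.
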